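(* Let $(L,A)$ be a Lie pair, $B=L/A$, and let $j:B\to L$ be a splitting of $0\to A\xrightarrow{i}L\xrightarrow{q}B\to0$. The operators $P_0:\Gamma(\pi^!L)\to\Gamma(\Lambda^\bullet A^\vee\otimes B)$, $I_0:\Gamma(\Lambda^\bullet A^\vee\otimes B)\to\Gamma(\pi^!L)$ and $H_0:\Gamma(\pi^!L)\to\Gamma(\pi^!L)[-1]$ constitute $\Gamma(\Lambda^\bullet A^\vee)$-linear contraction data of $\big(\Gamma(\pi^!L),\mathcal Q\big)$ onto $\big(\Gamma(\Lambda^\bullet A^\vee\otimes B),d_A\big)$, where $\mathcal Q=[s,\,\cdot\,]$ is the coboundary operator induced by the section $s=(d_A,\boldsymbol i)$ of $\pi^!L$, and $d_A$ is the Chevalley–Eilenberg differential of the Bott representation of $A$ on $B$.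
   Context: $\mathbb K\in\{\mathbb R,\mathbb C\}$; $M$ a smooth manifold. A Lie pair $(L,A)$ is a Lie algebroid $L\to M$ over $\mathbb K$ with a Lie subalgebroid $i:A\hookrightarrow L$ over $M$. $A[1]$ is the graded manifold with $C^\infty(A[1])=\Gamma(\Lambda^\bullet A^\vee)$, $\pi:A[1]\to M$ the projection, $\mathfrak X(A[1])$ the graded derivations of $\Gamma(\Lambda^\bullet A^\vee)$, $d_A$ the Chevalley–Eilenberg differential. $p:L\to A$ is the projection with kernel $j(B)$. Bott connection: $\nabla^{\rm Bott}_aq(v)=q([a,v])$, $a\in\Gamma(A)$, $v\in\Gamma(L)$. Homogeneous sections of the pull-back Lie algebroid $\pi^!L\cong T_{A[1]}\times_{T_M}L\to A[1]$ are pairs $(X,\nu)$, $X\in\mathfrak X(A[1])$, $\nu=\sum_k\xi_k\otimes v_k\in\Gamma(\Lambda^\bullet A^\vee\otimes L)$ of the same degree, with $X(f)=\sum_k\rho_L(v_k)(f)\xi_k$ for all $f\in C^\infty(M)$. Bracket: $[(X,\nu),(X',\nu')]=([X,X'],\sum_jX(\xi'_j)\otimes l'_j-(-1)^{|X||X'|}\sum_iX'(\xi_i)\otimes l_i+\sum_{i,j}\xi_i\wedge\xi'_j\otimes[l_i,l'_j])$ for $\nu=\sum\xi_i\otimes l_i$, $\nu'=\sum\xi'_j\otimes l'_j$. $\boldsymbol i=\sum_k\xi^k\otimes i(e_k)$ for dual local frames $(e_k),(\xi^k)$ of $A,A^\vee$. $P_0(X,\nu)=\sum_k\xi_k\otimes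 q(v_k)$ for $\nu=\sum_k\xi_k\otimes v_k$. For $b\in\Gamma(B)$, $\Delta_b$ is the degree $0$ derivation of $\Gamma(\Lambda^\bullet A^\vee)$ with $\Delta_bf=\rho_L(j(b))f$ for $f\in C^\infty(M)$ and $\langle\Delta_b\xi,a\rangle=\rho_L(j(b))\langle\xi,a\rangle-\langle\xi,p[j(b),i(a)]\rangle$ for $\xi\in\Gamma(A^\vee)$, $a\in\Gamma(A)$; $I_0(\sum_k\xi_k\otimes b_k)=(\sum_k\xi_k\Delta_{b_k},\sum_k\xi_k\otimes j(b_k))$. $H_0(X,\nu)=\big(\sum_k(-1)^{|\xi_k|}\xi_k\,\iota_{p(v_k)},0\big)$, where $\iota_a$ is the interior product by $a\in\Gamma(A)$. A contraction of a cochain complex $(C,\delta)$ onto $(K,\delta_K)$ consists of cochain maps $P:C\to K$, $I:K\to C$ and a degree $-1$ operator $H$ on $C$ with $PI=\mathrm{id}$, $IP=\mathrm{id}-(H\delta+\delta H)$, $H^2=0$, $HI=0$, $PH=0$. $\Gamma(\Lambda^\bullet A^\vee)$-linearity is in the graded sense ($H(fx)=(-1)^{|f|}fH(x)$). *)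

(* Defs.v *)
From HB Require Import structures.
From mathcomp Require Import all_boot all_order all_algebra.
From mathcomp Require Import complex.
From mathcomp Require Import boolp classical_sets functions reals.
From mathcomp Require Import topology normedtype landau derive.

Set Implicit Arguments.
Unset Strict Implicit.
Unset Printing Implicit Defensive.

Import Order.TTheory GRing.Theory Num.Theory.
Import numFieldNormedType.Exports.

Local Open Scope classical_set_scope.
Local Open Scope ring_scope.

Section SmoothEuclidean.
Context {R : realType} {n : nat}.
Implicit Types (U : set 'rV[R]_n) (f g : 'rV[R]_n -> R) (k : nat).

Fixpoint Ck k U f : Prop :=
  if k is k'.+1 then
    (forall x, U x -> differentiable f x) /\ (forall v, Ck k' U ('D_v f))
  else forall x, U x -> {for x, continuous f}.

Definition smooth_on U f := forall k, Ck k U f.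

Lemma near_eq_differentiable f g x :
  {near x, f =1 g} -> differentiable f x -> differentiable g x.
Proof.
move=> fg df.
have fgx : g x = f x by rewrite (nbhs_singleton fg).
have E : g \o shift x = cst (g x) + 'd f x +o_ 0 id.
  apply/eqaddoP => e e0.
  have := diff_locally df => /eqaddoP /(_ e e0) H.
  have fg0 : \forall y \near 0, f (y + x) = g (y + x).
    by move/nbhs0P: fg; apply: filterS => y; rewrite addrC.
  near=> y.
  suff -> : (g \o shift x - (cst (g x) + 'd f x)) y =
            (f \o shift x - (cst (f x) + 'd f x)) y by near: y.
  rewrite !fctE /= fgx; congr (_ - _).
  by apply/esym; near: y.
apply/diff_locallyP; rewrite (diff_unique (diff_continuous df) E).
by split=> //; exact: diff_continuous df.
Unshelve. all: by end_near. Qed.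

Lemma open_near_eq U f g x : open U -> (forall x, U x -> f x = g x) ->
  U x -> {near x, f =1 g}.
Proof.
move=> oU fg Ux; have : nbhs x U by exact: open_nbhs_nbhs.
by rewrite /prop_near1; apply: filterS => y; exact: fg.
Qed.

Lemma Ck_ext k U f g : open U -> (forall x, U x -> f x = g x) ->
  Ck k U f -> Ck k U g.
Proof.
move=> oU; elim: k f g => [|k IH] f g fg /=.
  move=> cf x Ux; rewrite /prop_for /continuous_at -(fg _ Ux).
  exact: cvg_trans (near_eq_cvg (open_near_eq oU fg Ux)) (cf x Ux).
move=> [df Df]; split=> [x Ux|v].
  exact: near_eq_differentiable (open_near_eq oU fg Ux) (df x Ux).
by apply: IH (Df v) => x Ux; apply: near_eq_derive; exact: open_near_eq oU fg Ux.
Qed.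

Lemma Ck_pred k U f : Ck k.+1 U f -> Ck k U f.
Proof.
elim: k f => [|k IH] f [df Df]; first by move=> x /df /differentiable_continuous.
by split=> // v; exact: IH (Df v).
Qed.

Lemma Ck_cst k U (a : R) : Ck k U (fun=> a).
Proof.
elim: k a => [|k IH] a; first by move=> x _; exact: cst_continuous.
split=> [x _|v]; first exact: differentiable_cst.
suff -> : 'D_v (fun=> a) = fun=> 0 by exact: IH.
by apply/funext => x; exact: derive_cst.
Qed.

Lemma CkD k U f g : open U -> Ck k U f -> Ck k U g ->
  Ck k U (fun x => f x + g x).
Proof.
move=> oU; elim: k f g => [|k IH] f g.
  by move=> cf cg x Ux; exact: (continuousD (cf x Ux) (cg x Ux)).
move=> [df Df] [dg Dg]; split=> [x Ux|v].
  by apply: differentiableD; [exact: df|exact: dg].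
apply: (Ck_ext oU _ (IH _ _ (Df v) (Dg v))) => x Ux; apply/esym.
by apply: deriveD; apply: diff_derivable; [exact: df|exact: dg].
Qed.

Lemma CkM k U f g : open U -> Ck k U f -> Ck k U g ->
  Ck k U (fun x => f x * g x).
Proof.
move=> oU; elim: k f g => [|k IH] f g.
  by move=> cf cg x Ux; exact: (continuousM (cf x Ux) (cg x Ux)).
move=> fk gk; have [df Df] := fk; have [dg Dg] := gk; split=> [x Ux|v].
  by apply: differentiableM; [exact: df|exact: dg].
apply: (Ck_ext oU _ (CkD oU (IH _ _ (Ck_pred fk) (Dg v))
                            (IH _ _ (Ck_pred gk) (Df v)))) => x Ux.
apply/esym; rewrite -[LHS]/('D_v (f * g) x) deriveM //.
- by apply: diff_derivable; exact: df.
- by apply: diff_derivable; exact: dg.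
Qed.

End SmoothEuclidean.

Record chart (R : realType) (n : nat) (M : topologicalType) := Chart {
  cdom : set M;
  cmap : M -> 'rV[R]_n;
  cinv : 'rV[R]_n -> M;
  cdom_open : open cdom;
  cimg_open : open (cmap @` cdom);
  cmapK : {in cdom, cancel cmap cinv};
  cmap_cts : forall m, cdom m -> {for m, continuous cmap};
  cinv_cts : forall x, (cmap @` cdom) x -> {for x, continuous cinv} }.

(* The atlas is not required to be maximal: compatible atlases have the same
   smooth functions. *)
Record manifold (R : realType) := Manifold {
  mcarrier :> topologicalType;
  mdim : nat;
  atlas : set (chart R mdim mcarrier);
  m_hausdorff : hausdorff_space mcarrier;
  m_second_countable : @second_countable mcarrier;
  atlas_cover : forall m : mcarrier, exists2 c, atlas c & cdom c m;
  atlas_smooth : forall c c', atlas c -> atlas c' -> forall i,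
    smooth_on (cmap c @` (cdom c `&` cdom c'))
      (fun x => cmap c' (cinv c x) 0 i) }.

Arguments atlas {R M} : rename.

Lemma chart_img_open (R : realType) n (M : topologicalType) (c : chart R n M)
  (U : set M) : open U -> open (cmap c @` (cdom c `&` U)).
Proof.
move=> oU; have K m : cdom c m -> cinv c (cmap c m) = m.
  by move=> dm; apply: cmapK; rewrite inE.
rewrite openE => x [m [dm Um] <-]; rewrite /interior.
have xi : (cmap c @` cdom c) (cmap c m) by exists m.
have Uc : \forall y \near cmap c m, U (cinv c y).
  apply: (cinv_cts xi); rewrite /= K //; exact: open_nbhs_nbhs.
have Ic : \forall y \near cmap c m, (cmap c @` cdom c) y.
  by apply: open_nbhs_nbhs; split => //; exact: cimg_open.
apply: filterS2 Uc Ic => y Uy [m' dm' E]; exists m' => //; split=> //.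
by move: Uy; rewrite -E K.
Qed.

Variant ground := RealScalars | ComplexScalars.

Definition scalars (R : realType) (g : ground) : fieldType :=
  match g with RealScalars => R : fieldType | ComplexScalars => R[i] : fieldType end.

Section SmoothFunctions.
Context {R : realType} (M : manifold R).
Implicit Types (U : set M).

Definition rsmooth_on U (f : M -> R) := forall c, atlas c ->
  smooth_on (cmap c @` (cdom c `&` U)) (f \o cinv c).

Definition ksmooth_on (g : ground) U : (M -> scalars R g) -> Prop :=
  match g with
  | RealScalars => fun f => rsmooth_on U f
  | ComplexScalars => fun f => rsmooth_on U (fun m => complex.Re (f m)) /\
                               rsmooth_on U (fun m => complex.Im (f m))
  end.

Lemma rsmooth_onD U f h : open U -> rsmooth_on U f -> rsmooth_on U h ->
  rsmooth_on U (fun m => f m + h m).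
Proof.
move=> oU sf sh c ac k.
exact: (CkD (chart_img_open oU) (sf c ac k) (sh c ac k)).
Qed.

Lemma rsmooth_onM U f h : open U -> rsmooth_on U f -> rsmooth_on U h ->
  rsmooth_on U (fun m => f m * h m).
Proof.
move=> oU sf sh c ac k.
exact: (CkM (chart_img_open oU) (sf c ac k) (sh c ac k)).
Qed.

Lemma rsmooth_on_cst U (a : R) : rsmooth_on U (fun=> a).
Proof. by move=> c ac k; exact: Ck_cst. Qed.

Lemma rsmooth_onN U f : open U -> rsmooth_on U f -> rsmooth_on U (fun m => - f m).
Proof.
move=> oU sf; have := rsmooth_onM oU (rsmooth_on_cst U (-1)) sf.
by congr (rsmooth_on U _); apply/funext => m; rewrite mulN1r.
Qed.

Variable g : ground.

Lemma ksmooth_onD U f h : open U -> @ksmooth_on g U f -> @ksmooth_on g U h ->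
  ksmooth_on U (fun m => f m + h m).
Proof.
case: g f h => /= f h oU; first exact: rsmooth_onD.
move=> [fr fi] [hr hi]; split.
  have := rsmooth_onD oU fr hr; congr (rsmooth_on U _).
  by apply/funext => m; case: (f m); case: (h m).
have := rsmooth_onD oU fi hi; congr (rsmooth_on U _).
by apply/funext => m; case: (f m); case: (h m).
Qed.

Lemma ksmooth_onM U f h : open U -> @ksmooth_on g U f -> @ksmooth_on g U h ->
  ksmooth_on U (fun m => f m * h m).
Proof.
case: g f h => /= f h oU; first exact: rsmooth_onM.
move=> [fr fi] [hr hi]; split.
  have := rsmooth_onD oU (rsmooth_onM oU fr hr)
    (rsmooth_onN oU (rsmooth_onM oU fi hi)).
  congr (rsmooth_on U _).
  by apply/funext => m; case: (f m); case: (h m).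
have := rsmooth_onD oU (rsmooth_onM oU fr hi) (rsmooth_onM oU fi hr).
congr (rsmooth_on U _).
by apply/funext => m; case: (f m); case: (h m).
Qed.

Lemma ksmooth_on_cst U (a : scalars R g) : ksmooth_on U (fun=> a).
Proof. by case: g a => [a|a] /=; [|split]; exact: rsmooth_on_cst. Qed.

Lemma ksmooth_on_sub U V f : U `<=` V -> open U -> open V ->
  @ksmooth_on g V f -> ksmooth_on U f.
Proof.
move=> UV oU oV.
have Hr h : rsmooth_on V h -> rsmooth_on U h.
  move=> sh c ac k; have := sh c ac k.
  have : cmap c @` (cdom c `&` U) `<=` cmap c @` (cdom c `&` V).
    by move=> _ [m [dm Um] <-]; exists m => //; split=> //; exact: UV.
  move: (cmap c @` _) (cmap c @` _) (h \o cinv c) => A B.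
  elim: k => [|k IH] u AB /=; first by move=> H x /AB; exact: H.
  by move=> [d D]; split=> [x /AB|v]; [exact: d|exact: IH].
by case: g f => f /=; [exact: Hr|move=> [? ?]; split; exact: Hr].
Qed.

Definition smooth_pred : {pred M -> scalars R g} :=
  [pred f : M -> scalars R g | `[< ksmooth_on setT f >]].

Lemma smooth_pred_subring : subring_closed smooth_pred.
Proof.
split=> [|f h /asboolP sf /asboolP sh|f h /asboolP sf /asboolP sh].
- exact: asboolT (ksmooth_on_cst setT 1).
- apply: asboolT; have := ksmooth_onD openT sf
    (ksmooth_onM openT (ksmooth_on_cst setT (-1)) sh).
  by congr (ksmooth_on _ _); apply/funext => m; rewrite mulN1r.
- exact: asboolT (ksmooth_onM openT sf sh).
Qed.

(* The ring C^oo(M, K); it is trivial when M is empty. *)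
Record smoothfun := SmoothFun {
  smoothfun_val :> M -> scalars R g;
  smoothfunP : smoothfun_val \in smooth_pred }.

HB.instance Definition _ := [isSub for smoothfun_val].
HB.instance Definition _ := [Choice of smoothfun by <:].
HB.instance Definition _ := GRing.SubChoice_isSubComPzRing.Build
  _ _ smoothfun smooth_pred_subring.

Definition smooth_cst (a : scalars R g) : smoothfun :=
  SmoothFun (asboolT (ksmooth_on_cst setT a) : _ \in smooth_pred).

End SmoothFunctions.

(* [vtriv i m] and [vinv i m] are the restriction to the fibre over [m] of a
   local trivialization over the open set [vdom i], and of its inverse. *)
Record vbundle (R : realType) (M : manifold R) (g : ground) := VBundle {
  vfib :> M -> lmodType (scalars R g);
  vrank : nat;
  vidx : Type;
  vdom : vidx -> set M;
  vtriv : forall (i : vidx) (m : M), {linear vfib m -> 'rV[scalars R g]_vrank};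
  vinv : forall (i : vidx) (m : M), 'rV[scalars R g]_vrank -> vfib m;
  vdom_open : forall i, open (vdom i);
  vdom_cover : forall m, exists i, vdom i m;
  vtrivK : forall i m, vdom i m -> cancel (vtriv i m) (vinv i m);
  vinvK : forall i m, vdom i m -> cancel (vinv i m) (vtriv i m);
  vtransition : forall i i' x k,
    ksmooth_on (vdom i `&` vdom i') (fun m => vtriv i' m (vinv i m x) 0 k) }.

Section Sections.
Context {R : realType} {M : manifold R} {g : ground} (E : vbundle M g).
Local Notation K := (scalars R g).
Local Notation Cinf := (smoothfun M g).

Definition smooth_section (s : forall m, E m) : Prop :=
  forall i k, ksmooth_on (vdom i) (fun m => vtriv i m (s m) 0 k).

Record vsection := VSection {
  vsection_val :> forall m, E m;
  vsectionP : smooth_section vsection_val }.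

Lemma vsection_ext (s t : vsection) : (forall m, s m = t m) -> s = t.
Proof.
case: s t => [s sP] [t tP] /= st.
have {}st : s = t by exact: functional_extensionality_dep.
by case: _ / st tP => tP; congr VSection; exact: Prop_irrelevance.
Qed.

Lemma smooth_sectionZD (f : Cinf) (s t : vsection) :
  smooth_section (fun m => f m *: s m + t m).
Proof.
move=> i k; have oi := @vdom_open _ _ _ E i.
have fi : ksmooth_on (vdom i) f.
  apply: (ksmooth_on_sub (@subsetT _ _) oi openT).
  exact: asboolW (smoothfunP f).
have := ksmooth_onD oi (ksmooth_onM oi fi (vsectionP s i k)) (vsectionP t i k).
by congr (ksmooth_on _ _); apply/funext => m; rewrite linearP !mxE.
Qed.

Lemma smooth_section0 : smooth_section (fun=> 0).
Proof.
move=> i k; have := ksmooth_on_cst (vdom i) (0 : K).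
by congr (ksmooth_on _ _); apply/funext => m; rewrite linear0 mxE.
Qed.

Definition vsection0 := VSection smooth_section0.
Definition vsectionZD f s t := VSection (smooth_sectionZD f s t).

HB.instance Definition _ := gen_eqMixin vsection.
HB.instance Definition _ := gen_choiceMixin vsection.

Let add s t := vsectionZD 1 s t.
Let opp s := vsectionZD (-1) s vsection0.
Let scale f s := vsectionZD f s vsection0.

Let addA : associative add.
Proof. by move=> r s t; apply: vsection_ext => m /=; rewrite !scale1r addrA. Qed.
Let addC : commutative add.
Proof. by move=> s t; apply: vsection_ext => m /=; rewrite !scale1r addrC. Qed.
Let add0 : left_id vsection0 add.
Proof. by move=> s; apply: vsection_ext => m /=; rewrite scale1r add0r. Qed.
Let addN : left_inverse vsection0 opp add.
Proof.
by move=> s; apply: vsection_ext => m /=; rewrite scale1r addr0 scaleN1r addNr.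
Qed.

HB.instance Definition _ := GRing.isZmodule.Build vsection addA addC add0 addN.

Let scaleA f h s : scale f (scale h s) = scale (f * h) s.
Proof. by apply: vsection_ext => m /=; rewrite !addr0 scalerA. Qed.
Let scale1 : left_id 1 scale.
Proof. by move=> s; apply: vsection_ext => m /=; rewrite addr0 scale1r. Qed.
Let scaleDr : right_distributive scale +%R.
Proof.
by move=> f s t; apply: vsection_ext => m /=; rewrite !scale1r !addr0 scalerDr.
Qed.
Let scaleDl s : {morph scale^~ s : f h / f + h}.
Proof.
by move=> f h; apply: vsection_ext => m /=; rewrite !scale1r !addr0 scalerDl.
Qed.

HB.instance Definition _ :=
  GRing.Zmodule_isLmodule.Build Cinf vsection scaleA scale1 scaleDr scaleDl.

Lemma vsectionDE (s t : vsection) m : (s + t) m = s m + t m.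
Proof. by rewrite /= scale1r. Qed.

Lemma vsectionZE (f : Cinf) (s : vsection) m : (f *: s) m = f m *: s m.
Proof. by rewrite /= addr0. Qed.

End Sections.

(* A morphism of vector bundles over the identity of M: a fibrewise linear map
   is smooth exactly when it sends smooth sections to smooth sections. *)
Record vbmorph (R : realType) (M : manifold R) (g : ground) (E F : vbundle M g) :=
  VBMorph {
    vbmorph_fun :> forall m, {linear E m -> F m};
    vbmorph_smooth : forall s : vsection E,
      smooth_section (fun m => vbmorph_fun m (s m)) }.

Section SectionMap.
Context {R : realType} {M : manifold R} {g : ground} {E F : vbundle M g}.
Variable phi : vbmorph E F.

Definition smap (s : vsection E) : vsection F := VSection (vbmorph_smooth phi s).

Lemma smap_is_linear : linear smap.
Proof.
move=> f s t; apply: vsection_ext => m.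
rewrite vsectionDE vsectionZE -[LHS]/(phi m ((f *: s + t) m)).
by rewrite vsectionDE vsectionZE linearP.
Qed.

HB.instance Definition _ := GRing.isLinear.Build _ _ _ _ smap smap_is_linear.

End SectionMap.

(* A form of arbitrary (possibly mixed) degree is a function on the finite
   sequences of vectors, the component of degree k being its restriction to the
   sequences of size k.  For V = Gamma(A) and W = Gamma(E) these are the
   sections of the bundle Lambda A^* (x) E; since the alternating forms of degree
   above the rank of A vanish, every such function is a finite sum of
   homogeneous forms. *)

Section Forms.
Context {S : comPzRingType}.
Implicit Types V W : lmodType S.

Definition is_form V W (f : seq V -> W) : Prop :=
  (forall s t c a b,
     f (s ++ (c *: a + b) :: t) = c *: f (s ++ a :: t) + f (s ++ b :: t)) /\
  (forall s t u a, f (s ++ a :: t ++ a :: u) = 0).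

Record form V W := Form { form_val :> seq V -> W; formP : is_form form_val }.

Definition homog V W (d : int) (w : form V W) : Prop :=
  forall s : seq V, (size s)%:Z <> d -> w s = 0.

Section FormModule.
Context {V W : lmodType S}.

Lemma form_ext (w w' : form V W) : (forall s, w s = w' s) -> w = w'.
Proof.
case: w w' => [f fP] [h hP] /= fh.
have {}fh : f = h by exact: funext.
by case: _ / fh hP => hP; congr Form; exact: Prop_irrelevance.
Qed.

Lemma is_form0 : is_form (fun _ : seq V => 0 : W).
Proof. by split=> *; rewrite ?scaler0 ?addr0. Qed.

Lemma is_formN (w : form V W) : is_form (fun s => - w s).
Proof.
case: (formP w) => l a; split=> [*|*]; last by rewrite a oppr0.
by rewrite l opprD scalerN.
Qed.

Lemma is_formD (w w' : form V W) : is_form (fun s => w s + w' s).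
Proof.
case: (formP w) (formP w') => l a [l' a']; split=> *; last first.
  by rewrite a a' addr0.
by rewrite l l' scalerDr addrACA.
Qed.

HB.instance Definition _ := gen_eqMixin (form V W).
HB.instance Definition _ := gen_choiceMixin (form V W).

Let form_add w w' := Form (is_formD w w').
Let form_opp w := Form (is_formN w).

Let addA : associative form_add.
Proof. by move=> *; apply: form_ext => s /=; rewrite addrA. Qed.
Let addC : commutative form_add.
Proof. by move=> *; apply: form_ext => s /=; rewrite addrC. Qed.
Let add0 : left_id (Form is_form0) form_add.
Proof. by move=> *; apply: form_ext => s /=; rewrite add0r. Qed.
Let addN : left_inverse (Form is_form0) form_opp form_add.
Proof. by move=> *; apply: form_ext => s /=; rewrite addNr. Qed.

HB.instance Definition _ := GRing.isZmodule.Build (form V W) addA addC add0 addN.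

(* The form with a given underlying function; only meant to be applied to
   functions satisfying [is_form]. *)
Definition mkform (f : seq V -> W) : form V W :=
  xget 0 [set w : form V W | forall s, w s = f s].

Lemma is_form_const (v : W) : is_form (fun s : seq V => if s is [::] then v else 0).
Proof. by split=> [[|? ?]|[|? ?]] *; rewrite /= ?scaler0 ?addr0. Qed.

Definition form0 (v : W) : form V W := Form (is_form_const v).

Lemma is_form_lin (h : {linear V -> W}) :
  is_form (fun s : seq V => if s is [:: a] then h a else 0).
Proof.
split=> [[|x [|y s]] [|z t]|[|x [|y s]] [|z t]] * /=;
  by rewrite ?linearP ?scaler0 ?addr0.
Qed.

Definition form1 (h : {linear V -> W}) : form V W := Form (is_form_lin h).

Lemma is_form_iprod (a : V) (w : form V W) : is_form (fun s => w (a :: s)).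
Proof.
case: (formP w) => l z; split=> [s t c x y|s t u x].
  by have := l (a :: s) t c x y.
by have := z (a :: s) t u x.
Qed.

Definition iprod a w : form V W := Form (is_form_iprod a w).

Lemma is_form_tens (xi : form V S^o) (v : W) : is_form (fun s => (xi s : S) *: v).
Proof.
case: (formP xi) => l z; split=> [s t c x y|s t u x]; last by rewrite z scale0r.
by rewrite l scalerDl scalerA.
Qed.

Definition tens xi v : form V W := Form (is_form_tens xi v).

End FormModule.

Section FormMap.
Context {V W W' : lmodType S} (h : {linear W -> W'}).

Lemma is_form_map (w : form V W) : is_form (fun s => h (w s)).
Proof.
case: (formP w) => l z; split=> [s t c x y|s t u x]; last by rewrite z linear0.
by rewrite l linearP.
Qed.

Definition form_map w : form V W' := Form (is_form_map w).

End FormMap.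

Section Wedge.
Context {V W : lmodType S}.

(* The sum over (k, n-k)-shuffles, without factorials, computed by the rule that
   interior products are graded derivations:
   i_a (f ^ g) = (i_a f) ^ g + (-1)^|f| f ^ (i_a g). *)
Fixpoint wedge_fun (f : seq V -> S) (g : seq V -> W) (s : seq V) : W :=
  if s is a :: s' then
    wedge_fun (fun t => f (a :: t)) g s' +
    wedge_fun (fun t => (-1) ^+ size t * f t) (fun t => g (a :: t)) s'
  else f [::] *: g [::].

Lemma wedge_funPl c f1 f2 g s :
  wedge_fun (fun t => c * f1 t + f2 t) g s =
  c *: wedge_fun f1 g s + wedge_fun f2 g s.
Proof.
elim: s f1 f2 g => [|a s IH] f1 f2 g /=; first by rewrite scalerDl scalerA.
rewrite IH -[X in _ + X = _](_ : wedge_fun (fun t =>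
  c * ((-1) ^+ size t * f1 t) + (-1) ^+ size t * f2 t)
  (fun t => g (a :: t)) s = _).
  by rewrite IH scalerDr addrACA.
by congr (wedge_fun _ _ _); apply/funext => t; rewrite mulrDr mulrCA.
Qed.

Lemma wedge_funPr c f g1 g2 s :
  wedge_fun f (fun t => c *: g1 t + g2 t) s =
  c *: wedge_fun f g1 s + wedge_fun f g2 s.
Proof.
elim: s f g1 g2 => [|a s IH] f g1 g2 /=.
  by rewrite scalerDr !scalerA mulrC.
by rewrite !IH scalerDr addrACA.
Qed.

Lemma wedge_fun0l g s : wedge_fun (fun=> 0) g s = 0.
Proof.
elim: s g => [|a s IH] g /=; first by rewrite scale0r.
rewrite IH add0r -[RHS](IH (fun t => g (a :: t))).
by congr (wedge_fun _ _ _); apply/funext => t; rewrite mulr0.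
Qed.

Lemma wedge_fun0r f s : wedge_fun f (fun=> 0) s = 0.
Proof. by elim: s f => [|a s IH] f /=; rewrite ?scaler0 // !IH addr0. Qed.

Let multilin (W' : lmodType S) (f : seq V -> W') := forall s t c a b,
  f (s ++ (c *: a + b) :: t) = c *: f (s ++ a :: t) + f (s ++ b :: t).
Let altern (W' : lmodType S) (f : seq V -> W') := forall s t a,
  f (s ++ a :: a :: t) = 0.

Let multilin_cons (W' : lmodType S) (f : seq V -> W') a :
  multilin f -> multilin (fun t => f (a :: t)).
Proof. by move=> fl s t c x y; have := fl (a :: s) t c x y. Qed.

Let altern_cons (W' : lmodType S) (f : seq V -> W') a :
  altern f -> altern (fun t => f (a :: t)).
Proof. by move=> fa s t x; have := fa (a :: s) t x. Qed.

Let multilin_sign (f : seq V -> S^o) :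
  multilin f -> multilin (fun t => (-1) ^+ size t * f t : S^o).
Proof.
move=> fl s t c a b; rewrite fl !size_cat /= mulrDr; congr (_ + _).
exact: mulrCA.
Qed.

Let altern_sign (f : seq V -> S^o) :
  altern f -> altern (fun t => (-1) ^+ size t * f t : S^o).
Proof. by move=> fa s t a; rewrite fa mulr0. Qed.

Let wedge_multilin (f : seq V -> S^o) (g : seq V -> W) :
  multilin f -> multilin g -> multilin (wedge_fun f g).
Proof.
move=> fl gl s; elim: s f g fl gl => [|x s IH] f g fl gl t c a b /=.
  rewrite (_ : (fun t => f _) = fun t => c * f (a :: t) + f (b :: t)); last first.
    by apply/funext => u; have := fl [::] u c a b.
  rewrite (_ : (fun t => g _) = fun t => c *: g (a :: t) + g (b :: t)); last first.
    by apply/funext => u; have := gl [::] u c a b.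
  by rewrite wedge_funPl wedge_funPr scalerDr addrACA.
rewrite IH; [|exact: multilin_cons|done].
rewrite IH; [|exact: multilin_sign|exact: multilin_cons].
by rewrite scalerDr addrACA.
Qed.

Let wedge_altern (f : seq V -> S^o) (g : seq V -> W) :
  altern f -> altern g -> altern (wedge_fun f g).
Proof.
move=> fa ga s; elim: s f g fa ga => [|x s IH] f g fa ga t a /=; last first.
  rewrite IH; [|exact: altern_cons|done].
  by rewrite IH ?addr0; [|exact: altern_sign|exact: altern_cons].
rewrite (_ : (fun t => f _) = fun=> 0); last first.
  by apply/funext => u; exact: (fa [::] u a).
rewrite (_ : (fun t => g [:: a, a & t]) = fun=> 0); last first.
  by apply/funext => u; exact: (ga [::] u a).
rewrite wedge_fun0l wedge_fun0r add0r addr0.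
rewrite (_ : (fun t => (-1) ^+ size (a :: t) * f (a :: t)) =
   fun t => -1 * ((-1) ^+ size t * f (a :: t)) + 0); last first.
  by apply/funext => u; rewrite /= exprS addr0 mulrA.
by rewrite wedge_funPl wedge_fun0l addr0 scaleN1r addrN.
Qed.

Let altern_far (f : seq V -> W) : multilin f -> altern f ->
  forall s t u a, f (s ++ a :: t ++ a :: u) = 0.
Proof.
move=> fl fa s t; elim: t s => [|b t IH] s u a; first exact: fa.
have swap x y v : f (s ++ x :: y :: v) = - f (s ++ y :: x :: v).
  apply/eqP; rewrite -addr_eq0; apply/eqP.
  have E z w : s ++ z :: w :: v = (s ++ [:: z]) ++ w :: v by rewrite -catA.
  have := fa s v (1 *: x + y).
  rewrite fl (E x (1 *: x + y)) (E y (1 *: x + y)) !fl -!E !scale1r !fa.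
  by rewrite add0r addr0.
by rewrite /= swap -(cat_rcons b) IH oppr0.
Qed.

Lemma is_form_wedge (xi : form V S^o) (w : form V W) : is_form (wedge_fun xi w).
Proof.
case: (formP xi) (formP w) => xl xa [wl wa].
have lin : multilin (wedge_fun xi w) by exact: wedge_multilin.
split=> //; apply: altern_far => //; apply: wedge_altern => s t a.
  exact: xa s [::] t a.
exact: wa s [::] t a.
Qed.

Definition wedge xi w : form V W := Form (is_form_wedge xi w).

End Wedge.

(* The Chevalley-Eilenberg differential (Koszul formula) of the forms with
   values in a module W on which V acts by [nabla]. *)
Section ChevalleyEilenberg.
Context {V W : lmodType S} (br : V -> V -> V) (nabla : V -> W -> W).

Definition del (i : nat) (s : seq V) : seq V := take i s ++ drop i.+1 s.

Definition koszul (w : seq V -> W) (s : seq V) : W :=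
  \sum_(i < size s) (-1) ^+ i *: nabla s`_i (w (del i s)) +
  \sum_(i < size s) \sum_(j < size s | (i < j)%N)
    (-1) ^+ (i + j) *: w (br s`_i s`_j :: del i (del j s)).

Definition CE (w : form V W) : form V W := mkform (koszul w).

End ChevalleyEilenberg.

End Forms.

(* Sections of the complexified or real tangent bundle are the K-linear
   derivations of C^oo(M, K), and bundle maps L -> T_M (x) K correspond to
   C^oo(M, K)-linear maps from Gamma(L) to these derivations. *)
Record lie_algebroid (R : realType) (M : manifold R) (g : ground) := LieAlgebroid {
  la_bundle :> vbundle M g;
  anchor : vsection la_bundle -> smoothfun M g -> smoothfun M g;
  lbr : vsection la_bundle -> vsection la_bundle -> vsection la_bundle;
  anchor_klinear : forall v c f h,
    anchor v (smooth_cst M c * f + h) = smooth_cst M c * anchor v f + anchor v h;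
  anchor_leibniz : forall v f h,
    anchor v (f * h) = anchor v f * h + f * anchor v h;
  anchor_linear : forall f u v h,
    anchor (f *: u + v) h = f * anchor u h + anchor v h;
  lbr_klinear : forall c u v w,
    lbr (smooth_cst M c *: u + v) w = smooth_cst M c *: lbr u w + lbr v w;
  lbr_antisym : forall u v, lbr u v = - lbr v u;
  lbr_jacobi : forall u v w,
    lbr u (lbr v w) + lbr v (lbr w u) + lbr w (lbr u v) = 0;
  lbr_leibniz : forall u f v, lbr u (f *: v) = f *: lbr u v + anchor u f *: v;
  anchor_lbr : forall u v f,
    anchor (lbr u v) f = anchor u (anchor v f) - anchor v (anchor u f) }.

Record lie_pair (R : realType) (M : manifold R) (g : ground) := LiePair {
  lp_L : lie_algebroid M g;
  lp_A : lie_algebroid M g;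
  lp_i : vbmorph lp_A lp_L;
  lp_i_inj : forall m, injective (lp_i m);
  lp_i_anchor : forall (a : vsection lp_A) f, anchor (smap lp_i a) f = anchor a f;
  lp_i_lbr : forall a b : vsection lp_A,
    smap lp_i (lbr a b) = lbr (smap lp_i a) (smap lp_i b) }.

(* The exact sequence 0 -> A -> L -> B -> 0 exhibiting B as L/A, a splitting j
   of it, and the projection p of L onto A with kernel j(B). *)
Record splitting (R : realType) (M : manifold R) (g : ground)
    (P : lie_pair M g) := Splitting {
  sp_B : vbundle M g;
  sp_q : vbmorph (lp_L P) sp_B;
  sp_q_surj : forall m (b : sp_B m), exists v, sp_q m v = b;
  sp_exact : forall m (v : lp_L P m), sp_q m v = 0 <-> exists a, lp_i P m a = v;
  sp_j : vbmorph sp_B (lp_L P);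
  sp_qj : forall m (b : sp_B m), sp_q m (sp_j m b) = b;
  sp_p : vbmorph (lp_L P) (lp_A P);
  sp_pi : forall m (a : lp_A P m), sp_p m (lp_i P m a) = a;
  sp_p_ker : forall m (v : lp_L P m), sp_p m v = 0 <-> exists b, sp_j m b = v }.

Definition sg (d : int) : int := (-1) ^+ `|d|%N.

(* A graded K-vector space is given by the family C of its homogeneous
   components inside an ambient group T on which K acts by [sc]; operators are
   functions on T, of which only the values on the C d matter. *)
Record cochain_complex (K : pzRingType) (T : zmodType) (sc : K -> T -> T)
    (C : int -> set T) (delta : int -> T -> T) : Prop := CochainComplex {
  cc_0 : forall d, C d 0;
  cc_sub : forall d c x y, C d x -> C d y -> C d (sc c x + y);
  cc_map : forall d x, C d x -> C (d + 1) (delta d x);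
  cc_linear : forall d c x y, C d x -> C d y ->
    delta d (sc c x + y) = sc c (delta d x) + delta d y;
  cc_sq : forall d x, C d x -> delta (d + 1) (delta d x) = 0 }.

Record contraction (T U : zmodType)
    (C : int -> set T) (delta : int -> T -> T)
    (D : int -> set U) (delta' : int -> U -> U)
    (P : T -> U) (I : U -> T) (H : T -> T) : Prop := Contraction {
  ct_P : forall d x, C d x -> D d (P x);
  ct_I : forall d y, D d y -> C d (I y);
  ct_H : forall d x, C d x -> C (d - 1) (H x);
  ct_P_chain : forall d x, C d x -> P (delta d x) = delta' d (P x);
  ct_I_chain : forall d y, D d y -> I (delta' d y) = delta d (I y);
  ct_PI : forall d y, D d y -> P (I y) = y;
  ct_IP : forall d x, C d x ->
    I (P x) = x - (H (delta d x) + delta (d - 1) (H x));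
  ct_HH : forall d x, C d x -> H (H x) = 0;
  ct_HI : forall d y, D d y -> H (I y) = 0;
  ct_PH : forall d x, C d x -> P (H x) = 0 }.

(* Linearity, in the graded sense, of an operator of degree e over a graded ring
   with homogeneous components G. *)
Definition graded_linear (F T U : zmodType) (G : int -> set F)
    (aT : F -> T -> T) (aU : F -> U -> U) (C : int -> set T)
    (e : int) (phi : T -> U) : Prop :=
  (forall d x y, C d x -> C d y -> phi (x + y) = phi x + phi y) /\
  (forall k d f x, G k f -> C d x -> phi (aT f x) = aU f (phi x) *~ sg (k * e)).

(* Gamma(Lambda A^* ), and Gamma(Lambda A^* (x) E) *)
Notation Afun P := (form (vsection (lp_A P)) (smoothfun _ _)^o).
Notation Aform P E := (form (vsection (lp_A P)) (vsection E)).

Notation pbpair P := ((Afun P -> Afun P) * Aform P (lp_L P))%type.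

Section LiePairOperators.
Context {R : realType} {M : manifold R} {g : ground}.
Variables (P : lie_pair M g) (S : splitting P).
Local Notation K := (scalars R g).
Local Notation Cinf := (smoothfun M g).
Local Notation A := (lp_A P).
Local Notation L := (lp_L P).
Local Notation B := (sp_B S).
Local Notation i_ := (smap (lp_i P)).
Local Notation q_ := (smap (sp_q S)).
Local Notation j_ := (smap (sp_j S)).
Local Notation p_ := (smap (sp_p S)).

Definition Afun0 (f : Cinf) : Afun P := form0 (f : Cinf^o).
Definition Acst (c : K) : Afun P := Afun0 (smooth_cst M c).

(* Homogeneous elements of X(A[1]). *)
Record derivation (d : int) (X : Afun P -> Afun P) : Prop := Derivation {
  der_deg : forall k w, homog k w -> homog (k + d) (X w);
  der_linear : forall c w w',
    X (wedge (Acst c) w + w') = wedge (Acst c) (X w) + X w';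
  der_leibniz : forall k w w', homog k w ->
    X (wedge w w') = wedge (X w) w' + wedge w (X w') *~ sg (d * k) }.

(* [nu] is the sum of the [xi k (x) v k], with [xi k] of degree [deg k], on some
   neighbourhood of [m]. *)
Definition decomp_near (E : vbundle M g) (m : M) (nu : Aform P E) (n : nat)
    (deg : 'I_n -> int) (xi : 'I_n -> Afun P) (v : 'I_n -> vsection E) : Prop :=
  (forall k, homog (deg k) (xi k)) /\
  \forall m' \near m, forall s,
    nu s m' = (\sum_(k < n) tens (xi k) (v k) : Aform P E) s m'.

Definition pb_section (d : int) (x : pbpair P) : Prop :=
  [/\ derivation d x.1, homog d x.2 &
      forall f s, x.1 (Afun0 f) s = anchor (x.2 s) f].

Definition pb_bracket_form (d d' : int) (x y : pbpair P) (mu : Aform P L) : Prop :=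
  forall m n xi l n' xi' l',
    @decomp_near L m x.2 n (fun=> d) xi l ->
    @decomp_near L m y.2 n' (fun=> d') xi' l' ->
  forall s, mu s m =
    ((\sum_(k < n') tens (x.1 (xi' k)) (l' k)
      - (\sum_(k < n) tens (y.1 (xi k)) (l k)) *~ sg (d * d')
      + \sum_(k < n) \sum_(k' < n')
          tens (wedge (xi k) (xi' k')) (lbr (l k) (l' k'))) : Aform P L) s m.

(* The bracket of sections x and y of degrees d and d'; [pb_bracket_form]
   determines its second component since every form is a finite sum of tensors
   near every point. *)
Definition pb_bracket (d d' : int) (x y : pbpair P) : pbpair P :=
  ((fun w => x.1 (y.1 w) - y.1 (x.1 w) *~ sg (d * d')),
   xget 0 [set mu | pb_bracket_form d d' x y mu]).

Definition dA (w : Afun P) : Afun P :=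
  @CE _ _ Cinf^o (@lbr _ _ _ A) (@anchor _ _ _ A) w.

(* As an L-valued 1-form, the sum of the xi^k (x) i(e_k) over dual local frames
   is the inclusion i itself. *)
Definition pb_s : pbpair P := (dA, form1 i_).

Definition pb_Q (d : int) (x : pbpair P) : pbpair P := pb_bracket 1 d pb_s x.

(* nabla_a (q v) = q [a, v] for the lift v = j b of b. *)
Definition bott (a : vsection A) (b : vsection B) : vsection B :=
  q_ (lbr (i_ a) (j_ b)).

Definition dBott (w : Aform P B) : Aform P B := CE (@lbr _ _ _ A) bott w.

Definition pb_act (f : Afun P) (x : pbpair P) : pbpair P :=
  ((fun w => wedge f (x.1 w)), wedge f x.2).

(* The operator sum_k xi_k D_{|xi_k|}(v_k) on forms, for nu = sum_k xi_k (x) v_k.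
   It is well defined (independent of the decompositions, hence unique) as soon
   as D is C^oo(M, K)-linear in v. *)
Definition op_sum (E : vbundle M g) (D : int -> vsection E -> Afun P -> Afun P)
    (nu : Aform P E) : Afun P -> Afun P :=
  xget 0 [set Y : Afun P -> Afun P | forall m n deg xi v,
    @decomp_near E m nu n deg xi v ->
    forall w s, (Y w s : Cinf) m =
      ((\sum_(k < n) wedge (xi k) (D (deg k) (v k) w) : Afun P) s : Cinf) m].

Definition is_Delta (b : vsection B) (D : Afun P -> Afun P) : Prop :=
  [/\ derivation 0 D,
      forall f, D (Afun0 f) = Afun0 (anchor (j_ b) f) &
      forall (xi : Afun P) a, homog 1 xi ->
        D xi [:: a] = anchor (j_ b) (xi [:: a]) - xi [:: p_ (lbr (j_ b) (i_ a))]].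

(* A derivation is determined by its values on functions and 1-forms. *)
Definition Delta (b : vsection B) : Afun P -> Afun P :=
  xget 0 [set D | is_Delta b D].

Definition P0 (x : pbpair P) : Aform P B := form_map q_ x.2.

Definition I0 (w : Aform P B) : pbpair P :=
  (op_sum (fun _ b => Delta b) w, form_map j_ w).

Definition H0 (x : pbpair P) : pbpair P :=
  (op_sum (fun d v w => iprod (p_ v) w *~ sg d) x.2, 0).

End LiePairOperators.

(* Main.v *)
Require Import Defs.
From HB Require Import structures.
From mathcomp Require Import all_boot all_order all_algebra.
From mathcomp Require Import complex.
From mathcomp Require Import boolp classical_sets functions reals.
From mathcomp Require Import topology normedtype sequences derive realfun exp.
From mathcomp Require Import zify ring lra.

Set Implicit Arguments.
Unset Strict Implicit.
Unset Printing Implicit Defensive.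

Import Order.TTheory GRing.Theory Num.Theory.
Import numFieldNormedType.Exports.

Local Open Scope classical_set_scope.
Local Open Scope ring_scope.

(* A section [(X, nu)] of degree [d], with differential [(X', mu)], satisfies
     X i^* = iota_nu d_L + (-1)^d (d_A iota_nu - iota_mu)
   on the forms on [L], where [iota_nu] is the sum of the [xi_k /\ i^* iota_(l_k)]
   for [nu] the sum of the [xi_k (x) l_k]: both sides are derivations along
   [i^*], they agree on functions by the anchor condition and on 1-forms by the
   definition of the bracket, and a derivation is determined by these values by
   Euler's identity in local frames.  As [i^*] is onto, [X] is determined by
   [nu] and [mu]; hence [Q^2 = 0] and the contraction identities only have to be
   checked on the second components, that is, after pairing with 1-forms on
   [L].  For instance [Q (H_0 (X, nu))] has second component [i p nu], which
   leaves [j q nu = nu - i p nu] in [I_0 P_0 = id - (H_0 Q + Q H_0)]. *)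

(** The operators of the statement are chosen by [xget] among maps constrained on all local
    decompositions of a form into tensors, which is unusable for computation. The proof therefore
    replaces a sum over a decomposition by [pwedge], a recursion on the argument sequence in which
    no decomposition occurs; the two descriptions meet only in [op_sumE] and
    [is_differential_bracket_form]. Decompositions exist only near a point, so locality has to be
    produced by bump functions; a local frame becomes a global identity by multiplying it with a
    cutoff ([frame_at]). Forms on [L] enter although [X] acts on forms on [A], because an [L]-valued
    form can only be contracted with forms on [L]. Signs are carried by the parity operator [eps]
    instead of degrees, so that most identities hold for inhomogeneous forms and survive contraction
    with a vector. Characteristic zero is used in Euler's identity, where one divides by the degree,
    and to get [v, v] = 0 from antisymmetry. *)

Local Notation form := Defs.form.
Local Notation contraction := Defs.contraction.

(** * Forms as functions on sequences *)

Section ZmodReflection.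

Inductive zexp := ZVar of nat | ZZero | ZAdd of zexp & zexp | ZOpp of zexp.

Fixpoint zeval (U : zmodType) (env : seq U) (e : zexp) : U :=
  match e with
  | ZVar n => nth 0 env n
  | ZZero => 0
  | ZAdd e1 e2 => zeval env e1 + zeval env e2
  | ZOpp e1 => - zeval env e1
  end.

Fixpoint zcoef (e : zexp) (i : nat) : int :=
  match e with
  | ZVar n => (i == n)%:Z
  | ZZero => 0
  | ZAdd e1 e2 => zcoef e1 i + zcoef e2 i
  | ZOpp e1 => - zcoef e1 i
  end.

Lemma zevalE (U : zmodType) (env : seq U) e :
  zeval env e = \sum_(i < size env) env`_i *~ zcoef e i.
Proof.
elim: e => [n||e1 IH1 e2 IH2|e1 IH] /=.
- have [nn|nn] := ltnP n (size env).
    rewrite (bigD1 (Ordinal nn)) //= eqxx big1 ?addr0 // => i /negPf.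
    by rewrite -val_eqE /= => ->.
  rewrite nth_default // big1 // => i _.
  by case: eqP => // E; move: (ltn_ord i); rewrite E ltnNge nn.
- by rewrite big1.
- by rewrite IH1 IH2 -big_split; apply: eq_bigr => i _; rewrite mulrzDr.
- by rewrite IH -sumrN; apply: eq_bigr => i _; rewrite mulrNz.
Qed.

(** The hypothesis is a closed computation in [int], settled by [vm_compute]. Variables beyond the
    end of [env] evaluate to the default 0, so comparing the first [size env] coefficients is
    enough. *)
Lemma zeval_eq (U : zmodType) (env : seq U) e1 e2 :
  all (fun i => zcoef e1 i == zcoef e2 i) (iota 0 (size env)) ->
  zeval env e1 = zeval env e2.
Proof.
move=> /allP E; rewrite !zevalE; apply: eq_bigr => i _.
by rewrite (eqP (E i _)) // mem_iota add0n ltn_ord.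
Qed.

End ZmodReflection.

(** [same] is a tactic that fails on distinct atoms; the backtracking of [match] then passes to the
    next entry of [env]. *)
Ltac zmod_index same x env :=
  match env with
  | ?y :: _ => let E := same x y in constr:(0%N)
  | _ :: ?env' => let n := zmod_index same x env' in constr:(S n)
  end.

Ltac zmod_env same t env :=
  lazymatch t with
  | (?a + ?b)%R => let env1 := zmod_env same a env in zmod_env same b env1
  | (- ?a)%R => zmod_env same a env
  | 0%R => env
  | _ => match env with
         | _ => let n := zmod_index same t env in env
         | _ => constr:(t :: env)
         end
  end.

Ltac zmod_quote same t env :=
  lazymatch t with
  | (?a + ?b)%R => let x := zmod_quote same a env in
                   let y := zmod_quote same b env in constr:(ZAdd x y)
  | (- ?a)%R => let x := zmod_quote same a env in constr:(ZOpp x)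
  | 0%R => constr:(ZZero)
  | _ => let n := zmod_index same t env in constr:(ZVar n)
  end.

Ltac zmod_with same :=
  lazymatch goal with
  | |- @eq ?T ?l ?r =>
    let env0 := zmod_env same l (@nil T) in
    let env := zmod_env same r env0 in
    let e1 := zmod_quote same l env in
    let e2 := zmod_quote same r env in
    refine (@zeval_eq _ env e1 e2 _); vm_compute; reflexivity
  end.

Ltac zmod_syntactic x y := lazymatch x with y => constr:(tt) end.
Ltac zmod_convertible x y := constr:(erefl x : x = y).

(* Identities of abelian groups; the atoms are compared up to conversion when
   syntactic comparison does not suffice. *)
Ltac zmod := first [zmod_with zmod_syntactic | zmod_with zmod_convertible].

(** * Wedge calculus on functions of sequences *)

Section RawForms.
Context {S : comPzRingType}.

(** The parity involution. It turns a graded sign (-1)^|w| into an operator that makes sense without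
    homogeneity. *)
Definition eps {V W : lmodType S} (w : seq V -> W) (s : seq V) : W :=
  (-1) ^+ size s *: w s.

Definition epsb {V W : lmodType S} (b : bool) (w : seq V -> W) : seq V -> W :=
  if b then eps w else w.

Definition con {V W : lmodType S} (a : V) (w : seq V -> W) : seq V -> W :=
  fun s => w (a :: s).

(** [homog] for functions not known to be forms: inductions on the sequence pass through such
    functions. *)
Definition rhomog {V W : lmodType S} (d : int) (w : seq V -> W) : Prop :=
  forall s : seq V, (size s)%:Z <> d -> w s = 0.

(* [pwedge D nu] is the sum of the [xi k /\ D (v k)] for [nu] the sum of the
   [xi k (x) v k]; like [wedge_fun], it is computed by interior products. *)
Fixpoint pwedge {V W W' : lmodType S} (D : W -> seq V -> W') (nu : seq V -> W)
    (s : seq V) : W' :=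
  if s is a :: s' then
    pwedge D (con a nu) s' + pwedge (fun v => con a (D v)) (eps nu) s'
  else D (nu [::]) [::].

Definition Dlin {V W W' : lmodType S} (D : W -> seq V -> W') : Prop :=
  forall c u v s, D (c *: u + v) s = c *: D u s + D v s.

Section Wedge.
Context {V W : lmodType S}.
Implicit Types (f g : seq V -> S^o) (w : seq V -> W) (a : V) (s : seq V).

Lemma eq_wedge f f' w w' s :
  f =1 f' -> w =1 w' -> wedge_fun f w s = wedge_fun f' w' s.
Proof. by move=> /funext -> /funext ->. Qed.

Lemma wedge_funDl f1 f2 w s :
  wedge_fun (fun t => f1 t + f2 t) w s = wedge_fun f1 w s + wedge_fun f2 w s.
Proof.
rewrite -[X in _ = X + _]scale1r -wedge_funPl.
by apply: eq_wedge => // t; rewrite mul1r.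
Qed.

Lemma wedge_funDr f w1 w2 s :
  wedge_fun f (fun t => w1 t + w2 t) s = wedge_fun f w1 s + wedge_fun f w2 s.
Proof.
rewrite -[X in _ = X + _]scale1r -wedge_funPr.
by apply: eq_wedge => // t; rewrite scale1r.
Qed.

Lemma wedge_funZl c f w s :
  wedge_fun (fun t => c *: f t) w s = c *: wedge_fun f w s.
Proof.
rewrite -[RHS]addr0 -(wedge_fun0l w s) -wedge_funPl.
by apply: eq_wedge => // t; rewrite addr0.
Qed.

Lemma wedge_funZr c f w s :
  wedge_fun f (fun t => c *: w t) s = c *: wedge_fun f w s.
Proof.
rewrite -[RHS]addr0 -(wedge_fun0r f s) -wedge_funPr.
by apply: eq_wedge => // t; rewrite addr0.
Qed.

Lemma wedge_funNl f w s : wedge_fun (fun t => - f t) w s = - wedge_fun f w s.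
Proof. by rewrite -scaleN1r -wedge_funZl; apply: eq_wedge => // t; rewrite scaleN1r. Qed.

Lemma wedge_funNr f w s : wedge_fun f (fun t => - w t) s = - wedge_fun f w s.
Proof. by rewrite -scaleN1r -wedge_funZr; apply: eq_wedge => // t; rewrite scaleN1r. Qed.

Lemma wedge_fun_cons f w a s : wedge_fun f w (a :: s) =
  wedge_fun (con a f) w s + wedge_fun (eps f) (con a w) s.
Proof. by []. Qed.

Lemma eps_con w a s : con a (eps w) s = - eps (con a w) s.
Proof. by rewrite /con /eps /= exprS mulN1r scaleNr. Qed.

Lemma epsK w : eps (eps w) = w.
Proof.
apply/funext => s; rewrite /eps scalerA -exprMn_comm; last exact: commr_refl.
by rewrite mulrNN mulr1 expr1n scale1r.
Qed.

Lemma epsD w w' s : eps (fun t => w t + w' t) s = eps w s + eps w' s.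
Proof. by rewrite /eps scalerDr. Qed.

Lemma epsN w s : eps (fun t => - w t) s = - eps w s.
Proof. by rewrite /eps scalerN. Qed.

(** Parity is multiplicative; this is the sign rule behind associativity and all later Leibniz
    rules. *)
Lemma eps_wedge f w s :
  wedge_fun (eps f) (eps w) s = eps (wedge_fun f w) s.
Proof.
elim: s f w => [|a s IH] f w.
  by rewrite /eps /= !expr0 !scale1r.
rewrite wedge_fun_cons.
rewrite (@eq_wedge (con a (eps f)) (fun t => - eps (con a f) t) _ (eps w)) //; last first.
  by move=> t; rewrite /eps /con /= exprS mulN1r scaleNr.
rewrite (@eq_wedge (eps (eps f)) (eps (eps f)) (con a (eps w)) (fun t => - eps (con a w) t)) //; last first.
  by move=> t; rewrite eps_con.
rewrite wedge_funNl wedge_funNr !IH /eps /= exprS mulN1r scaleNr -opprD.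
by rewrite -scalerDr.
Qed.

Lemma wedge_const (c : S) w s :
  wedge_fun (fun t => if t is [::] then c else 0) w s = c *: w s.
Proof.
elim: s w => [|a s IH] w; first by [].
rewrite wedge_fun_cons.
rewrite (@eq_wedge (con a _) (fun=> 0) w w) // wedge_fun0l add0r.
rewrite -[RHS](IH (con a w)); apply: eq_wedge => // -[|b t].
  by rewrite /eps /= scale1r.
by rewrite /eps /= scaler0.
Qed.

Lemma wedge_constr f (v : W) s :
  wedge_fun f (fun t => if t is [::] then v else 0) s = (f s : S) *: v.
Proof.
elim: s f => [|a s IH] f; first by [].
rewrite wedge_fun_cons IH.
by rewrite (@eq_wedge (eps f) (eps f) (con a _) (fun=> 0)) // wedge_fun0r addr0.
Qed.

End Wedge.

(** Contraction with the first argument is an odd derivation of either side, and both expansions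
    give the same three terms once [eps] is distributed over the product. *)
Lemma wedge_assoc {V W : lmodType S} (f g : seq V -> S^o) (w : seq V -> W) s :
  wedge_fun (wedge_fun f (g : seq V -> S^o)) w s = wedge_fun f (wedge_fun g w) s.
Proof.
elim: s f g w => [|a s IH] f g w; first by rewrite /= scalerA.
rewrite !wedge_fun_cons.
rewrite (@eq_wedge _ _ (con a (wedge_fun f g)) (fun t => wedge_fun (con a f) g t +
   wedge_fun (eps f) (con a g) t) w w) //.
rewrite wedge_funDl !IH -addrA; congr (_ + _).
rewrite (@eq_wedge _ _ (eps f) (eps f) (con a (wedge_fun g w)) (fun t =>
  wedge_fun (con a g) w t + wedge_fun (eps g) (con a w) t)) //.
rewrite wedge_funDr; congr (_ + _).
by rewrite -IH; apply: eq_wedge => // t; rewrite eps_wedge.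
Qed.

Section PWedge.
Context {V W W' : lmodType S}.
Implicit Types (D : W -> seq V -> W') (nu : seq V -> W) (a : V) (s : seq V).

Lemma pwedge_cons D nu a s : pwedge D nu (a :: s) =
  pwedge D (con a nu) s + pwedge (fun v => con a (D v)) (eps nu) s.
Proof. by []. Qed.

Lemma eq_pwedge D D' nu nu' s : D =2 D' -> nu =1 nu' ->
  pwedge D nu s = pwedge D' nu' s.
Proof.
move=> DD /funext ->; suff -> : D = D' by [].
by apply/funext => v; apply/funext => t.
Qed.

Lemma Dlin_con D a : Dlin D -> Dlin (fun v => con a (D v)).
Proof. by move=> Dl c u v s; rewrite /con Dl. Qed.

Lemma Dlin0 D t : Dlin D -> D 0 t = 0.
Proof.
move=> Dl; have := Dl (-1) 0 0 t; rewrite scaler0 addr0 => ->.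
by rewrite scaleN1r addNr.
Qed.

Lemma pwedgeP D c nu nu' s : Dlin D ->
  pwedge D (fun t => c *: nu t + nu' t) s = c *: pwedge D nu s + pwedge D nu' s.
Proof.
elim: s D nu nu' => [|a s IH] D nu nu' Dl /=; first exact: Dl.
rewrite (IH D (con a nu) (con a nu')) // (@eq_pwedge (fun v => con a (D v)) (fun v => con a (D v))
   (eps (fun t => c *: nu t + nu' t)) (fun t => c *: eps nu t + eps nu' t)) //.
  rewrite (IH (fun v => con a (D v)) (eps nu) (eps nu')); last exact: Dlin_con.
  by rewrite scalerDr addrACA.
by move=> t; rewrite /eps scalerDr !scalerA mulrC.
Qed.

Lemma pwedgeZ D c nu s : Dlin D ->
  pwedge D (fun t => c *: nu t) s = c *: pwedge D nu s.
Proof.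
move=> Dl; have E : pwedge D (fun=> 0) s = 0.
  have := @pwedgeP D (-1) (fun=> 0) (fun=> 0) s Dl.
  by rewrite scaler0 addr0 => ->; rewrite scaleN1r addNr.
rewrite -[RHS]addr0 -E -pwedgeP //; apply: eq_pwedge => // t.
by rewrite addr0.
Qed.

Lemma pwedge0 D s : Dlin D -> pwedge D (fun=> 0) s = 0.
Proof. by move=> Dl; have := @pwedgeZ D 0 (fun=> 0) s Dl; rewrite !scale0r. Qed.

Lemma pwedgeD D nu nu' s : Dlin D ->
  pwedge D (fun t => nu t + nu' t) s = pwedge D nu s + pwedge D nu' s.
Proof.
move=> Dl; rewrite -[X in _ = X + _]scale1r -pwedgeP //.
by apply: eq_pwedge => // t; rewrite scale1r.
Qed.

Lemma pwedgeN D nu s : Dlin D ->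
  pwedge D (fun t => - nu t) s = - pwedge D nu s.
Proof.
move=> Dl; rewrite -scaleN1r -pwedgeZ //.
by apply: eq_pwedge => // t; rewrite scaleN1r.
Qed.

Lemma pwedge_Dlin D D' c nu s :
  pwedge (fun v t => c *: D v t + D' v t) nu s =
  c *: pwedge D nu s + pwedge D' nu s.
Proof.
elim: s D D' nu => [|a s IH] D D' nu //=.
rewrite (IH D D' (con a nu)) (IH (fun v => con a (D v)) (fun v => con a (D' v))).
by rewrite scalerDr addrACA.
Qed.

Lemma pwedge_D0 nu s : pwedge (fun _ _ => 0 : W') nu s = 0.
Proof. by elim: s nu => [|a s IH] nu //=; rewrite !IH addr0. Qed.

Lemma pwedge_DD D D' nu s :
  pwedge (fun v t => D v t + D' v t) nu s = pwedge D nu s + pwedge D' nu s.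
Proof.
rewrite -[X in _ = X + _]scale1r -pwedge_Dlin.
by apply: eq_pwedge => // v t; rewrite scale1r.
Qed.

Lemma pwedge_DZ D c nu s :
  pwedge (fun v t => c *: D v t) nu s = c *: pwedge D nu s.
Proof.
rewrite -[RHS]addr0 -(pwedge_D0 nu s) -pwedge_Dlin.
by apply: eq_pwedge => // v t; rewrite addr0.
Qed.

Lemma pwedge_DN D nu s :
  pwedge (fun v t => - D v t) nu s = - pwedge D nu s.
Proof.
by rewrite -scaleN1r -pwedge_DZ; apply: eq_pwedge => // v t; rewrite scaleN1r.
Qed.

(** This justifies reading [pwedge] as a sum over a decomposition. Linearity of [D] lets the value
    of [xi] leave its argument. *)
Lemma pwedge_tens D (xi : seq V -> S^o) v s : Dlin D ->
  pwedge D (fun t => (xi t : S) *: v) s = wedge_fun xi (D v) s.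
Proof.
elim: s D xi => [|a s IH] D xi Dl.
  by rewrite /= -[X in D X]addr0 Dl Dlin0 // addr0.
rewrite pwedge_cons wedge_fun_cons -IH // -(IH (fun v => con a (D v))).
  congr (_ + _); apply: eq_pwedge => // t.
  by rewrite /eps scalerA.
exact: Dlin_con.
Qed.

Lemma eps_pwedge D nu s : Dlin D ->
  pwedge (fun v => eps (D v)) (eps nu) s = eps (pwedge D nu) s.
Proof.
elim: s D nu => [|a s IH] D nu Dl.
  by rewrite /eps /= !expr0 !scale1r.
rewrite pwedge_cons (@eq_pwedge (fun v => eps (D v)) (fun v => eps (D v))
   (con a (eps nu)) (fun t => - eps (con a nu) t)) //.
  rewrite pwedgeN; last first.
    by move=> c u v t; rewrite /eps Dl scalerDr !scalerA mulrC.
  rewrite (@eq_pwedge (fun v => con a (eps (D v))) (fun v t => - eps (con a (D v)) t)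
     (eps (eps nu)) (eps (eps nu))) //.
    rewrite pwedge_DN !IH //; last exact: Dlin_con.
    by rewrite -opprD -scalerDr /eps /= exprS mulN1r scaleNr.
  by move=> v t; rewrite eps_con.
by move=> t; rewrite eps_con.
Qed.

Lemma pwedge_homog D nu d k : Dlin D -> rhomog d nu -> (forall v, rhomog k (D v)) ->
  rhomog (d + k) (pwedge D nu).
Proof.
move=> Dl hn hD s; elim: s D nu d k Dl hn hD => [|a s IH] D nu d k Dl hn hD.
  (* On the empty sequence, a degree d + k other than 0 forces one of the two factors to vanish. *)
  rewrite /= => Z; have [d0|d0] := eqVneq d 0.
    by apply: hD => /= k0; apply: Z; rewrite -k0 d0.
  by rewrite hn ?Dlin0 //= => k0; rewrite -k0 eqxx in d0.
move=> Z; rewrite pwedge_cons (IH _ _ (d - 1) k) //.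
- rewrite add0r (IH _ _ d (k - 1)) //; first exact: Dlin_con.
  + by move=> t tz; rewrite /eps hn // scaler0.
  + move=> v t tz; apply: hD => /= tz'; apply: tz; lia.
  + move=> tz; apply: Z => /=; lia.
- move=> t tz; apply: hn => /= tz'; apply: tz; lia.
- move=> tz; apply: Z => /=; lia.
Qed.

End PWedge.
End RawForms.

Section EpsTheory.
Context {S : comPzRingType} {V W : lmodType S}.
Implicit Types (f y : seq V -> S^o) (nu : seq V -> W) (a : V) (s : seq V).

(** The ordinary wedge is the case where [D] multiplies [nu] by a scalar, so facts on [pwedge]
    transfer to it. *)
Lemma wedge_pwedge f nu s :
  wedge_fun f nu s = pwedge (fun (c : S^o) t => (c : S) *: nu t) f s.
Proof.
elim: s f nu => [|a s IH] f nu //.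
by rewrite wedge_fun_cons !IH pwedge_cons.
Qed.

Lemma wedge_homog f nu d k :
  rhomog d f -> rhomog k nu -> rhomog (d + k) (wedge_fun f nu).
Proof.
move=> hf hn s sz; rewrite wedge_pwedge; apply: pwedge_homog sz => //.
  by move=> c u v t; rewrite scalerDl scalerA.
by move=> c t tz; rewrite hn ?scaler0.
Qed.

Lemma epsb_con b a nu s : con a (epsb b nu) s = (-1) ^+ b *: epsb b (con a nu) s.
Proof. by case: b; rewrite /= ?scale1r // eps_con scaleN1r. Qed.

Lemma eps_homog n nu : rhomog n%:Z nu -> forall s, eps nu s = (-1) ^+ odd n *: nu s.
Proof.
move=> hn s; have [<-|sn] := eqVneq (size s) n; first by rewrite signr_odd.
by rewrite /eps hn ?scaler0 // => -[] E; rewrite E eqxx in sn.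
Qed.

Lemma epsb_homog (b : bool) (n : nat) nu : rhomog n%:Z nu ->
  forall s, epsb b nu s = (-1) ^+ (b && odd n) *: nu s.
Proof. by case: b => hn s; rewrite /= ?scale1r //; exact: eps_homog. Qed.

Lemma epsb_epsb b b' nu : epsb b (epsb b' nu) = epsb (b (+) b') nu.
Proof. by case: b b' => [] [] //=; rewrite epsK. Qed.

Lemma con_homog a n nu : rhomog n.+1%:Z nu -> rhomog n%:Z (con a nu).
Proof. by move=> hn s sn; apply: hn => /= -[] E; apply: sn; rewrite E. Qed.

Lemma con_homog0 a nu s : rhomog 0 nu -> con a nu s = 0.
Proof. by move=> hn; apply: hn. Qed.

End EpsTheory.

Section PWedgeAlgebra.
Context {S : comPzRingType} {V W W' : lmodType S}.
Implicit Types (f y : seq V -> S^o) (nu : seq V -> W) (a : V) (s : seq V).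
Implicit Types (D : W -> seq V -> W').

Lemma pwedge_wedge D f nu s : Dlin D ->
  pwedge D (wedge_fun f nu) s = wedge_fun f (pwedge D nu) s.
Proof.
elim: s D f nu => [|a s IH] D f nu Dl.
  by rewrite /= -[X in D X]addr0 Dl Dlin0 // addr0.
rewrite pwedge_cons (@eq_pwedge _ _ _ _ D D (con a (wedge_fun f nu)) (fun t =>
  wedge_fun (con a f) nu t + wedge_fun (eps f) (con a nu) t)) //.
rewrite pwedgeD // !IH // (@eq_pwedge _ _ _ _ (fun v => con a (D v))
  (fun v => con a (D v)) (eps (wedge_fun f nu)) (wedge_fun (eps f) (eps nu))) //.
  rewrite IH; last exact: Dlin_con.
  by rewrite wedge_fun_cons -addrA -wedge_funDr.
by move=> t; rewrite eps_wedge.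
Qed.

Lemma pwedge_wedger (D : W -> seq V -> S^o) (w : seq V -> W') nu s : Dlin D ->
  pwedge (fun v => wedge_fun (D v) w) nu s = wedge_fun (pwedge D nu) w s.
Proof.
elim: s D w nu => [|a s IH] D w nu Dl; first by [].
rewrite pwedge_cons IH // (@eq_pwedge _ _ _ _
  (fun v => con a (wedge_fun (D v) w)) (fun v t => wedge_fun (con a (D v)) w t +
    wedge_fun (eps (D v)) (con a w) t) (eps nu) (eps nu)) //.
rewrite pwedge_DD !IH; [|by move=> c u v t; rewrite /eps Dl scalerDr !scalerA (mulrC c)|
  exact: Dlin_con].
rewrite addrA -wedge_funDl wedge_fun_cons; congr (_ + _).
by apply: eq_wedge => // t; rewrite eps_pwedge.
Qed.

(** Moving [y] in front of coefficients of degree n costs (-1)^(n|y|), which is carried by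
    [epsb (odd n) y]. *)
Lemma pwedge_wedgel D y nu n s : Dlin D -> rhomog n%:Z nu ->
  pwedge (fun v => wedge_fun y (D v)) nu s =
  wedge_fun (epsb (odd n) y) (pwedge D nu) s.
Proof.
elim: s D y nu n => [|a s IH] D y nu n Dl hn.
  case: n hn => [|n] hn /=; first by [].
  have e : epsb (~~ odd n) y [::] = y [::] by case: (~~ _); rewrite // /= /eps scale1r.
  by rewrite e.
have Cl : Dlin (fun v => con a (D v)) by exact: Dlin_con.
have wl D' z : Dlin D' -> Dlin (fun v => wedge_fun z (D' v)).
  by move=> Dl' c u v t; rewrite -wedge_funPr; exact: eq_wedge.
rewrite pwedge_cons (@eq_pwedge _ _ _ _
  (fun v => con a (wedge_fun y (D v))) (fun v t => wedge_fun (con a y) (D v) t +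
    wedge_fun (eps y) (con a (D v)) t) (eps nu) (fun t => (-1) ^+ odd n *: nu t)) //;
  last exact: eps_homog.
rewrite pwedge_DD !pwedgeZ //; try exact: wl.
rewrite (IH _ _ nu n) // (IH _ _ nu n) // wedge_fun_cons.
rewrite (@eq_wedge _ _ _ (con a (epsb (odd n) y)) (fun t =>
  (-1) ^+ odd n *: epsb (odd n) (con a y) t) (pwedge D nu) (pwedge D nu)) //;
  last by move=> t; rewrite epsb_con.
rewrite wedge_funZl addrCA; congr (_ + _).
have -> : eps (epsb (odd n) y) = epsb (odd n) (eps y).
  by case: (odd n).
rewrite [in RHS](@eq_wedge _ _ _ (epsb (odd n) (eps y)) (epsb (odd n) (eps y))
  (con a (pwedge D nu)) (fun t => pwedge D (con a nu) t +
  pwedge (fun v => con a (D v)) (eps nu) t)) // wedge_funDr; congr (_ + _).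
  (* In degree 0 there is no degree n - 1 for the induction hypothesis, but then the contraction of
     [nu] vanishes. *)
  case: n hn => [|n] hn /=.
    rewrite (@eq_pwedge _ _ _ _ (fun v => wedge_fun y (D v))
      (fun v => wedge_fun y (D v)) (con a nu) (fun=> 0)) //; last first.
      by move=> t; exact: con_homog0.
    rewrite pwedge0; last exact: wl.
    rewrite (@eq_wedge _ _ _ (eps y) (eps y) _ (fun=> 0)) ?wedge_fun0r //.
    move=> t; rewrite (@eq_pwedge _ _ _ _ D D (con a nu) (fun=> 0)) ?pwedge0 //.
    by move=> x; exact: con_homog0.
  rewrite (IH _ _ (con a nu) n) //; last exact: con_homog.
  by case: (odd n) => //=; rewrite epsK.
rewrite -wedge_funZr; apply: eq_wedge => // t; rewrite -pwedgeZ //.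
by apply: eq_pwedge => // x; rewrite (eps_homog hn).
Qed.

Lemma pwedge_form0 (h : W -> W') nu s :
  pwedge (fun v t => if t is [::] then h v else 0) nu s = h (nu s).
Proof.
elim: s nu => [|a s IH] nu //; rewrite pwedge_cons IH.
rewrite (@eq_pwedge _ _ _ _ (fun v => con a _) (fun _ _ => 0) (eps nu) (eps nu)) //.
by rewrite pwedge_D0 addr0.
Qed.

End PWedgeAlgebra.

(** Graded commutativity is [pwedge_wedgel] for the tautological [D] sending a scalar to the
    corresponding form of degree 0. *)
Lemma wedge_comm {S : comPzRingType} {V : lmodType S} (f y : seq V -> S^o) n s : rhomog n%:Z f ->
  wedge_fun f y s = wedge_fun (epsb (odd n) y) f s.
Proof.
move=> hf; pose D (c : S^o) (t : seq V) : S^o := if t is [::] then c else 0.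
rewrite -[RHS](@eq_wedge _ _ _ (epsb (odd n) y) (epsb (odd n) y) (pwedge D f) f) //.
  rewrite -pwedge_wedgel //; last first.
    by move=> c u v [|b t] /=; rewrite ?scaler0 ?addr0.
  rewrite wedge_pwedge; apply: eq_pwedge => // c t.
  by rewrite wedge_constr; exact: mulrC.
by move=> t; rewrite /D (@pwedge_form0 _ _ S^o S^o id).
Qed.

(** * Lie derivatives and the Koszul formula *)

Section Multilinear.
Context {S : comPzRingType} {V W : lmodType S}.
Implicit Types (w : seq V -> W) (a b : V) (s : seq V).

Definition mlin w : Prop := forall s t c a b,
  w (s ++ (c *: a + b) :: t) = c *: w (s ++ a :: t) + w (s ++ b :: t).

(** Only adjacent repetitions are mentioned, since this is what inductions produce;
    [mlin_alt_is_form] recovers the general case by transpositions. *)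
Definition alt w : Prop := forall s t a, w (s ++ a :: a :: t) = 0.

Lemma mlin_con w a : mlin w -> mlin (con a w).
Proof. by move=> wl s t; exact: (wl (a :: s)). Qed.

Lemma alt_con w a : alt w -> alt (con a w).
Proof. by move=> wl s t; exact: (wl (a :: s)). Qed.

Lemma mlinD w s t a b : mlin w -> w (s ++ (a + b) :: t) = w (s ++ a :: t) + w (s ++ b :: t).
Proof. by move=> wl; have := wl s t 1 a b; rewrite !scale1r. Qed.

Lemma mlin0 w s t : mlin w -> w (s ++ 0 :: t) = 0.
Proof.
move=> wl; have := wl s t (-1) 0 0; rewrite scaler0 addr0 => ->.
by rewrite scaleN1r addNr.
Qed.

Lemma mlinN w s t a : mlin w -> w (s ++ (- a) :: t) = - w (s ++ a :: t).
Proof.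
by move=> wl; have := wl s t (-1) a 0; rewrite addr0 !scaleN1r mlin0 // addr0.
Qed.

Lemma alt_swap w s t a b : mlin w -> alt w ->
  w (s ++ a :: b :: t) = - w (s ++ b :: a :: t).
Proof.
move=> wl wa; apply/eqP; rewrite -addr_eq0; apply/eqP.
have E x y : s ++ x :: y :: t = (s ++ [:: x]) ++ y :: t by rewrite -catA.
have := wa s t (a + b); rewrite mlinD // (E a (a + b)) (E b (a + b)) !mlinD //.
by rewrite -!E !wa add0r addr0.
Qed.

Lemma con_swap w a b s : mlin w -> alt w -> w (a :: b :: s) = - w (b :: a :: s).
Proof. exact: (@alt_swap w [::]). Qed.

Lemma mlin_alt_is_form w : mlin w -> alt w -> is_form w.
Proof.
move=> wl wa; split=> // s t; elim: t s => [|b t IH] s u a; first exact: wa.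
by rewrite /= alt_swap // -(cat_rcons b) IH oppr0.
Qed.

Lemma is_form_mlin w : is_form w -> mlin w.
Proof. by case. Qed.

Lemma is_form_alt w : is_form w -> alt w.
Proof. by case=> _ wa s t a; exact: (wa s [::] t a). Qed.

Lemma del0 a s : del 0 (a :: s) = s.
Proof. by rewrite /del take0 /= drop0. Qed.

Lemma delS i a s : del i.+1 (a :: s) = a :: del i s.
Proof. by []. Qed.

End Multilinear.

Section LieDerivative.
Context {S : comPzRingType} {V W : lmodType S}.
Implicit Types (w : seq V -> W) (a b : V) (s : seq V).

(* The derivation of the forms induced by a derivation [delta] of the values and
   a derivation [tau] of the arguments. *)
Fixpoint lie (delta : W -> W) (tau : V -> V) w s : W :=
  if s is a :: s' then lie delta tau (con a w) s' - w (tau a :: s')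
  else delta (w [::]).

Lemma lie_cons delta tau w a s :
  lie delta tau w (a :: s) = lie delta tau (con a w) s - w (tau a :: s).
Proof. by []. Qed.

Lemma eq_lie delta tau w w' s : w =1 w' ->
  lie delta tau w s = lie delta tau w' s.
Proof. by move=> /funext ->. Qed.

Section Delta.
Variables (delta : W -> W) (tau : V -> V) (delta0 : S -> S).
Hypothesis deltaD : forall x y, delta (x + y) = delta x + delta y.
Hypothesis deltaZ : forall c x, delta (c *: x) = c *: delta x + delta0 c *: x.

Lemma delta_0 : delta 0 = 0.
Proof. by apply: (addrI (delta 0)); rewrite -deltaD !addr0. Qed.

Lemma delta_N x : delta (- x) = - delta x.
Proof. by apply/eqP; rewrite -addr_eq0 -deltaD addNr delta_0. Qed.

Lemma delta_sign n x : delta ((-1) ^+ n *: x) = (-1) ^+ n *: delta x.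
Proof.
by rewrite -signr_odd; case: (odd n); rewrite ?scale1r // !scaleN1r delta_N.
Qed.

Lemma lieD w w' s :
  lie delta tau (fun t => w t + w' t) s = lie delta tau w s + lie delta tau w' s.
Proof.
elim: s w w' => [|a s IH] w w' /=; first exact: deltaD.
by rewrite (IH (con a w) (con a w')) opprD addrACA.
Qed.

Lemma lieZ c w s :
  lie delta tau (fun t => c *: w t) s = c *: lie delta tau w s + delta0 c *: w s.
Proof.
elim: s w => [|a s IH] w /=; first exact: deltaZ.
by rewrite (IH (con a w)) scalerBr addrAC.
Qed.

Lemma lieN w s : lie delta tau (fun t => - w t) s = - lie delta tau w s.
Proof.
apply/eqP; rewrite -addr_eq0 -lieD; apply/eqP.
elim: s w => [|a s IH] w /=; first by rewrite addNr delta_0.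
by rewrite (IH (con a w)) addNr oppr0 addr0.
Qed.

Lemma lie_eps w s : lie delta tau (eps w) s = eps (lie delta tau w) s.
Proof.
elim: s w => [|a s IH] w; first by rewrite /eps /= scale1r -delta_sign scale1r.
rewrite lie_cons (@eq_lie _ _ (con a (eps w)) (fun t => - eps (con a w) t)).
  by rewrite lieN IH /eps /= exprS mulN1r !scaleNr scalerBr opprB opprK addrC.
by move=> t; rewrite eps_con.
Qed.

Hypothesis tauP : forall c a b, tau (c *: a + b) = c *: tau a + delta0 c *: a + tau b.

(** [delta] and [tau] are derivations over the same [delta0], so the two terms in [delta0 c]
    cancel. *)
Lemma lie_mlin w : mlin w -> mlin (lie delta tau w).
Proof.
move=> wl s; elim: s w wl => [|x s IH] w wl t c a b.
  rewrite !cat0s !lie_cons tauP -addrA (wl [::]) (wl [::]) /=.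
  rewrite (@eq_lie _ _ _ (fun t => c *: con a w t + con b w t)).
    by rewrite lieD lieZ /con scalerBr; zmod.
  by move=> u; exact: (wl [::]).
rewrite !cat_cons !lie_cons IH; last exact: mlin_con.
by rewrite (wl (tau x :: s)) scalerBr opprD addrACA.
Qed.

Lemma lie_alt w : mlin w -> alt w -> alt (lie delta tau w).
Proof.
move=> wl wa s; elim: s w wl wa => [|x s IH] w wl wa t a.
  rewrite cat0s !lie_cons (@eq_lie _ _ _ (fun=> 0)); last by move=> u; exact: (wa [::]).
  have -> : lie delta tau (fun=> 0) t = 0.
    have := lieN (fun=> 0) t; rewrite oppr0 => E.
    by elim: t {E} => [|y t IH] /=; rewrite ?delta_0 // (IH : lie _ _ (con y (fun=> 0)) t = 0) subr0.
  by rewrite /con sub0r con_swap // opprK subrr.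
rewrite cat_cons lie_cons IH ?sub0r; [|exact: mlin_con|exact: alt_con].
by rewrite (wa (tau x :: s)) oppr0.
Qed.

(** The link with the Koszul formula, where the modified argument stands in front; bringing it there
    from position i produces (-1)^i. *)
Lemma lie_sum w s : mlin w -> alt w -> lie delta tau w s =
  delta (w s) - \sum_(i < size s) (-1) ^+ i *: w (tau s`_i :: del i s).
Proof.
elim: s w => [|a s IH] w wl wa; first by rewrite /= big_ord0 subr0.
rewrite lie_cons IH; [|exact: mlin_con|exact: alt_con].
rewrite big_ord_recl /= del0 expr0 scale1r -addrA; congr (_ + _).
rewrite opprD addrC; congr (_ + _); rewrite -!sumrN; apply: eq_bigr => i _.
rewrite /con /bump /= add1n exprS mulN1r scaleNr opprK -scalerN.
by rewrite -con_swap.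
Qed.

End Delta.

Lemma lie_homog delta tau d w : delta 0 = 0 -> rhomog d w ->
  rhomog d (lie delta tau w).
Proof.
move=> d0 hw s; elim: s d w hw => [|a s IH] d w hw sz; first by rewrite /= hw.
rewrite lie_cons (IH (d - 1)) ?hw ?subr0 //.
  by move=> t tz; apply: hw => /= tz'; apply: tz; lia.
by move=> tz; apply: sz => /=; lia.
Qed.

Lemma lie_comm (d1 d2 d3 : W -> W) (t1 t2 t3 : V -> V) w s :
  (forall x y, d1 (x + y) = d1 x + d1 y) -> (forall x y, d2 (x + y) = d2 x + d2 y) ->
  (forall x, d3 x = d1 (d2 x) - d2 (d1 x)) ->
  (forall a, t3 a = t1 (t2 a) - t2 (t1 a)) -> mlin w ->
  lie d3 t3 w s = lie d1 t1 (lie d2 t2 w) s - lie d2 t2 (lie d1 t1 w) s.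
Proof.
move=> D1 D2 D3 T3; elim: s w => [|a s IH] w wl; first exact: D3.
rewrite lie_cons IH; last exact: mlin_con.
rewrite !lie_cons T3 (@mlinD _ _ _ w [::]) // (@mlinN _ _ _ w [::]) // !cat0s.
rewrite (@eq_lie d1 t1 (con a (lie d2 t2 w)) (fun t => lie d2 t2 (con a w) t +
  (fun t => - (con (t2 a) w) t) t)) // lieD // (@lieN d1 t1) //.
rewrite (@eq_lie d2 t2 (con a (lie d1 t1 w)) (fun t => lie d1 t1 (con a w) t +
  (fun t => - (con (t1 a) w) t) t)) // lieD // (@lieN d2 t2) //.
zmod.
Qed.

End LieDerivative.

(** * Lie-Rinehart algebras: Cartan calculus and the square of the differential *)

Section LieRinehart.
Context {S : comPzRingType} {V : lmodType S}.

(** The algebraic part of a Lie algebroid. Antisymmetry is recorded as [br a a = 0], the form in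
    which [kz_alt] consumes it; over a general ring one could not divide by 2. *)
Record lie_rinehart (rho : V -> S -> S) (br : V -> V -> V) : Prop := LieRinehart {
  lr_rhoP : forall c a b f, rho (c *: a + b) f = c * rho a f + rho b f;
  lr_brP : forall a c b b', br a (c *: b + b') = c *: br a b + rho a c *: b + br a b';
  lr_Pbr : forall c a a' b, br (c *: a + a') b = c *: br a b - rho b c *: a + br a' b;
  lr_brxx : forall a, br a a = 0;
  lr_jacobi : forall a b c, br (br a b) c = br a (br b c) - br b (br a c) }.

Record flat_rep (rho : V -> S -> S) (br : V -> V -> V) (W : lmodType S)
    (nabla : V -> W -> W) : Prop := FlatRep {
  fr_D : forall a x y, nabla a (x + y) = nabla a x + nabla a y;
  fr_Z : forall a c x, nabla a (c *: x) = c *: nabla a x + rho a c *: x;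
  fr_P : forall c a b x, nabla (c *: a + b) x = c *: nabla a x + nabla b x;
  fr_flat : forall a b x, nabla (br a b) x = nabla a (nabla b x) - nabla b (nabla a x) }.

Variables (rho : V -> S -> S) (br : V -> V -> V).
Hypothesis LR : lie_rinehart rho br.
(** That [rho] acts by derivations and respects brackets is expressed by making the functions a flat
    representation. *)
Hypothesis FR0 : @flat_rep rho br S^o rho.

Section Koszul.
Context {W : lmodType S} (nabla : V -> W -> W).
Implicit Types (w : seq V -> W) (a b : V) (s : seq V).

(* The Koszul formula computed by Cartan's rule [i_a d = L_a - d i_a]. *)
Fixpoint kz w s : W :=
  if s is a :: s' then lie (nabla a) (br a) w s' - kz (con a w) s' else 0.

Lemma kz_cons w a s : kz w (a :: s) = lie (nabla a) (br a) w s - kz (con a w) s.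
Proof. by []. Qed.

Lemma eq_kz w w' s : w =1 w' -> kz w s = kz w' s.
Proof. by move=> /funext ->. Qed.

Hypothesis FR : flat_rep rho br nabla.
Let nD := fr_D FR.
Let nZ := fr_Z FR.

(** In the Koszul formula the terms involving index 0 form the Lie derivative along the first
    argument, by [lie_sum]; the others are minus the Koszul formula of the contracted form. *)
Lemma koszulE w s : is_form w -> koszul br nabla w s = kz w s.
Proof.
elim: s w => [|a s IH] w fw; first by rewrite /koszul /= !big_ord0 addr0.
have [wl wa] := (is_form_mlin fw, is_form_alt fw).
rewrite kz_cons -IH; last first.
  by apply: mlin_alt_is_form; [exact: mlin_con|exact: alt_con].
rewrite lie_sum // /koszul [size (a :: s)]/=.
rewrite [X in X + _]big_ord_recl [X in _ + X]big_ord_recl /= del0 expr0 scale1r.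
rewrite -!addrA; congr (_ + _).
have E1 : \sum_(i < size s) (-1) ^+ bump 0 i *:
    nabla (nth 0 (a :: s) (bump 0 i)) (w (del (bump 0 i) (a :: s))) =
    - \sum_(i < size s) (-1) ^+ i *: nabla s`_i (con a w (del i s)).
  rewrite -sumrN; apply: eq_bigr => i _.
  by rewrite /bump /= add1n delS exprS mulN1r scaleNr.
have E2 : \sum_(j < (size s).+1 | (0 < j)%N) (-1) ^+ (0 + j) *:
    w (br a (nth 0 (a :: s) j) :: del 0 (del j (a :: s))) =
    - \sum_(i < size s) (-1) ^+ i *: w (br a s`_i :: del i s).
  rewrite big_mkcond big_ord_recl /= add0r -sumrN; apply: eq_bigr => i _.
  by rewrite /bump /= add1n add0n delS del0 exprS mulN1r scaleNr.
have E3 : \sum_(i < size s) \sum_(j < (size s).+1 | (bump 0 i < j)%N)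
    (-1) ^+ (bump 0 i + j) *: w (br (nth 0 (a :: s) (bump 0 i)) (nth 0 (a :: s) j)
      :: del (bump 0 i) (del j (a :: s))) =
  - \sum_(i < size s) \sum_(j < size s | (i < j)%N) (-1) ^+ (i + j) *:
      con a w (br s`_i s`_j :: del i (del j s)).
  rewrite -sumrN; apply: eq_bigr => i _; rewrite -sumrN.
  rewrite big_mkcond big_ord_recl /= add0r -big_mkcond /=.
  apply: eq_big => [j|j _]; first by rewrite /bump /= !add1n.
  rewrite /bump /= !add1n !delS addSn addnS !exprS !mulN1r opprK /con.
  by rewrite con_swap // scalerN.
rewrite E1 E2 E3 /=; zmod.
Qed.

Lemma kzD w w' s : kz (fun t => w t + w' t) s = kz w s + kz w' s.
Proof.
elim: s w w' => [|a s IH] w w'; first by rewrite addr0.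
by rewrite !kz_cons (lieD _ (nD a)) (IH (con a w) (con a w')); zmod.
Qed.

Lemma kz0 s : kz (fun=> 0) s = 0.
Proof. by apply: (addrI (kz (fun=> 0) s)); rewrite addr0 -kzD; apply: eq_kz => t; rewrite addr0. Qed.

Lemma kzN w s : kz (fun t => - w t) s = - kz w s.
Proof.
apply/eqP; rewrite -addr_eq0 -kzD -(kz0 s); apply/eqP.
by apply: eq_kz => t; rewrite addNr.
Qed.

Lemma kz_eps w s : kz (eps w) s = - eps (kz w) s.
Proof.
elim: s w => [|a s IH] w; first by rewrite /eps scaler0 oppr0.
rewrite kz_cons (lie_eps _ (nD a)) (@eq_kz _ (fun t => - eps (con a w) t)); last first.
  by move=> t; rewrite eps_con.
by rewrite kzN IH /eps /= exprS mulN1r scaleNr scalerBr; zmod.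
Qed.

Lemma kz_homog d w : rhomog d w -> rhomog (d + 1) (kz w).
Proof.
move=> hw s; elim: s d w hw => [|a s IH] d w hw sz; first by [].
rewrite kz_cons (@lie_homog _ _ _ _ _ d) ?(IH (d - 1)) ?subr0 //.
- by move=> t tz; apply: hw => /= tz'; apply: tz; lia.
- by move=> tz; apply: sz => /=; lia.
- exact: delta_0 (nD a).
- by move=> tz; apply: sz => /=; lia.
Qed.

(** Induction by Cartan's rule i_b L_a = L_a i_b - i_[a,b]; flatness and Jacobi enter through the
    commutator of two Lie derivatives. *)
Lemma lie_kz a w s : mlin w ->
  lie (nabla a) (br a) (kz w) s = kz (lie (nabla a) (br a) w) s.
Proof.
elim: s w => [|b s IH] w wl; first exact: delta_0 (nD a).
rewrite lie_cons (@eq_lie _ _ _ _ _ (con b (kz w)) (fun t =>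
  lie (nabla b) (br b) w t + (fun t => - kz (con b w) t) t)) //.
rewrite (lieD _ (nD a)) (lieN _ (nD a)) IH; last exact: mlin_con.
rewrite !kz_cons (@eq_kz (con b (lie (nabla a) (br a) w)) (fun t =>
  lie (nabla a) (br a) (con b w) t + (fun t => - con (br a b) w t) t)) //.
rewrite kzD kzN (@lie_comm _ _ _ (nabla a) (nabla b) (nabla (br a b))
  (br a) (br b) (br (br a b)) w s (nD a) (nD b)) //.
- by zmod.
- by move=> x; exact: fr_flat FR _ _ _.
- by move=> x; exact: lr_jacobi LR _ _ _.
Qed.

Lemma brP a c b b' : br a (c *: b + b') = c *: br a b + rho a c *: b + br a b'.
Proof. exact: lr_brP LR _ _ _ _. Qed.

(** Contraction gives i_a d d = L_a d - d L_a + d d i_a; the first two terms cancel by [lie_kz] and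
    the last falls to the induction hypothesis. *)
Lemma kz_kz w s : mlin w -> kz (kz w) s = 0.
Proof.
elim: s w => [|a s IH] w wl; first by [].
rewrite kz_cons lie_kz // (@eq_kz (con a (kz w)) (fun t =>
  lie (nabla a) (br a) w t + (fun t => - kz (con a w) t) t)) //.
by rewrite kzD kzN IH ?oppr0 ?addr0 ?subrr //; exact: mlin_con.
Qed.

End Koszul.

Section Leibniz.
Context {W : lmodType S} (nabla : V -> W -> W).
Hypothesis FR : flat_rep rho br nabla.
Implicit Types (f : seq V -> S^o) (w : seq V -> W) (a b : V) (s : seq V).

Lemma lie_wedge (delta0 : S^o -> S^o) (delta : W -> W) tau f w s :
  (forall x y, delta0 (x + y) = delta0 x + delta0 y) ->
  (forall x y, delta (x + y) = delta x + delta y) ->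
  (forall c x, delta (c *: x) = c *: delta x + (delta0 c : S) *: x) ->
  lie delta tau (wedge_fun f w) s =
  wedge_fun (lie delta0 tau f) w s + wedge_fun f (lie delta tau w) s.
Proof.
move=> D0 D1 DZ; elim: s f w => [|a s IH] f w; first by rewrite /= DZ addrC.
rewrite lie_cons (@eq_lie _ _ _ _ _ (con a (wedge_fun f w)) (fun t =>
  wedge_fun (con a f) w t + wedge_fun (eps f) (con a w) t)) //.
rewrite (lieD _ D1) !IH !wedge_fun_cons.
rewrite (@eq_wedge _ _ _ (con a (lie delta0 tau f)) (fun t =>
  lie delta0 tau (con a f) t + (fun t => - con (tau a) f t) t) w w) //.
rewrite (@eq_wedge _ _ _ (eps f) (eps f) (con a (lie delta tau w)) (fun t =>
  lie delta tau (con a w) t + (fun t => - con (tau a) w t) t)) //.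
rewrite wedge_funDl wedge_funDr wedge_funNl wedge_funNr.
rewrite (@eq_wedge _ _ _ (lie delta0 tau (eps f)) (eps (lie delta0 tau f)) _ (con a w)) //.
  by zmod.
by move=> t; rewrite lie_eps.
Qed.

Lemma kz_wedge f w s : kz nabla (wedge_fun f w) s =
  wedge_fun (kz (rho : V -> S^o -> S^o) f) w s + wedge_fun (eps f) (kz nabla w) s.
Proof.
elim: s f w => [|a s IH] f w; first by rewrite /= scale0r scaler0 addr0.
rewrite kz_cons (@lie_wedge (rho a)); [|exact: fr_D FR0 _|exact: fr_D FR _|exact: fr_Z FR _].
rewrite (@eq_kz _ _ (con a (wedge_fun f w)) (fun t =>
  wedge_fun (con a f) w t + wedge_fun (eps f) (con a w) t)) //.
rewrite (kzD FR) !IH epsK !wedge_fun_cons epsK.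
rewrite (@eq_wedge _ _ _ (con a (kz (rho : V -> S^o -> S^o) f)) (fun t =>
  lie (rho a : S^o -> S^o) (br a) f t +
  (fun t => - kz (rho : V -> S^o -> S^o) (con a f) t) t) w w) //.
rewrite (@eq_wedge _ _ _ f f (con a (kz nabla w)) (fun t =>
  lie (nabla a) (br a) w t + (fun t => - kz nabla (con a w) t) t)) //.
rewrite wedge_funDl wedge_funDr wedge_funNl wedge_funNr.
rewrite (@eq_wedge _ _ _ (kz (rho : V -> S^o -> S^o) (eps f))
  (fun t => - eps (kz (rho : V -> S^o -> S^o) f) t) _ (con a w)) //; last first.
  by move=> t; rewrite (kz_eps FR0).
rewrite (@eq_wedge _ _ _ (con a (eps f)) (fun t => - eps (con a f) t) _ (kz nabla w)) //;
  last by move=> t; rewrite eps_con.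
by rewrite !wedge_funNl; zmod.
Qed.

Definition dfun (c : S) (s : seq V) : S^o := if s is [:: a] then rho a c else 0.

Lemma rho0 a : rho a 0 = 0.
Proof. exact: delta_0 (fr_D FR0 a). Qed.

Lemma kz_const (c : S) s :
  kz (rho : V -> S^o -> S^o) (fun t => if t is [::] then c else 0) s = dfun c s.
Proof.
case: s => [|a s]; first by [].
rewrite kz_cons (@eq_kz _ _ (con a _) (fun=> 0)) // (kz0 FR0) subr0.
case: s => [|b s] //; rewrite lie_cons subr0.
rewrite (_ : con b _ = fun=> 0) //; elim: s => [|x s IH]; first exact: rho0.
by rewrite lie_cons (IH : lie _ _ (con x _) s = 0) subr0.
Qed.

Lemma wedge_dfun_cons c w a s :
  wedge_fun (dfun c) w (a :: s) = rho a c *: w s - wedge_fun (dfun c) (con a w) s.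
Proof.
rewrite wedge_fun_cons (@eq_wedge _ _ _ (con a (dfun c))
  (fun t => if t is [::] then rho a c else 0) w w) ?wedge_const //.
congr (_ + _); rewrite -wedge_funNl; apply: eq_wedge => // -[|b [|x t]].
- by rewrite /eps /= scaler0 oppr0.
- by rewrite /eps /= expr1 scaleN1r.
- by rewrite /eps /= scaler0 oppr0.
Qed.

(** A Lie derivative is not function-linear in its vector: L_(ca) = c L_a + dc ^ i_a. *)
Lemma lie_P w c a b s : mlin w -> alt w ->
  lie (nabla (c *: a + b)) (br (c *: a + b)) w s =
  c *: lie (nabla a) (br a) w s + lie (nabla b) (br b) w s +
  wedge_fun (dfun c) (con a w) s.
Proof.
elim: s w => [|x s IH] w wl wa.
  by rewrite /= scale0r addr0 (fr_P FR).
rewrite !lie_cons IH; [|exact: mlin_con|exact: alt_con].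
rewrite wedge_dfun_cons (lr_Pbr LR) -scaleNr (@mlinD _ _ _ w [::]) //.
rewrite (@mlinD _ _ _ w [::]) // !cat0s.
have Z k y : w (k *: y :: s) = k *: w (y :: s).
  have := wl [::] s k y 0; rewrite addr0 !cat0s => ->.
  by rewrite (@mlin0 _ _ _ w [::]) // addr0.
rewrite !Z scaleNr (@eq_wedge _ _ _ (dfun c) (dfun c) (con x (con a w))
  (fun t => - con a (con x w) t)) //; last by move=> t; exact: con_swap.
by rewrite wedge_funNr scalerBr; rewrite /con; zmod.
Qed.

(** The defect dc ^ i_a w from [lie_P] cancels against the Leibniz term of d(c i_a w). *)
Lemma kz_mlin w : mlin w -> alt w -> mlin (kz nabla w).
Proof.
move=> wl wa s; elim: s w wl wa => [|x s IH] w wl wa t c a b.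
  rewrite !cat0s !kz_cons lie_P // (@eq_kz _ _ (con (c *: a + b) w) (fun t =>
    wedge_fun (fun u => if u is [::] then c : S^o else 0) (con a w) t + con b w t)); last first.
    by move=> u; rewrite wedge_const; exact: (wl [::]).
  rewrite (kzD FR) kz_wedge (@eq_wedge _ _ _ (kz _ _) (dfun c) _ (con a w)) //; last first.
    by move=> u; rewrite kz_const.
  rewrite (@eq_wedge _ _ _ (eps _) (fun u => if u is [::] then c : S^o else 0) _ (kz nabla (con a w))) //.
    by rewrite wedge_const scalerBr; zmod.
  by move=> [|y u]; rewrite /eps /= ?scaler0 // scale1r.
rewrite !cat_cons !kz_cons IH; [|exact: mlin_con|exact: alt_con].
rewrite (@lie_mlin _ _ _ _ _ (rho x) (fr_D FR x) (fr_Z FR x) (@brP x)) //.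
by rewrite scalerBr; zmod.
Qed.

Lemma kz_alt w : mlin w -> alt w -> alt (kz nabla w).
Proof.
move=> wl wa s; elim: s w wl wa => [|x s IH] w wl wa t a.
  rewrite cat0s !kz_cons (@eq_kz _ _ (con a (con a w)) (fun=> 0)); last first.
    by move=> u; exact: (wa [::]).
  rewrite (kz0 FR) lie_cons (lr_brxx LR) (@mlin0 _ _ _ w [::]) //; zmod.
rewrite cat_cons kz_cons IH ?subr0; [|exact: mlin_con|exact: alt_con].
by apply: lie_alt => //; exact: fr_D FR x.
Qed.

End Leibniz.
End LieRinehart.

(** * Operations on forms *)

Section FormOperations.
Context {S : comPzRingType}.

Section Basic.
Context {V W : lmodType S}.
Implicit Types (w : form V W) (f : form V S^o).

Lemma formDE w w' s : (w + w') s = w s + w' s. Proof. by []. Qed.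
Lemma formNE w s : (- w) s = - w s. Proof. by []. Qed.
Lemma form_sumE I (r : seq I) (P : pred I) (F : I -> form V W) s :
  (\sum_(i <- r | P i) F i) s = \sum_(i <- r | P i) F i s.
Proof. by elim/big_rec2: _ => // i x y _ <-. Qed.

Lemma mkformE (F : seq V -> W) s : is_form F -> mkform F s = F s.
Proof.
move=> fF; 
have [w wP] : exists w : form V W, forall s, w s = F s by exists (Form fF).
have P := @xgetPex (form V W) 0 [set w : form V W | forall s, w s = F s] (ex_intro _ w wP).
exact: P.
Qed.

Lemma form_mlin w : mlin w. Proof. exact: is_form_mlin (formP w). Qed.
Lemma form_alt w : alt w. Proof. exact: is_form_alt (formP w). Qed.

Lemma is_form_eps w : is_form (eps w).
Proof.
have [wl wa] := formP w; split=> [s t c a b|s t u a]; last by rewrite /eps wa scaler0.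
by rewrite /eps wl !size_cat /= scalerDr !scalerA mulrC.
Qed.

Definition feps w : form V W := Form (is_form_eps w).
Definition fepsb (b : bool) w : form V W := if b then feps w else w.

(** Signs indexed by a parity bit: sign bookkeeping becomes a case analysis followed by [zmod]. *)
Definition signed {U : zmodType} (b : bool) (x : U) : U := if b then - x else x.

Lemma fepsE w s : feps w s = eps w s. Proof. by []. Qed.
Lemma fepsbE b w s : fepsb b w s = epsb b w s. Proof. by case: b. Qed.
Lemma signedE b w s : signed b w s = signed b (w s). Proof. by case: b. Qed.

Lemma fepsD w w' : feps (w + w') = feps w + feps w'.
Proof. by apply: form_ext => s; rewrite formDE !fepsE -epsD. Qed.

Lemma fepsN w : feps (- w) = - feps w.
Proof. by apply: form_ext => s; rewrite formNE !fepsE -epsN. Qed.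

Lemma fepsK : involutive feps.
Proof. by move=> w; apply: form_ext => s; have := congr1 (fun F => F s) (epsK w). Qed.

Lemma fepsb_hom b n w : homog n%:Z w -> fepsb b w = signed (b && odd n) w.
Proof.
move=> hw; apply: form_ext => s; rewrite fepsbE signedE (epsb_homog _ hw).
by case: (b && _); rewrite ?scaleN1r ?scale1r.
Qed.

End Basic.

Section WedgeForm.
Context {V W : lmodType S}.
Implicit Types (w : form V W) (f : form V S^o).

Lemma wedgeDl f f' w : wedge (f + f') w = wedge f w + wedge f' w.
Proof. by apply: form_ext => s; exact: wedge_funDl. Qed.

Lemma wedgeDr f w w' : wedge f (w + w') = wedge f w + wedge f w'.
Proof. by apply: form_ext => s; exact: wedge_funDr. Qed.

Lemma wedgeNl f w : wedge (- f) w = - wedge f w.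
Proof. by apply: form_ext => s; exact: wedge_funNl. Qed.

Lemma wedgeNr f w : wedge f (- w) = - wedge f w.
Proof. by apply: form_ext => s; exact: wedge_funNr. Qed.

Lemma wedge0l w : wedge 0 w = 0.
Proof. by apply: form_ext => s; exact: wedge_fun0l. Qed.

Lemma wedge0r f : wedge f (0 : form V W) = 0.
Proof. by apply: form_ext => s; exact: wedge_fun0r. Qed.

Lemma wedge_signedl b f w : wedge (signed b f) w = signed b (wedge f w).
Proof. by case: b => //=; rewrite wedgeNl. Qed.

Lemma wedge_signedr b f w : wedge f (signed b w) = signed b (wedge f w).
Proof. by case: b => //=; rewrite wedgeNr. Qed.

Lemma feps_wedge f w : wedge (feps f) (feps w) = feps (wedge f w).
Proof. by apply: form_ext => s; exact: eps_wedge. Qed.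

Lemma wedge_form0 (c : S) w s : wedge (form0 (c : S^o)) w s = c *: w s.
Proof. exact: wedge_const. Qed.

Lemma wedge1 w : wedge (form0 (1 : S^o)) w = w.
Proof. by apply: form_ext => s; rewrite wedge_form0 scale1r. Qed.

Lemma homogD d w w' : homog d w -> homog d w' -> homog d (w + w').
Proof. by move=> h h' s sd; rewrite formDE h ?h' ?addr0. Qed.

Lemma homogN d w : homog d w -> homog d (- w).
Proof. by move=> h s sd; rewrite formNE h ?oppr0. Qed.

Lemma homog0 d : homog d (0 : form V W).
Proof. by []. Qed.

Lemma homog_signed d b w : homog d w -> homog d (signed b w).
Proof. by case: b => //; exact: homogN. Qed.

Lemma homog_feps d w : homog d w -> homog d (feps w).
Proof. by move=> h s sd; rewrite fepsE /eps h ?scaler0. Qed.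

Lemma homog_form0 (v : W) : homog 0 (form0 v : form V W).
Proof. by move=> [|a s]. Qed.

Lemma homog_form1 (h : {linear V -> W}) : homog 1 (form1 h : form V W).
Proof. by move=> [|a [|b s]]. Qed.

Lemma homog_wedge d k f w : homog d f -> homog k w -> homog (d + k) (wedge f w).
Proof. exact: wedge_homog. Qed.

(** Degrees are integers, because [H0] lowers them; this disposes of the negative ones. *)
Lemma homog_neg d w : homog d w -> (d < 0)%R -> w = 0.
Proof.
move=> hw d0; apply: form_ext => s; rewrite hw // => E.
by move: d0; rewrite -E ltNge.
Qed.

Lemma homog0P w : homog 0 w -> w = form0 (w [::]).
Proof.
by move=> hw; apply: form_ext => -[|a s] //; rewrite hw.
Qed.

Lemma fepsb_form0 b (v : W) : fepsb b (form0 v : form V W) = form0 v.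
Proof.
case: b => //=; apply: form_ext => -[|a t]; rewrite fepsE /eps /= ?scaler0 //.
by rewrite scale1r.
Qed.

Lemma homog1_ext w w' : homog 1 w -> homog 1 w' ->
  (forall a, w [:: a] = w' [:: a]) -> w = w'.
Proof.
move=> hw hw' E; apply: form_ext => -[|a [|b s]]; first by rewrite hw ?hw'.
  exact: E.
by rewrite hw ?hw'.
Qed.

End WedgeForm.

Lemma wedgeA {V W : lmodType S} (f g : form V S^o) (w : form V W) :
  wedge (wedge f g) w = wedge f (wedge g w).
Proof. by apply: form_ext => s; exact: wedge_assoc. Qed.

Lemma wedgeC {V : lmodType S} (f g : form V S^o) n : homog n%:Z f ->
  wedge f g = wedge (fepsb (odd n) g) f.
Proof.
move=> hf; apply: form_ext => s; rewrite /= (wedge_comm _ _ hf).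
by apply: eq_wedge => // t; rewrite fepsbE.
Qed.

Section Pull.
Context {V V' W : lmodType S} (phi : {linear V -> V'}).

Lemma is_form_pull (w : form V' W) : is_form (fun s => w (map phi s)).
Proof.
case: (formP w) => l z; split=> [s t c a b|s t u a].
  by rewrite !map_cat /= linearP l.
by rewrite map_cat /= map_cat /= z.
Qed.

Definition fpull w : form V W := Form (is_form_pull w).

Lemma fpullE w s : fpull w s = w (map phi s). Proof. by []. Qed.

Lemma fpullD w w' : fpull (w + w') = fpull w + fpull w'.
Proof. exact: form_ext. Qed.

Lemma fpull_feps w : fpull (feps w) = feps (fpull w).
Proof. by apply: form_ext => s; rewrite fpullE !fepsE /eps size_map. Qed.

Lemma fpull_homog d w : homog d w -> homog d (fpull w).
Proof. by move=> h s sd; rewrite fpullE h ?size_map. Qed.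

Lemma fpull_form0 (v : W) : fpull (form0 v) = form0 v.
Proof. by apply: form_ext => -[|a s]. Qed.

End Pull.

Lemma wedge_fun_map {V V' W : lmodType S} (phi : V -> V') (f : seq V' -> S^o)
    (w : seq V' -> W) s :
  wedge_fun (fun t => f (map phi t)) (fun t => w (map phi t)) s =
  wedge_fun f w (map phi s).
Proof.
elim: s f w => [|a s IH] f w //=; rewrite -(IH (con (phi a) f)).
rewrite -(IH _ (con (phi a) w)); congr (_ + _); apply: eq_wedge => // t.
by rewrite size_map.
Qed.

Lemma fpull_wedge {V V' W : lmodType S} (phi : {linear V -> V'})
    (f : form V' S^o) (w : form V' W) :
  fpull phi (wedge f w) = wedge (fpull phi f) (fpull phi w).
Proof. by apply: form_ext => s; rewrite fpullE /= -wedge_fun_map. Qed.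

Lemma lie_map {V V' W : lmodType S} (phi : V -> V') delta tau tau'
    (w : seq V' -> W) s : (forall a, phi (tau a) = tau' (phi a)) ->
  lie delta tau (fun t => w (map phi t)) s = lie delta tau' w (map phi s).
Proof.
move=> E; elim: s w => [|a s IH] w //=.
by rewrite -E -(IH (con (phi a) w)).
Qed.

(** Pullback along a bracket-preserving map commutes with the differential, since it intertwines
    contractions and Lie derivatives. *)
Lemma kz_map {V V' W : lmodType S} (phi : V -> V') br br' nabla nabla'
    (w : seq V' -> W) s :
  (forall a b, phi (br a b) = br' (phi a) (phi b)) ->
  (forall a x, nabla a x = nabla' (phi a) x) ->
  kz br nabla (fun t => w (map phi t)) s = kz br' nabla' w (map phi s).
Proof.
move=> E N; elim: s w => [|a s IH] w //=; rewrite -(IH (con (phi a) w)).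
congr (_ - _); rewrite -(lie_map _ _ _ (E a)).
by have -> : nabla a = nabla' (phi a) by apply/funext => x.
Qed.

Section FormPwedge.
Context {V W W' : lmodType S} (D : W -> form V W').
Hypothesis Dl : Dlin (fun v => form_val (D v)).

Lemma pwedge_mlin (E : W -> seq V -> W') (nu : seq V -> W) : Dlin E ->
  (forall v, mlin (E v)) -> mlin nu -> mlin (pwedge E nu).
Proof.
move=> El hE hn s; elim: s E nu El hE hn => [|x s IH] E nu El hE hn t c a b.
  rewrite !cat0s !pwedge_cons.
  rewrite (@eq_pwedge _ _ _ _ E E (con (c *: a + b) nu) (fun t => c *: con a nu t + con b nu t)) //;
    last by move=> u; exact: (hn [::]).
  rewrite (@eq_pwedge _ _ _ _ (fun v => con (c *: a + b) (E v))
    (fun v t => c *: con a (E v) t + con b (E v) t) (eps nu) (eps nu)) //;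
    last by move=> v u; exact: (hE v [::]).
  by rewrite pwedgeP // pwedge_Dlin scalerDr addrACA.
rewrite !cat_cons !pwedge_cons IH //; last exact: mlin_con.
rewrite (IH (fun v => con x (E v))) //.
- by rewrite scalerDr addrACA.
- exact: Dlin_con.
- by move=> v; exact: mlin_con.
- by move=> u v k y z; rewrite /eps hn !size_cat /= scalerDr !scalerA mulrC.
Qed.

Lemma pwedge_alt (E : W -> seq V -> W') (nu : seq V -> W) : Dlin E ->
  (forall v, alt (E v)) -> alt nu -> alt (pwedge E nu).
Proof.
move=> El hE hn s; elim: s E nu El hE hn => [|x s IH] E nu El hE hn t a.
  rewrite !cat0s !pwedge_cons.
  rewrite (@eq_pwedge _ _ _ _ E E (con a (con a nu)) (fun=> 0)) //;
    last by move=> u; exact: (hn [::]).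
  rewrite pwedge0 // (@eq_pwedge _ _ _ _ (fun v => con a (con a (E v)))
    (fun _ _ => 0) (eps (eps nu)) nu); last 2 first.
  - by move=> v u; exact: (hE v [::]).
  - by move=> u; rewrite epsK.
  rewrite pwedge_D0 (@eq_pwedge _ _ _ _ (fun v => con a (E v)) (fun v => con a (E v))
    (con a (eps nu)) (fun u => - eps (con a nu) u)) //;
    last by move=> u; rewrite eps_con.
  rewrite pwedgeN; last exact: Dlin_con.
  by zmod.
rewrite cat_cons pwedge_cons IH //; last exact: alt_con.
rewrite (IH (fun v => con x (E v))) ?addr0 //.
- exact: Dlin_con.
- by move=> v; exact: alt_con.
- by move=> u v y; rewrite /eps hn scaler0.
Qed.

Lemma is_form_pwedge (nu : form V W) : is_form (pwedge D nu).
Proof.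
apply: mlin_alt_is_form.
  by apply: pwedge_mlin => // [v|]; exact: form_mlin.
by apply: pwedge_alt => // [v|]; exact: form_alt.
Qed.

(** The proof [Dl] of linearity stays an explicit argument after the section, since multilinearity
    of the result rests on it. *)
Definition fpwedge nu : form V W' := Form (is_form_pwedge nu).

Lemma fpwedgeD nu nu' : fpwedge (nu + nu') = fpwedge nu + fpwedge nu'.
Proof. by apply: form_ext => s; exact: pwedgeD. Qed.

Lemma fpwedge_wedge f nu : fpwedge (wedge f nu) = wedge f (fpwedge nu).
Proof. by apply: form_ext => s; exact: pwedge_wedge. Qed.

Lemma fpwedge_tens xi v : fpwedge (tens xi v) = wedge xi (D v).
Proof. by apply: form_ext => s; exact: pwedge_tens. Qed.

Lemma fpwedge_homog d k nu : homog d nu -> (forall v, homog k (D v)) ->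
  homog (d + k) (fpwedge nu).
Proof. exact: pwedge_homog. Qed.

Lemma fpwedge_sum I (r : seq I) (P : pred I) (F : I -> form V W) :
  fpwedge (\sum_(i <- r | P i) F i) = \sum_(i <- r | P i) fpwedge (F i).
Proof.
elim/big_rec2: _ => [|i x y _ <-]; last by rewrite fpwedgeD.
by apply: form_ext => s; exact: pwedge0.
Qed.

End FormPwedge.
End FormOperations.

(** * Smooth cutoff functions *)

Section SmoothStep.
Context {R : realType}.

(** The functions t^(-n) e^(-1/t), extended by 0: their span is stable under differentiation, which
    makes the flat function [gexp 0] smooth by induction on the order. *)
Definition gexp (n : nat) (t : R) : R :=
  if 0 < t then t^-1 ^+ n * expR (- t^-1) else 0.

Lemma gexp_ge0 n t : 0 <= gexp n t.
Proof.
rewrite /gexp; case: ifP => // t0.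
by rewrite mulr_ge0 ?expR_ge0 // exprn_ge0 // invr_ge0 ltW.
Qed.

Lemma gexp_gt0 n t : 0 < t -> 0 < gexp n t.
Proof. by move=> t0; rewrite /gexp t0 mulr_gt0 ?expR_gt0 // exprn_gt0 // invr_gt0. Qed.

(** From e^x >= x^(n+2)/(n+2)! at x = 1/t. The exponent n + 2 leaves a factor t^2, so that the
    difference quotient at 0 still tends to 0. *)
Lemma gexp_le n t : gexp n t <= n.+2`!%:R * t ^+ 2.
Proof.
rewrite /gexp; case: ifP => t0; last by rewrite mulr_ge0 ?sqr_ge0.
have ti0 : 0 <= t^-1 by rewrite invr_ge0 ltW.
have E : t^-1 ^+ n.+2 / n.+2`!%:R <= expR t^-1.
  by apply: le_trans (expR_ge1Dxn n.+1 ti0); rewrite lerDr.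
have F0 : 0 < n.+2`!%:R :> R by rewrite ltr0n fact_gt0.
rewrite expRN ler_pdivrMr ?expR_gt0 //.
have -> : t^-1 ^+ n = n.+2`!%:R * t ^+ 2 * (t^-1 ^+ n.+2 / n.+2`!%:R).
  have tn : t != 0 by rewrite gt_eqF.
  rewrite !exprS; field.
  by rewrite tn gt_eqF.
by rewrite ler_wpM2l // mulr_ge0 ?sqr_ge0 // ltW.
Qed.

Lemma is_derive_gexp n (t : R) :
  is_derive t 1 (gexp n) (- n%:R * gexp n.+1 t + gexp n.+2 t).
Proof.
have [t0|t0|<-] := ltgtP 0 t.
- have tn : t != 0 by rewrite gt_eqF.
  apply: (@near_eq_is_derive _ _ _ (fun x : R => x^-1 ^+ n * expR (- x^-1))).
    near=> x; rewrite /gexp ifT //; near: x.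
    exact: lt_nbhsr.
  have V : is_derive t (1:R) (fun x : R => x^-1) (- t^-1 ^+ 2).
    have := @is_deriveV R id t 1 1 tn (is_derive_id _ _).
    by rewrite -[_ *: _]/(_ * _) mulr1 exprVn.
  have VN : is_derive t (1:R) (fun x : R => - x^-1) (t^-1 ^+ 2).
    by have := @is_deriveN _ _ _ _ _ _ _ V; rewrite opprK.
  have Dn : is_derive t (1:R) ((fun x : R => x^-1) ^+ n) (- n%:R * t^-1 ^+ n.+1).
    apply: is_derive_eq; rewrite -![_ *: _]/(_ * _).
    by case: n => [|k] /=; rewrite ?exprS; ring.
  have De := @is_derive1_comp R expR (fun x : R => - x^-1) t _ _ (is_derive_expR _) VN.
  rewrite (_ : (fun x => _) = (fun x : R => x^-1) ^+ n * (expR \o (fun x : R => - x^-1))).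
    apply: is_derive_eq; rewrite /gexp t0 -![_ *: _]/(_ * _) exprfctE /= !exprS; ring.
  by rewrite exprfctE; apply/funext.
- apply: (@near_eq_is_derive _ _ _ (cst 0)).
    near=> x; rewrite /gexp ifF //; apply/negbTE; rewrite -leNgt ltW //; near: x.
    exact: lt_nbhsl.
  rewrite /gexp !ifF ?(lt_gtF t0) // mulr0 addr0; exact: is_derive_cst.
- rewrite /gexp !ltxx mulr0 addr0.
  (* At the origin the difference quotient is at most (n+2)! |h| in absolute value, by [gexp_le]. *)
  have C : (fun h : R => h^-1 *: ((gexp n \o shift 0) (h *: 1) - gexp n 0)) @ 0^' --> (0 : R).
    apply/cvgr0Pnorm_lt => e e0.
    near=> h; rewrite /= addr0 -![_ *: _]/(_ * _) mulr1 [gexp n 0]/gexp ltxx subr0.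
    have h0 : h != 0 by near: h; exact: nbhs_dnbhs_neq.
    rewrite normrM normfV (ger0_norm (gexp_ge0 _ _)) mulrC ltr_pdivrMr ?normr_gt0 //.
    apply: le_lt_trans (gexp_le _ _) _.
    rewrite -real_normK ?num_real // expr2 mulrA.
    rewrite ltr_pM2r ?normr_gt0 // -ltr_pdivlMl ?ltr0n ?fact_gt0 //; near: h.
    by apply: dnbhs0_lt; rewrite mulr_gt0 // invr_gt0 ltr0n fact_gt0.
  by split; [apply/cvg_ex; exists 0|exact: cvg_lim].
Unshelve. all: by end_near. Qed.

End SmoothStep.

Section CkComposition.
Context {R : realType} {n : nat}.
Implicit Types (U : set 'rV[R]_n) (phi : 'rV[R]_n -> R).

Lemma derive_comp1 (f : R -> R) phi l x v : differentiable phi x ->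
  is_derive (phi x) 1 f l ->
  differentiable (f \o phi) x /\ 'D_v (f \o phi) x = l * 'D_v phi x.
Proof.
move=> dphi [df fl]; have dff : differentiable f (phi x) by apply/derivable1_diffP.
split; first exact: differentiable_comp.
rewrite deriveE; last exact: differentiable_comp.
rewrite diff_comp //= diff1E // derive1E fl deriveE // mulrC.
by [].
Qed.

Lemma Ck_gexp k U phi i : open U -> Ck k U phi -> Ck k U (gexp i \o phi).
Proof.
move=> oU; elim: k phi i => [|k IH] phi i.
  move=> cphi x Ux; apply: continuous_comp; first exact: cphi.
  apply/differentiable_continuous/derivable1_diffP.
  by have [] := is_derive_gexp i (phi x).
move=> phik; have [dphi Dphi] := phik.
have H x v (Ux : U x) := derive_comp1 v (dphi x Ux) (is_derive_gexp i (phi x)).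
split=> [x Ux|v]; first by have [] := H x 0 Ux.
have phik' := Ck_pred phik.
apply: (Ck_ext oU _ (CkM oU (CkD oU (CkM oU (Ck_cst k U (- i%:R)) (IH phi i.+1 phik'))
   (IH phi i.+2 phik')) (Dphi v))) => x Ux.
by have [_ ->] := H x v Ux.
Qed.

Lemma Ck_inv k U phi : open U -> (forall x, U x -> phi x != 0) ->
  Ck k U phi -> Ck k U (fun x => (phi x)^-1).
Proof.
move=> oU; elim: k phi => [|k IH] phi phi0.
  by move=> cphi x Ux; apply: continuousV; [exact: phi0|exact: cphi].
move=> phik; have [dphi Dphi] := phik.
have H x v (Ux : U x) := derive_comp1 v (dphi x Ux)
  (@is_deriveV R id (phi x) 1 1 (phi0 x Ux) (is_derive_id _ _)).
split=> [x Ux|v]; first by have [] := H x 0 Ux.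
have phik' := IH _ phi0 (Ck_pred phik).
apply: (Ck_ext oU _ (CkM oU (CkM oU (Ck_cst k U (-1)) (CkM oU phik' phik')) (Dphi v))) => x Ux.
have [_ E] := H x v Ux; rewrite [RHS]E -[_ *: _]/(_ * _) mulr1 mulN1r.
by rewrite -invfM.
Qed.

Lemma CkN k U f : open U -> Ck k U f -> Ck k U (fun x => - f x).
Proof.
move=> oU fk; apply: (Ck_ext oU _ (CkM oU (Ck_cst k U (-1)) fk)) => x _.
by rewrite mulN1r.
Qed.

Lemma Ck_sum k U I (r : seq I) (F : I -> 'rV[R]_n -> R) : open U ->
  (forall i, Ck k U (F i)) -> Ck k U (fun x => \sum_(i <- r) F i x).
Proof.
move=> oU Fk; elim: r => [|i r IH].
  rewrite (_ : (fun x => _) = fun=> 0); first exact: Ck_cst.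
  by apply/funext => x; rewrite big_nil.
rewrite (_ : (fun x => _) = fun x => F i x + \sum_(i <- r) F i x); first exact: CkD.
by apply/funext => x; rewrite big_cons.
Qed.

(** [Ck] constrains ambient derivatives at each point of the set, so it can be checked one point at
    a time. *)
Lemma Ck_local k U f : (forall x, U x -> exists V, V x /\ Ck k V f) -> Ck k U f.
Proof.
elim: k f => [|k IH] f H; first by move=> x /H [V [Vx]]; exact.
split=> [x /H [V [Vx [df _]]]|v]; first exact: df.
by apply: IH => x /H [V [Vx [_ Df]]]; exists V; split; last exact: Df.
Qed.

(** A smooth transition from 1 on t <= 1 to 0 on t >= 2; the denominator is positive because 2 - t
    and t - 1 are never both nonpositive. *)
Definition smooth_step (t : R) : R :=
  gexp 0 (2 - t) / (gexp 0 (2 - t) + gexp 0 (t - 1)).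

Lemma smooth_step_den t : gexp 0 (2 - t) + gexp 0 (t - 1) != 0 :> R.
Proof.
have [t1|t1] := ltP 1 t.
  by rewrite gt_eqF // ltr_wpDl ?gexp_ge0 ?gexp_gt0 ?subr_gt0.
by rewrite gt_eqF // ltr_pwDl ?gexp_ge0 ?gexp_gt0 //; lra.
Qed.

Lemma smooth_step1 t : t <= 1 -> smooth_step t = 1.
Proof.
move=> t1; have := smooth_step_den t; rewrite /smooth_step [gexp 0 (t - 1)]/gexp ifF.
  by rewrite addr0 => ?; rewrite divff.
by apply/negbTE; rewrite -leNgt subr_le0.
Qed.

Lemma smooth_step0 t : 2 <= t -> smooth_step t = 0.
Proof.
move=> t2; rewrite /smooth_step [gexp 0 (2 - t)]/gexp ifF ?mul0r //.
by apply/negbTE; rewrite -leNgt subr_le0.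
Qed.

Lemma Ck_smooth_step k U phi : open U -> Ck k U phi -> Ck k U (smooth_step \o phi).
Proof.
move=> oU pk.
have A : Ck k U (gexp 0 \o (fun x => 2 - phi x)).
  by apply: Ck_gexp => //; apply: CkD => //; [exact: Ck_cst|exact: CkN].
have B : Ck k U (gexp 0 \o (fun x => phi x - 1)).
  by apply: Ck_gexp => //; apply: CkD => //; exact: Ck_cst.
apply: CkM => //; apply: Ck_inv => //; last exact: CkD.
by move=> x _; exact: smooth_step_den.
Qed.

End CkComposition.

(** * Bump functions on a manifold *)

Section SmoothLocal.
Context {R : realType} {M : manifold R}.
Implicit Types (U N : set M) (m : M).

Lemma rsmooth_local U (f : M -> R) : open U ->
  (forall m, U m -> exists N h, [/\ open N, N m, rsmooth_on (U `&` N) h &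
     forall m', U m' -> N m' -> f m' = h m']) -> rsmooth_on U f.
Proof.
move=> oU H c ac k; apply: Ck_local => x [m [dm Um] <-].
have [ N [h [oO Nm sh fh]]] := H m Um.
exists (cmap c @` (cdom c `&` (U `&` N))); split; first by exists m.
apply: (Ck_ext _ _ (sh c ac k)); first by apply: chart_img_open; exact: openI.
move=> _ [m' [dm' [Um' Nm']] <-] /=.
by rewrite cmapK ?inE // fh.
Qed.

Lemma ksmooth_local g U (f : M -> scalars R g) : open U ->
  (forall m, U m -> exists N h, [/\ open N, N m, @ksmooth_on _ _ g (U `&` N) h &
     forall m', U m' -> N m' -> f m' = h m']) -> ksmooth_on U f.
Proof.
case: g f => f oU H /=; first exact: rsmooth_local.
split; apply: rsmooth_local => // m /H [ N [h [oO Nm [sr si] fh]]].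
  by exists N, (fun m => complex.Re (h m)); split=> // m' Um' Nm'; rewrite fh.
by exists N, (fun m => complex.Im (h m)); split=> // m' Um' Nm'; rewrite fh.
Qed.

Lemma rsmooth_cmap (c : chart R (mdim M) M) i : atlas c ->
  rsmooth_on (cdom c) (fun m => cmap c m 0 i).
Proof. by move=> ac c' ac' k; exact: atlas_smooth. Qed.

(** The norm of row vectors is the sup norm, which is not smooth; the squared Euclidean distance is
    polynomial in the coordinates. *)
Definition sqdist (c : chart R (mdim M) M) (x : 'rV[R]_(mdim M)) m : R :=
  \sum_(i < mdim M) (cmap c m 0 i - x 0 i) ^+ 2.

Lemma rsmooth_sqdist c x (a : R) : atlas c ->
  rsmooth_on (cdom c) (fun m => a * sqdist c x m).
Proof.
move=> ac c' ac' k.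
have oI := chart_img_open (c := c') (cdom_open c).
apply: CkM => //; first exact: Ck_cst.
apply: Ck_sum => // i.
have C : Ck k (cmap c' @` (cdom c' `&` cdom c))
    (fun y => cmap c (cinv c' y) 0 i - x 0 i).
  by apply: CkD => //; [exact: rsmooth_cmap|exact: Ck_cst].
exact: CkM.
Qed.

Lemma ball_rVP n (x y : 'rV[R]_n) (e : R) : 0 < e ->
  (forall i, `|x 0 i - y 0 i| < e) -> ball x e y.
Proof. by move=> e0 H; split=> // i j; rewrite ord1; exact: H. Qed.

Lemma smooth_bump m0 U : open U -> U m0 -> exists (h : M -> R) (C : set M),
  [/\ rsmooth_on setT h, \forall m \near m0, h m = 1, closed C, C `<=` U &
      forall m, ~ C m -> h m = 0].
Proof.
move=> oU Um0; have [c ac dm0] := atlas_cover m0.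
pose x0 := cmap c m0.
have oI := chart_img_open (c := c) oU.
have : nbhs x0 (cmap c @` (cdom c `&` U)).
  by apply: open_nbhs_nbhs; split=> //; exists m0.
move=> /nbhs_ballP [e /= e0 ballU].
pose r := e / 2; have r0 : 0 < r by rewrite divr_gt0.
(* A compact cube of half-width r = e / 2, hence inside the ball of radius e. *)
pose K := [set x : 'rV[R]_(mdim M) | forall i, x 0 i \in `[x0 0 i - r, x0 0 i + r]].
have Kc : compact K.
  exact: (@rV_compact R _ (fun i => [set` `[x0 0 i - r, x0 0 i + r]])
    (fun i => @segment_compact R _ _)).
have KU : K `<=` cmap c @` (cdom c `&` U).
  move=> x Kx; apply: ballU; apply: ball_rVP => // i.
  move: (Kx i); rewrite /= in_itv /= => /andP[k1 k2].
  have rr : e = r + r by rewrite /r -splitr.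
  by rewrite ltr_norml; apply/andP; split; lra.
pose C := cinv c @` K.
(* Hausdorffness is used here: the compact image of the cube must be closed in [M] for the extension
   by 0 to be smooth. *)
have Cc : closed C.
  apply: compact_closed; first exact: m_hausdorff.
  apply: continuous_compact => //; apply: continuous_in_subspaceT => x /set_mem Kx.
  by apply: cinv_cts; have [m [dm _] <-] := KU x Kx; exists m.
have CU : C `<=` U.
  by move=> _ [x Kx <-]; have [m [dm Um] <-] := KU x Kx; rewrite cmapK ?inE.
(* Scaled so that q < 2 means Euclidean distance below r, which forces the point into the cube. *)
pose q m := 2 / r ^+ 2 * sqdist c x0 m.
pose h m := if m \in cdom c then smooth_step (q m) else 0.
have r20 : 0 < r ^+ 2 by rewrite exprn_gt0.
have hC m : ~ C m -> h m = 0.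
  move=> nC; rewrite /h; case: ifP => // /set_mem dm.
  apply: smooth_step0; rewrite leNgt; apply/negP => qm; apply: nC.
  exists (cmap c m); last by rewrite cmapK ?inE.
  move=> i; rewrite /= in_itv /= -ler_distl -ler_sqr ?nnegrE ?normr_ge0 ?(ltW r0) //.
  rewrite real_normK ?num_real // ltW //.
  apply: (@le_lt_trans _ _ (sqdist c x0 m)).
    rewrite /sqdist (bigD1 i) //= lerDl sumr_ge0 // => j _; exact: sqr_ge0.
  by move: qm; rewrite /q mulrAC ltr_pdivrMr // ltr_pM2l.
have sq : rsmooth_on (cdom c) q by exact: rsmooth_sqdist.
exists h, C; split=> //.
- apply: rsmooth_local => [|m _]; first exact: openT.
  have [dm|dm] := boolP (m \in cdom c).
    exists (cdom c), (smooth_step \o q); split; first exact: cdom_open.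
    + exact: set_mem.
    + rewrite setTI => c' ac' k.
      have := Ck_smooth_step (chart_img_open (c := c') (cdom_open c)) (sq c' ac' k).
      by [].
    + by move=> m' _ /mem_set dm'; rewrite /h dm'.
  exists (~` C), (fun=> 0); split.
  + exact: closed_openC.
  + move=> [x Kx E]; move: dm; rewrite -E.
    have [m' [dm' _] E'] := KU x Kx.
    by rewrite -E' cmapK ?inE // => /negP; apply; rewrite inE.
  + exact: rsmooth_on_cst.
  + by move=> m' _ /hC.
- have near_d : \forall m \near m0, cdom c m.
    by apply: open_nbhs_nbhs; split=> //; exact: cdom_open.
  (* The successor avoids dividing by 0 in dimension 0. *)
  pose n := (mdim M).+1.
  (* With coordinate differences below 1, each square is at most the absolute value, hence at most
     r^2 / (2n), and no square root is needed; the sum is then at most r^2 / 2, that is q <= 1. *)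
  have s0 : 0 < Num.min (r ^+ 2 / (2 * n%:R)) 1 by rewrite lt_min ltr01 andbT divr_gt0 // mulr_gt0 // ltr0n.
  have : \forall m \near m0, ball x0 (Num.min (r ^+ 2 / (2 * n%:R)) 1) (cmap c m).
    by apply: (cmap_cts dm0); exact: nbhsx_ballx.
  apply: filterS2 near_d => m dm [_ B].
  rewrite /h mem_set //; apply: smooth_step1.
  rewrite /q mulrAC ler_pdivrMr // mul1r.
  have : sqdist c x0 m <= \sum_(i < mdim M) (r ^+ 2 / (2 * n%:R)).
    apply: ler_sum => i _; have := B 0 i; rewrite -ball_normE /= lt_min => /andP[b1 b2].
    rewrite -(@real_normK _ (cmap c m 0 i - x0 0 i)) ?num_real // distrC expr2.
    apply: le_trans (ltW b1); rewrite ler_piMr // ltW //.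
  rewrite sumr_const card_ord => le1.
  have : sqdist c x0 m <= r ^+ 2 / 2.
    apply: le_trans le1 _.
    have -> : (r ^+ 2 / (2 * n%:R)) *+ mdim M = r ^+ 2 / 2 * ((mdim M)%:R / n%:R).
      by rewrite -mulr_natr invfM mulrA -!mulrA (mulrC n%:R^-1).
    rewrite ler_piMr //; first by rewrite divr_ge0 // ltW.
    by rewrite ler_pdivrMr ?ltr0n // mul1r ler_nat.
  by rewrite ler_pdivlMr // mulrC.
Qed.

End SmoothLocal.

(** * Local frames and gluing of sections *)

Section Frames.
Context {R : realType} {M : manifold R} {g : ground}.
Local Notation K := (scalars R g).
Local Notation Cinf := (smoothfun M g).
Implicit Types (f h : Cinf) (m : M) (U : set M).

Lemma sf_ext f h : (forall m, f m = h m) -> f = h.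
Proof. by move=> fh; apply: val_inj; apply/funext. Qed.

Lemma sfM f h m : (f * h) m = f m * h m. Proof. by []. Qed.
Lemma sfD f h m : (f + h) m = f m + h m. Proof. by []. Qed.
Lemma sfN f m : (- f) m = - f m. Proof. by []. Qed.
Lemma sf_sum I (r : seq I) (P : pred I) (F : I -> Cinf) m :
  (\sum_(i <- r | P i) F i) m = \sum_(i <- r | P i) F i m.
Proof. by elim/big_rec2: _ => // i x y _ <-. Qed.

Lemma vsection_sum (E : vbundle M g) I (r : seq I) (P : pred I) (F : I -> vsection E) m :
  (\sum_(i <- r | P i) F i) m = \sum_(i <- r | P i) F i m.
Proof. by elim/big_rec2: _ => // i x y _ <-; rewrite vsectionDE. Qed.

Lemma near_open m (P : M -> Prop) : (\forall m' \near m, P m') ->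
  exists N : set M, [/\ open N, N m & N `<=` P].
Proof.
move=> H; have : nbhs m P by exact: H.
by rewrite nbhsE => -[N [oN Nm] NP]; exists N.
Qed.

Lemma kbump m0 U : open U -> U m0 -> exists (chi : Cinf) (C : set M),
  [/\ \forall m \near m0, chi m = 1, closed C, C `<=` U &
      forall m, ~ C m -> chi m = 0].
Proof.
move=> oU Um0; have [h [C [sh h1 Cc CU h0]]] := smooth_bump oU Um0.
pose emb (x : R) : K :=
  match g return scalars R g with RealScalars => x | ComplexScalars => x%:C%C end.
have emb1 : emb 1 = 1 by rewrite /emb; case: (g).
have emb0 : emb 0 = 0 by rewrite /emb; case: (g).
have semb : ksmooth_on setT (fun m => emb (h m)).
  rewrite /emb; case: (g) => //=; split=> //; exact: rsmooth_on_cst.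
exists (SmoothFun (asboolT semb : _ \in @smooth_pred R M g)), C; split=> //.
  by apply: filterS h1 => m /= ->.
by move=> m /h0 /= ->.
Qed.

Lemma ksmooth_sf f U : open U -> ksmooth_on U f.
Proof.
move=> oU; apply: (ksmooth_on_sub (@subsetT _ _) oU openT).
exact: asboolW (smoothfunP f).
Qed.

Section FrameAt.
Variable (E : vbundle M g).
Local Notation V := (vsection E).

(** A local frame and its dual coframe are both multiplied by a bump function [chi] to become
    global, whence u = chi^2. This global identity replaces every expansion in a local frame. *)
Lemma frame_at m0 : exists (u : Cinf) (theta : 'I_(vrank E) -> {linear V -> Cinf^o})
    (e : 'I_(vrank E) -> V), (\forall m \near m0, u m = 1) /\
  forall v, u *: v = \sum_k (theta k v : Cinf) *: e k.
Proof.
have [i im0] := @vdom_cover _ _ _ E m0.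
have oi := @vdom_open _ _ _ E i.
have [chi [C [chi1 Cc CU chi0]]] := kbump oi im0.
have nC m : ~ vdom i m -> (~` C) m by move=> nd /CU.
have se k : smooth_section (fun m => chi m *: vinv i m (delta_mx 0 k) : E m).
  move=> i' k'; apply: ksmooth_local => [|m im']; first exact: vdom_open.
  have [dm|dm] := pselect (vdom i m).
    exists (vdom i), (fun m => chi m * vtriv i' m (vinv i m (delta_mx 0 k)) 0 k').
    split=> //; last by move=> m' _ _; rewrite linearZ mxE.
    apply: ksmooth_onM; [by apply: openI => //; exact: vdom_open| |].
      by apply: ksmooth_sf; apply: openI => //; exact: vdom_open.
    by rewrite setIC; exact: vtransition.
  exists (~` C), (fun=> 0); split; [exact: closed_openC|exact: nC|exact: ksmooth_on_cst|].
  by move=> m' _ /chi0 ->; rewrite scale0r linear0 mxE.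
have st k (v : V) : ksmooth_on setT (fun m => chi m * vtriv i m (v m) 0 k).
  apply: ksmooth_local => [|m _]; first exact: openT.
  have [dm|dm] := pselect (vdom i m).
    exists (vdom i), (fun m => chi m * vtriv i m (v m) 0 k); split=> //.
    rewrite setTI; apply: ksmooth_onM => //; first exact: ksmooth_sf.
    exact: vsectionP.
  exists (~` C), (fun=> 0); split; [exact: closed_openC|exact: nC|exact: ksmooth_on_cst|].
  by move=> m' _ /chi0 ->; rewrite mul0r.
pose th k (v : V) : Cinf^o := SmoothFun (asboolT (st k v) : _ \in @smooth_pred R M g).
have thl k : linear (th k).
  move=> f v w; apply: sf_ext => m; 
  rewrite -[LHS]/(chi m * vtriv i m ((f *: v + w) m) 0 k).
  rewrite -[RHS]/(f m * (chi m * vtriv i m (v m) 0 k) + chi m * vtriv i m (w m) 0 k).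
  by rewrite vsectionDE vsectionZE linearP !mxE mulrDr mulrCA.
pose theta k : {linear V -> Cinf^o} :=
  HB.pack (th k) (GRing.isLinear.Build _ _ _ _ (th k) (thl k)).
exists (chi * chi), theta, (fun k => VSection (se k)); split.
  by apply: filterS chi1 => m c1; rewrite sfM c1 mulr1.
move=> v; apply: vsection_ext => m; rewrite vsectionZE vsection_sum sfM.
have [dm|dm] := pselect (vdom i m); last first.
  rewrite (chi0 m) ?mul0r ?scale0r; last exact: nC.
  rewrite big1 // => k _; rewrite vsectionZE /= (chi0 m) ?scale0r ?scaler0 //.
  exact: nC.
rewrite -[v m in LHS](vtrivK dm) -scalerA.
apply: (can_inj (vtrivK dm)); rewrite linear_sum.
set c := vtriv i m (v m); transitivity ((chi m * chi m) *: c).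
  by rewrite !linearZ /= vinvK // scalerA.
rewrite {1}(row_sum_delta c) scaler_sumr; apply: eq_bigr => k _.
rewrite vsectionZE -[X in _ = vtriv i m X]/((chi m * c 0 k) *: (chi m *: vinv i m (delta_mx 0 k))).
by rewrite !linearZ /= vinvK // !scalerA; congr (_ *: _); rewrite mulrA [c 0 k * _]mulrC.
Qed.

(** The second hypothesis is agreement on overlaps with denominators cleared; the glued section is
    the diagonal m -> F m m. *)
Lemma glue_sections (F : M -> V) (u : M -> Cinf) :
  (forall m, \forall m' \near m, u m m' = 1) ->
  (forall m m', u m *: F m' = u m' *: F m) ->
  exists G : V, forall m, u m *: G = F m.
Proof.
move=> u1 uF.
have EG m m' : u m m' *: F m' m' = F m m'.
  have := congr1 (fun s : V => s m') (uF m m').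
  by rewrite !vsectionZE => ->; rewrite (nbhs_singleton (u1 m')) scale1r.
have sG : smooth_section (fun m => F m m).
  move=> i k; apply: ksmooth_local => [|m im]; first exact: vdom_open.
  have [N [oN Nm Nu]] := near_open (u1 m).
  exists N, (fun m' => vtriv i m' (F m m') 0 k); split=> //; last first.
    by move=> m' _ /Nu um'; rewrite -(EG m m') um' scale1r.
  apply: (@ksmooth_on_sub _ _ _ _ (vdom i)); [exact: subIsetl| |exact: vdom_open|].
    by apply: openI => //; exact: vdom_open.
  exact: vsectionP.
by exists (VSection sG) => m; apply: vsection_ext => m'; rewrite vsectionZE EG.
Qed.

Lemma form_rank (w : form V Cinf^o) s : (vrank E < size s)%N -> w s = 0.
Proof.
move=> rs; apply: sf_ext => m.
have [u [theta [e [u1 ue]]]] := frame_at m.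
have {}u1 := nbhs_singleton u1.
(* [t] lists the arguments already replaced by frame vectors; once all are replaced, some index
   repeats by the pigeonhole principle. *)
suff H t : (vrank E < size t + size s)%N ->
    ((w (map e t ++ s) : Cinf) m = 0) by exact: (H [::]).
elim: s t {rs} => [|a s IH] t /=.
  rewrite addn0 cats0 => rt.
  have nu : ~~ uniq t.
    apply/negP => /card_uniqP ut; have := max_card (mem t).
    by rewrite ut card_ord leqNgt rt.
  have : exists t1 t2 t3 k, t = t1 ++ k :: t2 ++ k :: t3.
    elim: t nu {rt} => //= k t IH; rewrite negb_and negbK => /orP[|/IH].
      by move=> /path.splitPr [t1 t2]; exists [::], t1, t2, k.
    by move=> [t1 [t2 [t3 [k' ->]]]]; exists (k :: t1), t2, t3, k'.
  move=> [t1 [t2 [t3 [k ->]]]]; rewrite map_cat /= map_cat /=.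
  by have [_ ->] := formP w.
rewrite addnS => rt.
have W := form_mlin w.
have -> : (w (map e t ++ a :: s) : Cinf) m = (w (map e t ++ (u *: a) :: s) : Cinf) m.
  have := W (map e t) s u a 0; rewrite addr0 (mlin0 _ _ W) addr0 => ->.
  by rewrite [RHS]sfM u1 mul1r.
rewrite ue; have {}IH k := IH (rcons t k).
suff : forall r : seq 'I_(vrank E),
   (w (map e t ++ (\sum_(k <- r) (theta k a : Cinf) *: e k) :: s) : Cinf) m = 0 by exact.
elim=> [|k r IHr]; first by rewrite big_nil (mlin0 _ _ W).
rewrite big_cons W [LHS]sfD IHr addr0 [LHS]sfM.
have := IH k; rewrite map_rcons size_rcons cat_rcons => ->; rewrite ?mulr0 //.
Qed.

End FrameAt.
End Frames.

(** * Graded derivations *)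

Section Signs.
Context {U : zmodType}.
Implicit Types (x y : U) (b : bool).

Lemma signedD b x y : signed b (x + y) = signed b x + signed b y.
Proof. by case: b => //=; rewrite opprD. Qed.

Lemma signedN b x : signed b (- x) = - signed b x.
Proof. by case: b. Qed.

Lemma signed0 b : signed b 0 = 0 :> U.
Proof. by case: b => //=; rewrite oppr0. Qed.

Lemma signedK b : involutive (@signed U b).
Proof. by case: b => x //=; rewrite opprK. Qed.

Lemma signed_signed b b' x : signed b (signed b' x) = signed (b (+) b') x.
Proof. by case: b b' => [] [] //=; rewrite opprK. Qed.

Lemma mulrz_sg x k : x *~ sg k = signed (odd (absz k)) x.
Proof. by rewrite /sg -signr_odd; case: (odd _); rewrite ?mulrN1z ?mulr1z. Qed.

Lemma odd_abszD (a c : int) : odd (absz (a + c)) = odd (absz a) (+) odd (absz c).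
Proof. lia. Qed.

Lemma odd_abszM (a c : int) : odd (absz (a * c)) = odd (absz a) && odd (absz c).
Proof. by rewrite abszM oddM. Qed.

End Signs.

Section GradedDerivations.
Context {S : comPzRingType}.

(** Derivations of parity [b] along an algebra morphism [Phi]. Commutation with [feps] up to sign
    stands for homogeneity, so the Leibniz rule needs no degrees. *)
Record gder {V V' : lmodType S} (Phi : form V' S^o -> form V S^o) (b : bool)
    (D : form V' S^o -> form V S^o) : Prop := Gder {
  gd_D : forall w w', D (w + w') = D w + D w';
  gd_feps : forall w, D (feps w) = signed b (feps (D w));
  gd_M : forall w w', D (wedge w w') =
    wedge (D w) (Phi w') + wedge (fepsb b (Phi w)) (D w') }.

Section Theory.
Context {V V' : lmodType S} (Phi : form V' S^o -> form V S^o).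
Implicit Types (D : form V' S^o -> form V S^o) (b : bool).

Lemma gd_0 b D : gder Phi b D -> D 0 = 0.
Proof. by move=> gD; apply: (addrI (D 0)); rewrite -(gd_D gD) !addr0. Qed.

Lemma gd_N b D w : gder Phi b D -> D (- w) = - D w.
Proof.
by move=> gD; apply/eqP; rewrite -addr_eq0 -(gd_D gD) addNr (gd_0 gD).
Qed.

Lemma gd_signed b c D w : gder Phi b D -> D (signed c w) = signed c (D w).
Proof. by case: c => // gD; exact: gd_N gD. Qed.

Lemma gd_sum b D I (r : seq I) (P : pred I) (F : I -> form V' S^o) : gder Phi b D ->
  D (\sum_(i <- r | P i) F i) = \sum_(i <- r | P i) D (F i).
Proof.
move=> gD; elim/big_rec2: _ => [|i x y _ <-]; first exact: gd_0 gD.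
by rewrite (gd_D gD).
Qed.

Lemma gd_fepsb b c D w : gder Phi b D ->
  D (fepsb c w) = signed (b && c) (fepsb c (D w)).
Proof. by case: c => gD /=; rewrite ?andbF // andbT (gd_feps gD). Qed.

Lemma feps_signed (W : lmodType S) b (w : form V W) : feps (signed b w) = signed b (feps w).
Proof. by case: b => //=; rewrite fepsN. Qed.

Lemma gder_add b D D' : gder Phi b D -> gder Phi b D' ->
  gder Phi b (fun w => D w + D' w).
Proof.
move=> gD gD'; split=> [w w'|w|w w'].
- by rewrite (gd_D gD) (gd_D gD'); zmod.
- by rewrite (gd_feps gD) (gd_feps gD') -signedD fepsD.
- by rewrite (gd_M gD) (gd_M gD') wedgeDl wedgeDr; zmod.
Qed.

Lemma gder_signed b c D : gder Phi b D -> gder Phi b (fun w => signed c (D w)).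
Proof.
move=> gD; split=> [w w'|w|w w'].
- by rewrite (gd_D gD) signedD.
- by rewrite (gd_feps gD) feps_signed !signed_signed addbC.
- by rewrite (gd_M gD) wedge_signedl wedge_signedr signedD.
Qed.

End Theory.

(** The graded commutator of a derivation along [Phi] with a pair of derivations related by [Phi] is
    again a derivation along [Phi]. *)
Lemma gder_comm {V V' : lmodType S} (Phi : form V' S^o -> form V S^o) b b' D d' (dd : form V S^o -> form V S^o) :
  (forall w, Phi (feps w) = feps (Phi w)) -> (forall w, Phi (d' w) = dd (Phi w)) ->
  gder Phi b D -> gder id b' d' -> gder id b' dd ->
  gder Phi (b (+) b') (fun w => D (d' w) - signed (b && b') (dd (D w))).
Proof.
move=> Pe Pd gD gd' gdd; split=> [w w'|w|w w'].
- by rewrite (gd_D gd') !(gd_D gD) (gd_D gdd) signedD; zmod.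
- rewrite (gd_feps gd') (gd_signed _ _ gD) !(gd_feps gD) (gd_signed _ _ gdd).
  rewrite (gd_feps gdd) fepsD fepsN feps_signed.
  by case: b b' {gD gd' gdd} => [] [] /=; zmod.
have Pe' c x : Phi (fepsb c x) = fepsb c (Phi x) by case: c; rewrite /= ?Pe.
rewrite (gd_M gd') (gd_D gD) !(gd_M gD) (gd_D gdd) !(gd_M gdd).
rewrite (gd_fepsb _ _ gD) (gd_fepsb _ _ gdd) !Pe' !Pd.
case: b b' {gD gd' gdd Pe'} => [] [] /=; rewrite ?wedgeNl ?wedgeDl ?wedgeDr ?wedgeNl ?wedgeNr ?fepsK; zmod.
Qed.

Lemma fpull_gder {V V' : lmodType S} (phi : {linear V -> V'}) b X :
  gder id b X -> gder (fpull phi) b (fun w => X (fpull phi w)).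
Proof.
move=> gX; split=> [w w'|w|w w'].
- by rewrite fpullD (gd_D gX).
- by rewrite fpull_feps (gd_feps gX).
- by rewrite fpull_wedge (gd_M gX).
Qed.

Lemma iprod_gder {V V' : lmodType S} (phi : {linear V -> V'}) a :
  gder (fpull phi) true (fun w => fpull phi (iprod a w)).
Proof.
split=> [w w'|w|w w'].
- exact: form_ext.
- apply: form_ext => s; have := eps_con w a (map phi s).
  by rewrite /= /eps size_map.
- apply: form_ext => s; rewrite formDE.
  rewrite -[fepsb true _]/(feps (fpull phi w)) -fpull_feps.
  have -> : iprod a (wedge w w') = wedge (iprod a w) w' + wedge (feps w) (iprod a w').
    exact: form_ext.
  by rewrite fpullD !fpull_wedge.
Qed.

Lemma pwedge_gder {V V' W : lmodType S} (Phi : form V' S^o -> form V S^o) b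
    (D : W -> form V' S^o -> form V S^o) (nu : form V W) n
    (Dl : forall w, Dlin (fun v => form_val (D v w))) :
  homog n%:Z nu -> (forall v, gder Phi b (D v)) ->
  gder Phi (b (+) odd n) (fun w => fpwedge (Dl w) nu).
Proof.
move=> hn gD; split=> [w w'|w|w w']; apply: form_ext => s.
- rewrite formDE /= -pwedge_DD; apply: eq_pwedge => // v t.
  by rewrite (gd_D (gD v)).
- rewrite signedE fepsE -(eps_pwedge _ _ (Dl w)).
  rewrite (@eq_pwedge _ _ _ _ (fun v => eps (D v w)) (fun v => eps (D v w))
    (eps nu) (fun t => (-1) ^+ odd n *: nu t)) //; last exact: eps_homog hn.
  rewrite pwedgeZ; last by move=> c u v t; rewrite /eps Dl scalerDr !scalerA mulrC.
  rewrite [LHS](@eq_pwedge _ _ _ _ _ (fun v t => (-1) ^+ b *: eps (D v w) t) nu nu) //.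
    rewrite pwedge_DZ; case: (b) (odd n) => [] [];
    by rewrite /= ?scale1r ?scaleN1r ?opprK.
  move=> v t; rewrite (gd_feps (gD v)) signedE fepsE.
  by case: (b); rewrite /= ?scaleN1r ?scale1r.
- rewrite formDE [LHS](@eq_pwedge _ _ _ _ _ (fun v t => wedge_fun (D v w) (Phi w') t +
    wedge_fun (fepsb b (Phi w)) (D v w') t) nu nu) //; last first.
    by move=> v t; rewrite (gd_M (gD v)).
  rewrite pwedge_DD pwedge_wedger // (pwedge_wedgel _ _ (Dl w') hn).
  congr (_ + _); apply: eq_wedge => // t.
  rewrite fepsbE (_ : form_val (fepsb b (Phi w)) = epsb b (Phi w)) ?epsb_epsb.
    by rewrite addbC.
  by case: (b).
Qed.

(** [CE] is built with [mkform], so its values are known only after the Koszul formula has been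
    shown to give a form. *)
Lemma CEE (V W : lmodType S) (rho : V -> S -> S) br (nabla : V -> W -> W)
    (w : form V W) s :
  lie_rinehart rho br -> @flat_rep _ _ rho br S^o rho -> flat_rep rho br nabla ->
  CE br nabla w s = kz br nabla w s.
Proof.
move=> LR FR0 FR; have E : koszul br nabla w =1 kz br nabla w.
  by move=> t; apply: koszulE; exact: formP.
rewrite -E; apply: mkformE; rewrite (funext E); apply: mlin_alt_is_form.
  by apply: (kz_mlin LR FR0 FR); [exact: form_mlin|exact: form_alt].
by apply: (kz_alt LR FR); [exact: form_mlin|exact: form_alt].
Qed.

Section CEForm.
Context {V W : lmodType S} (rho : V -> S -> S) (br : V -> V -> V) (nabla : V -> W -> W).
Hypothesis LR : lie_rinehart rho br.
Hypothesis FR0 : @flat_rep _ _ rho br S^o rho.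
Hypothesis FR : flat_rep rho br nabla.
Local Notation d := (CE br nabla).
Local Notation d0 := (CE br (rho : V -> S^o -> S^o)).

Lemma CE_D w w' : d (w + w') = d w + d w'.
Proof.
apply: form_ext => s; rewrite formDE !(CEE _ _ LR FR0 FR).
exact: (kzD FR).
Qed.

Lemma CE_feps w : d (feps w) = - feps (d w).
Proof.
apply: form_ext => s; rewrite formNE fepsE /eps !(CEE _ _ LR FR0 FR).
exact: (kz_eps FR).
Qed.

Lemma CE_wedge (f : form V S^o) w :
  d (wedge f w) = wedge (d0 f) w + wedge (feps f) (d w).
Proof.
apply: form_ext => s; rewrite formDE (CEE _ _ LR FR0 FR) (kz_wedge FR0 FR).
by congr (_ + _); apply: eq_wedge => // t; rewrite ?(CEE _ _ LR FR0 FR) ?(CEE _ _ LR FR0 FR0).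
Qed.

Lemma CE_CE w : d (d w) = 0.
Proof.
apply: form_ext => s; rewrite (CEE _ _ LR FR0 FR).
rewrite (@eq_kz _ _ _ _ _ (d w) (kz br nabla w)); last first.
  by move=> t; rewrite (CEE _ _ LR FR0 FR).
by rewrite (kz_kz LR FR) //; exact: form_mlin.
Qed.

Lemma CE_homog k w : homog k w -> homog (k + 1) (d w).
Proof. by move=> h s sk; rewrite (CEE _ _ LR FR0 FR); exact: (kz_homog FR h). Qed.

Lemma CE_form0 (c : S) s : d0 (form0 (c : S^o)) s = dfun rho c s.
Proof. by rewrite (CEE _ _ LR FR0 FR0) kz_const. Qed.

End CEForm.

Lemma CE_gder {V : lmodType S} (rho : V -> S -> S) (br : V -> V -> V) :
  lie_rinehart rho br -> @flat_rep _ _ rho br S^o rho ->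
  gder id true (CE br (rho : V -> S^o -> S^o)).
Proof.
move=> LR FR0; split=> [w w'|w|w w'].
- exact: (CE_D LR FR0 FR0).
- exact: (CE_feps LR FR0 FR0).
- exact: (CE_wedge LR FR0 FR0).
Qed.

End GradedDerivations.

(** * Homogeneous components and Euler's identity *)

Section Components.
Context {S : comPzRingType} {V W : lmodType S}.
Implicit Types (w : form V W).

Lemma is_form_component n w : is_form (fun s => if size s == n then w s else 0).
Proof.
have [wl wa] := formP w; split=> [s t c a b|s t u a]; last by rewrite wa if_same.
rewrite !size_cat /= wl; case: eqP => // _.
by rewrite scaler0 addr0.
Qed.

Definition component n w : form V W := Form (is_form_component n w).

Lemma component_homog n w : homog n%:Z (component n w).
Proof. by move=> s sn; rewrite /= ifF //; apply/negP => /eqP E; apply: sn; rewrite E. Qed.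

Lemma component_sum N w : (forall s, (N <= size s)%N -> w s = 0) ->
  w = \sum_(n < N) component n w.
Proof.
move=> w0; apply: form_ext => s; rewrite form_sumE.
have [sN|Ns] := ltnP (size s) N; last first.
  rewrite w0 // big1 // => n _ /=; rewrite ifF //.
  by apply/negP => /eqP E; move: (ltn_ord n); rewrite -E ltnNge Ns.
rewrite (bigD1 (Ordinal sN)) //= eqxx big1 ?addr0 // => n.
by rewrite -val_eqE /= eq_sym => /negPf ->.
Qed.

Lemma feps_homog k w : homog k w -> feps w = signed (odd (absz k)) w.
Proof.
have [k0 hw|k0 /homog_neg ->//] := leP 0 k.
  by rewrite -(fepsb_hom true (n := absz k)) // gez0_abs.
by apply: form_ext => s; rewrite signed0 fepsE /eps scaler0.
Qed.

Lemma wedge_suml I (r : seq I) (P : pred I) (F : I -> form V S^o) w :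
  wedge (\sum_(i <- r | P i) F i) w = \sum_(i <- r | P i) wedge (F i) w.
Proof.
by elim/big_rec2: _ => [|i x y _ <-]; rewrite ?wedge0l ?wedgeDl.
Qed.

Lemma wedge_sumr I (r : seq I) (P : pred I) (F : I -> form V W) (f : form V S^o) :
  wedge f (\sum_(i <- r | P i) F i) = \sum_(i <- r | P i) wedge f (F i).
Proof.
by elim/big_rec2: _ => [|i x y _ <-]; rewrite ?wedge0r ?wedgeDr.
Qed.

(** Each argument [a] contributes one copy of u w: contracting theta^k yields sum theta^k(a) e_k = u
    a, and the two signs of the other term cancel. *)
Lemma euler_frame r (u : S) (theta : 'I_r -> {linear V -> S^o}) (e : 'I_r -> V) w s :
  (forall v, u *: v = \sum_k (theta k v : S) *: e k) ->
  (\sum_k wedge (form1 (theta k)) (iprod (e k) w)) s = (u *: w s) *+ size s.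
Proof.
move=> ue; rewrite form_sumE; elim: s w => [|a s IH] w.
  by rewrite big1 // => k _; rewrite /= scale0r.
have wl := form_mlin w.
transitivity (\sum_k ((theta k a : S) *: w (e k :: s) +
    wedge (form1 (theta k)) (iprod (e k) (iprod a w)) s)).
  apply: eq_bigr => k _; rewrite [LHS]wedge_fun_cons; congr (_ + _).
    rewrite -(wedge_const (theta k a : S) (fun t => w (e k :: t))).
    by apply: eq_wedge => // -[|b [|c t]].
  rewrite /= -[RHS]opprK -wedge_funNl -wedge_funNr; apply: eq_wedge.
    move=> [|b [|c t]]; rewrite /eps /= ?scaler0 ?oppr0 //.
    by rewrite expr1 scaleN1r.
  by move=> t; rewrite /con /= con_swap //; exact: form_alt.
rewrite big_split mulrS; congr (_ + _); last exact: IH.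
have := wl [::] s u a 0; rewrite addr0 (@mlin0 _ _ _ w [::]) // addr0 !cat0s => <-.
rewrite ue; elim: (index_enum _) => [|k r' IHr].
  by rewrite !big_nil (@mlin0 _ _ _ w [::]).
by rewrite !big_cons (wl [::]) !cat0s IHr.
Qed.

End Components.

Arguments component_homog {S V W} n w [s].

Section Uniqueness.
Context {R : realType} {M : manifold R} {g : ground}.
Local Notation Cinf := (smoothfun M g).
Local Notation Om E := (form (vsection E) Cinf^o).

Lemma scalars_mulrn_eq0 (x : scalars R g) n : x *+ n.+1 = 0 -> x = 0.
Proof.
by case: g x => x /eqP; rewrite mulrn_eq0 => /eqP.
Qed.

Lemma component_decomp (E : vbundle M g) (w : Om E) :
  w = \sum_(n < (vrank E).+1) component n w.
Proof. by apply: component_sum => s; exact: form_rank. Qed.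

(* By Euler's identity a form of degree n + 1 is, near any given point, a sum of
   products of 1-forms by forms of degree n, divided by n + 1. *)
Lemma gder_eq0 (E E' : vbundle M g) (Phi : Om E' -> Om E) b D : gder Phi b D ->
  (forall f, Phi (form0 f) = form0 f) -> (forall f, D (form0 f) = 0) ->
  (forall w, homog 1 w -> D w = 0) -> forall w, D w = 0.
Proof.
move=> gD P0 D0 D1 w; rewrite (component_decomp w) (gd_sum _ _ _ gD) big1 // => n _.
move: (component n w) (component_homog n w) => {}w; move: (n : nat) => {}n.
elim: n w => [|n IH] w hw; first by rewrite (homog0P hw).
have hi a : homog n%:Z (iprod a w) by move=> s sn; apply: hw => -[] /= sn'; apply: sn; rewrite sn'.
apply: form_ext => s; apply: sf_ext => m.
have [u [theta [e [u1 ue]]]] := frame_at E' m.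
have {}u1 := nbhs_singleton u1.
have E1 : \sum_k wedge (form1 (theta k)) (iprod (e k) w) = wedge (form0 (u : Cinf^o)) w *+ n.+1.
  apply: form_ext => t; rewrite (euler_frame _ _ ue).
  have -> : (wedge (form0 (u : Cinf^o)) w *+ n.+1) t = (u *: w t) *+ n.+1.
    rewrite -(wedge_form0 u w t); elim: (n.+1) => // k IHk.
    by rewrite !mulrS formDE IHk.
  have [->//|tn] := eqVneq (size t) n.+1.
  rewrite hw ?scaler0 ?mul0rn // => -[] E1; by rewrite E1 eqxx in tn.
have : D (wedge (form0 (u : Cinf^o)) w *+ n.+1) = 0.
  rewrite -E1 (gd_sum _ _ _ gD) big1 // => k _.
  by rewrite (gd_M gD) (D1 _ (homog_form1 _)) wedge0l add0r (IH _ (hi _)) wedge0r.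
have -> : D (wedge (form0 (u : Cinf^o)) w *+ n.+1) = D (wedge (form0 (u : Cinf^o)) w) *+ n.+1.
  by elim: (n.+1) => [|k IHk]; rewrite ?mulr0n ?(gd_0 gD) // !mulrS (gd_D gD) IHk.
rewrite (gd_M gD) D0 wedge0l add0r P0 fepsb_form0.
move=> /(congr1 (fun F : Om E => (F s : Cinf) m)).
have -> k : ((wedge (form0 (u : Cinf^o)) (D w) *+ k) s : Cinf) m =
   (u m * (D w s : Cinf) m) *+ k.
  elim: k => [|k IHk] //; rewrite !mulrS formDE [LHS]sfD IHk; congr (_ + _).
  by rewrite wedge_form0.
by rewrite u1 mul1r; exact: scalars_mulrn_eq0.
Qed.

Lemma gder_ext (E E' : vbundle M g) (Phi : Om E' -> Om E) b D D' :
  gder Phi b D -> gder Phi b D' -> (forall f, Phi (form0 f) = form0 f) ->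
  (forall f, D (form0 f) = D' (form0 f)) ->
  (forall w, homog 1 w -> D w = D' w) -> forall w, D w = D' w.
Proof.
move=> gD gD' P0 E0 E1 w; apply/eqP; rewrite -subr_eq0; apply/eqP.
apply: (gder_eq0 (gder_add gD (gder_signed true gD'))) => // [f|w' h].
  by rewrite /= E0 subrr.
by rewrite /= E1 // subrr.
Qed.

End Uniqueness.

Section DerivationGder.
Context {R : realType} {M : manifold R} {g : ground} (P : lie_pair M g).
Local Notation Cinf := (smoothfun M g).
Local Notation A := (lp_A P).
Implicit Types (X : Afun P -> Afun P) (d : int).

Lemma smooth_cst1 : smooth_cst M (1 : scalars R g) = 1.
Proof. exact: sf_ext. Qed.

(** The Leibniz rule of [derivation] concerns a homogeneous left factor; the bound by the rank makes
    every form a finite sum of such factors. *)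
Lemma derivation_gder d X : derivation d X -> gder id (odd (absz d)) X.
Proof.
move=> [deg lin lei].
have XD w w' : X (w + w') = X w + X w'.
  by have := lin 1 w w'; rewrite /Acst /Afun0 smooth_cst1 !wedge1.
have X0 : X 0 = 0 by apply: (addrI (X 0)); rewrite -XD !addr0.
have Xsum (F : nat -> Afun P) N : X (\sum_(n < N) F n) = \sum_(n < N) X (F n).
  by elim/big_rec2: _ => // i x y _ <-.
have E (w : Afun P) : w = \sum_(n < (vrank A).+1) component n w by exact: component_decomp.
split=> // [w|w w'].
  have esum (F : nat -> Afun P) N : feps (\sum_(n < N) F n) = \sum_(n < N) feps (F n).
    elim/big_rec2: _ => [|i x y _ <-]; rewrite ?fepsD //.
    by apply: form_ext => s; rewrite fepsE /eps scaler0.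
  have ssum (F : nat -> Afun P) N b : signed b (\sum_(n < N) F n) = \sum_(n < N) signed b (F n).
    by elim/big_rec2: _ => [|i x y _ <-]; rewrite ?signed0 ?signedD.
  have EX : X w = \sum_(n < (vrank A).+1) X (component n w).
    by rewrite {1}(E w) (Xsum (fun n => component n w)).
  rewrite EX (esum (fun n => X (component n w))).
  rewrite (ssum (fun n => feps (X (component n w)))) {1}(E w).
  rewrite (esum (fun n => component n w)) (Xsum (fun n => feps (component n w))).
  apply: eq_bigr => n _.
  have hn := component_homog n w.
  rewrite (feps_homog hn) (feps_homog (deg _ _ hn)) odd_abszD signed_signed.
  rewrite addbC -addbA addbb addbF /=.
  case: (odd n) => //=; apply/eqP; rewrite -addr_eq0 -XD addNr X0 //.
rewrite {1}(E w) wedge_suml (Xsum (fun n => wedge (component n w) w')).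
under eq_bigr => n _ do rewrite (lei _ _ _ (component_homog n w)).
rewrite big_split /= -wedge_suml -(Xsum (fun n => component n w)) -(E w); congr (_ + _).
have fsum (F : nat -> Afun P) N b : fepsb b (\sum_(n < N) F n) = \sum_(n < N) fepsb b (F n).
  case: b => //=; elim/big_rec2: _ => [|i x y _ <-]; rewrite ?fepsD //.
  by apply: form_ext => s; rewrite fepsE /eps scaler0.
rewrite {2}(E w) (fsum (fun n => component n w)) wedge_suml; apply: eq_bigr => n _.
rewrite (fepsb_hom _ (component_homog n w)) wedge_signedl mulrz_sg odd_abszM.
by [].
Qed.

Lemma gder_derivation d X : gder id (odd (absz d)) X ->
  (forall k w, homog k w -> homog (k + d) (X w)) ->
  (forall c, X (Acst P c) = 0) -> derivation d X.
Proof.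
move=> gX deg X0; split=> // [c w w'|k w w' hw].
  rewrite (gd_D gX) (gd_M gX) X0 wedge0l add0r; congr (wedge _ _ + _).
  exact: fepsb_form0.
rewrite (gd_M gX) mulrz_sg odd_abszM; congr (_ + _).
case: (odd (absz d)) => //=; rewrite (feps_homog hw).
by rewrite wedge_signedl.
Qed.

End DerivationGder.

(** * Lie algebroids and the split exact sequence *)

Section Algebroid.
Context {R : realType} {M : manifold R} {g : ground} (L : lie_algebroid M g).
Local Notation Cinf := (smoothfun M g).
Implicit Types (u v w : vsection L) (f h : Cinf).

Lemma anchorD v f h : anchor v (f + h) = anchor v f + anchor v h.
Proof. by have := anchor_klinear v 1 f h; rewrite smooth_cst1 !mul1r. Qed.

Lemma anchor0 v : anchor v 0 = 0.
Proof. by apply: (addrI (anchor v 0)); rewrite -anchorD !addr0. Qed.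

Lemma anchor1 v : anchor v 1 = 0.
Proof.
apply: (addrI (anchor v 1)); rewrite addr0.
by have := anchor_leibniz v 1 1; rewrite !mulr1 mul1r => <-.
Qed.

Lemma anchor_cst v c : anchor v (smooth_cst M c) = 0.
Proof.
have := anchor_klinear v c 1 0.
by rewrite anchor1 anchor0 mulr1 mulr0 !addr0.
Qed.

Lemma lbrDl u v w : lbr (u + v) w = lbr u w + lbr v w.
Proof. by have := lbr_klinear 1 u v w; rewrite smooth_cst1 !scale1r. Qed.

Lemma lbrDr u v w : lbr u (v + w) = lbr u v + lbr u w.
Proof. by rewrite lbr_antisym lbrDl opprD -!(lbr_antisym u). Qed.

Lemma lbr0r u : lbr u 0 = 0 :> vsection L.
Proof. by apply: (addrI (lbr u 0)); rewrite -lbrDr !addr0. Qed.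

Lemma lbrNr u v : lbr u (- v) = - lbr u v.
Proof. by apply/eqP; rewrite -addr_eq0 -lbrDr addNr lbr0r. Qed.

(** Turns the antisymmetry axiom into [v, v] = 0. *)
Lemma vsection_double (E : vbundle M g) (v : vsection E) : v + v = 0 -> v = 0.
Proof.
move=> E0; apply: vsection_ext => m.
have := congr1 (fun s : vsection E => s m) E0; rewrite vsectionDE.
rewrite -[v m]scale1r -scalerDl -[(0 : vsection E) m]/(0 : E m) => E2.
have n0 : (1 + 1 : scalars R g) != 0.
  by apply/eqP => /(@scalars_mulrn_eq0 _ _ 1 1) /eqP; rewrite oner_eq0.
have := congr1 (fun x => (1 + 1 : scalars R g)^-1 *: x) E2.
by rewrite scaler0 scalerA mulVf // scale1r.
Qed.

Lemma algebroid_lie_rinehart : lie_rinehart (@anchor _ _ _ L) (@lbr _ _ _ L).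
Proof.
split=> [c a b f|a c b b'|c a a' b|a|a b c].
- exact: anchor_linear.
- by rewrite lbrDr lbr_leibniz.
- by rewrite lbrDl lbr_antisym lbr_leibniz (lbr_antisym b) scalerN; zmod.
- apply: vsection_double; rewrite {1}lbr_antisym; exact: addNr.
- have := lbr_jacobi a b c; rewrite (lbr_antisym c a) lbrNr => J.
  rewrite (lbr_antisym (lbr a b) c); apply/esym/eqP.
  by rewrite -addr_eq0; apply/eqP.
Qed.

Lemma algebroid_flat_rep :
  @flat_rep _ _ (@anchor _ _ _ L) (@lbr _ _ _ L) Cinf^o (@anchor _ _ _ L).
Proof.
split=> [a x y|a c x|c a b x|a b x].
- exact: anchorD.
- rewrite -[RHS]/((c : Cinf) * anchor a x + anchor a c * (x : Cinf)) addrC.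
  exact: anchor_leibniz.
- exact: anchor_linear.
- exact: anchor_lbr.
Qed.

End Algebroid.

Section SmapTheory.
Context {R : realType} {M : manifold R} {g : ground} {E F : vbundle M g}.
Variable phi : vbmorph E F.

Lemma smapD u v : smap phi (u + v) = smap phi u + smap phi v.
Proof. exact: linearD. Qed.

Lemma smapZ f v : smap phi (f *: v) = f *: smap phi v.
Proof. exact: linearZ. Qed.

Lemma smapN v : smap phi (- v) = - smap phi v.
Proof. exact: linearN. Qed.

Lemma smap0 : smap phi 0 = 0.
Proof. exact: linear0. Qed.

End SmapTheory.

Section SplitSequence.
Context {R : realType} {M : manifold R} {g : ground}.
Variables (P : lie_pair M g) (S : splitting P).
Local Notation Cinf := (smoothfun M g).
Local Notation A := (lp_A P).
Local Notation L := (lp_L P).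
Local Notation B := (sp_B S).
Local Notation i_ := (smap (lp_i P)).
Local Notation q_ := (smap (sp_q S)).
Local Notation j_ := (smap (sp_j S)).
Local Notation p_ := (smap (sp_p S)).

Lemma sm_qi a : q_ (i_ a) = 0.
Proof.
apply: vsection_ext => m; rewrite -[LHS]/(sp_q S m (lp_i P m (a m))).
by apply/sp_exact; exists (a m).
Qed.

Lemma sm_qj b : q_ (j_ b) = b.
Proof. by apply: vsection_ext => m; exact: sp_qj. Qed.

Lemma sm_pi a : p_ (i_ a) = a.
Proof. by apply: vsection_ext => m; exact: sp_pi. Qed.

Lemma sm_pj b : p_ (j_ b) = 0.
Proof.
apply: vsection_ext => m; rewrite -[LHS]/(sp_p S m (sp_j S m (b m))).
by apply/sp_p_ker; exists (b m).
Qed.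

Lemma sm_split v : v = i_ (p_ v) + j_ (q_ v).
Proof.
apply: vsection_ext => m; rewrite vsectionDE.
rewrite -[i_ (p_ v) m]/(lp_i P m (sp_p S m (v m))) -[j_ (q_ v) m]/(sp_j S m (sp_q S m (v m))).
have : sp_q S m (v m - sp_j S m (sp_q S m (v m))) = 0 by rewrite linearB sp_qj subrr.
move=> /sp_exact [a E].
have -> : v m = lp_i P m a + sp_j S m (sp_q S m (v m)) by rewrite E subrK.
rewrite !linearD sp_pi sp_qj.
have -> : sp_q S m (lp_i P m a) = 0 by apply/sp_exact; exists a.
have -> : sp_p S m (sp_j S m (sp_q S m (v m))) = 0.
  by apply/sp_p_ker; exists (sp_q S m (v m)).
by rewrite !linear0 addr0 add0r.
Qed.

(** The Bott connection does not depend on the lift, because [A] is closed under the bracket and [q]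
    kills [A]. *)
Lemma q_lbr_i a v : q_ (lbr (i_ a) (j_ (q_ v))) = q_ (lbr (i_ a) v).
Proof.
rewrite {2}(sm_split v) lbrDr smapD -lp_i_lbr sm_qi add0r.
by [].
Qed.

Lemma bott_flat_rep : flat_rep (@anchor _ _ _ A) (@lbr _ _ _ A) (@bott _ _ _ P S).
Proof.
have LR := algebroid_lie_rinehart L.
split=> [a x y|a c x|c a b x|a b x]; rewrite /bott.
- by rewrite smapD lbrDr smapD.
- by rewrite smapZ lbr_leibniz smapD !smapZ sm_qj lp_i_anchor.
- rewrite !(smapD, smapZ) (lr_Pbr LR).
  by rewrite !(smapD, smapN, smapZ) sm_qi scaler0 subr0.
- rewrite !q_lbr_i lp_i_lbr (lr_jacobi LR) smapD smapN.
  by [].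
Qed.

End SplitSequence.

(** * The differential of a section *)

Section Reflexivity.
Context {R : realType} {M : manifold R} {g : ground} (E : vbundle M g).
Local Notation Cinf := (smoothfun M g).
Local Notation W := (vsection E).
Context {V : lmodType Cinf}.
Implicit Types (w : form W Cinf^o).

Lemma form1P w : homog 1 w -> exists h : {linear W -> Cinf^o}, w = form1 h.
Proof.
move=> hw; have hl : linear (fun v => w [:: v]).
  by move=> c u v; exact: (form_mlin w [::] [::]).
exists (HB.pack (fun v => w [:: v]) (GRing.isLinear.Build _ _ _ _ _ hl) : {linear W -> Cinf^o}).
by apply: form_ext => -[|v [|v' s]] //; rewrite hw.
Qed.

(** Reflexivity of the module of sections: near a point the form is sum Psi(theta^k) e_k, and the
    local pieces are glued. It produces the second component of a differential from its pairings. *)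
Lemma sections_dual_reflexive (Psi : form W Cinf^o -> form V Cinf^o) :
  (forall w w', Psi (w + w') = Psi w + Psi w') ->
  (forall (f : Cinf) w, homog 1 w ->
     Psi (wedge (form0 (f : Cinf^o)) w) = wedge (form0 (f : Cinf^o)) (Psi w)) ->
  exists mu : form V W, forall w, homog 1 w -> forall s, w [:: mu s] = Psi w s.
Proof.
move=> PD PZ.
have Psum I (r : seq I) (F : I -> form W Cinf^o) : Psi (\sum_(i <- r) F i) = \sum_(i <- r) Psi (F i).
  have P0 : Psi 0 = 0 by apply: (addrI (Psi 0)); rewrite -PD !addr0.
  by elim/big_rec2: _ => // i x y _ <-.
pose isfr (m : M) (T : Cinf * ('I_(vrank E) -> {linear W -> Cinf^o}) * ('I_(vrank E) -> W)) :=
  (\forall m' \near m, T.1.1 m' = 1) /\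
  forall v, T.1.1 *: v = \sum_k (T.1.2 k v : Cinf) *: T.2 k.
have fe (m : M) : exists T, isfr m T.
  by have [u [th [e [H1 H2]]]] := frame_at E m; exists (u, th, e).
pose fr m := projT1 (cid (fe m)).
have frP m : isfr m (fr m) by exact: projT2 (cid (fe m)).
pose u m := (fr m).1.1; pose th m := (fr m).1.2; pose e m := (fr m).2.
have u1 m : \forall m' \near m, u m m' = 1 by have [] := frP m.
have ue m v : u m *: v = \sum_k (th m k v : Cinf) *: e m k by have [_] := frP m; exact.
(* [Psi] preserves linear relations between 1-forms; both the gluing condition and the final formula
   are such relations. *)
have PE (T : nat) (c : 'I_T -> Cinf) (h : 'I_T -> {linear W -> Cinf^o}) (c' : Cinf) w :
    homog 1 w -> (forall v, \sum_k c k * (h k v : Cinf) = c' * (w [:: v] : Cinf)) ->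
    forall s, \sum_k c k * (Psi (form1 (h k)) s : Cinf) = c' * (Psi w s : Cinf).
  move=> hw H s.
  have := congr1 (fun F : form V Cinf^o => F s) (PZ c' w hw); rewrite wedge_form0 => E0; rewrite -[RHS]/(c' *: Psi w s) -E0.
  have -> : wedge (form0 (c' : Cinf^o)) w = \sum_k wedge (form0 (c k : Cinf^o)) (form1 (h k)).
    apply: homog1_ext => [||v].
    - by rewrite -[1]add0r; apply: homog_wedge => //; exact: homog_form0.
    - elim/big_rec: _ => // k x _ hx; apply: homogD => //.
      by rewrite -[1]add0r; apply: homog_wedge; [exact: homog_form0|exact: homog_form1].
    rewrite wedge_form0 -[LHS]/(c' * (w [:: v] : Cinf)) -H form_sumE.
    by apply: eq_bigr => k _; rewrite wedge_form0.
  rewrite Psum form_sumE; apply: eq_bigr => k _.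
  by rewrite PZ ?wedge_form0 //; exact: homog_form1.
pose F s m : W := \sum_k (Psi (form1 (th m k)) s : Cinf) *: e m k.
have H s : exists G : W, forall m, u m *: G = F s m.
  apply: glue_sections => // m m'.
  rewrite /F !scaler_sumr.
  transitivity (\sum_k \sum_l ((th m l (e m' k) : Cinf) * (Psi (form1 (th m' k)) s : Cinf)) *: e m l).
    apply: eq_bigr => k _; rewrite scalerA mulrC -scalerA ue scaler_sumr.
    by apply: eq_bigr => l _; rewrite scalerA mulrC.
  rewrite exchange_big; apply: eq_bigr => l _ /=.
  rewrite -scaler_suml scalerA; congr (_ *: _).
  apply: (PE _ _ _ _ (form1 (th m l))); first exact: homog_form1.
  move=> v; have := congr1 (th m l) (ue m' v); rewrite linearZ linear_sum => E1.
  rewrite -[RHS]/(u m' *: (th m l v)) E1; apply: eq_bigr => k _.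
  by rewrite linearZ mulrC.
pose G s := projT1 (cid (H s)).
have GP s m : u m *: G s = F s m by rewrite /G; case: (cid _).
have sep (x y : W) : (forall m, u m *: x = u m *: y) -> x = y.
  move=> xy; apply: vsection_ext => m.
  have := congr1 (fun z : W => z m) (xy m).
  by rewrite !vsectionZE (nbhs_singleton (u1 m)) !scale1r.
have fG : is_form G.
  split=> [s t c a b|s t v a]; apply: sep => m.
    rewrite scalerDr scalerA mulrC -scalerA !GP /F scaler_sumr -big_split.
    apply: eq_bigr => k _ /=; rewrite scalerA -scalerDl; congr (_ *: _).
    exact: (form_mlin (Psi (form1 (th m k)))).
  rewrite GP scaler0 /F big1 // => k _.
  by have [_ ->] := formP (Psi (form1 (th m k))); rewrite scale0r.
exists (Form fG) => w hw s; apply: sf_ext => m /=.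
have [h wh] := form1P hw.
have hZ (c : Cinf) v : h (c *: v) = c *: h v by exact: linearZ.
have E1 : u m * (w [:: G s] : Cinf) = u m * (Psi w s : Cinf).
  rewrite -(PE _ (fun k => w [:: e m k] : Cinf) (th m) (u m) w hw); last first.
    move=> v; rewrite wh /= -[RHS]/(u m *: (h v)) -hZ ue linear_sum.
    by apply: eq_bigr => k _; rewrite hZ mulrC.
  rewrite wh /= -[LHS]/(u m *: (h (G s))) -hZ GP linear_sum.
  by apply: eq_bigr => k _; rewrite hZ mulrC.
have := congr1 (fun f : Cinf => f m) E1.
by rewrite !sfM (nbhs_singleton (u1 m)) !mul1r.
Qed.

Lemma section_sep (x y : W) m :
  (forall w, homog 1 w -> (w [:: x] : Cinf) m = (w [:: y] : Cinf) m) -> x m = y m.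
Proof.
move=> H; have [u [th [e [u1 ue]]]] := frame_at E m.
have {}u1 := nbhs_singleton u1.
have E1 (z : W) : z m = \sum_k (th k z : Cinf) m *: e k m.
  rewrite -[LHS]scale1r -u1 -vsectionZE ue vsection_sum.
  by apply: eq_bigr => k _; rewrite vsectionZE.
rewrite (E1 x) (E1 y); apply: eq_bigr => k _; congr (_ *: _).
exact: (H (form1 (th k)) (homog_form1 _)).
Qed.

Lemma form_sep (mu mu' : form V W) :
  (forall w, homog 1 w -> forall s, w [:: mu s] = w [:: mu' s]) -> mu = mu'.
Proof.
move=> H; apply: form_ext => s; apply: vsection_ext => m.
by apply: section_sep => w hw; rewrite H.
Qed.

End Reflexivity.

(** * Contraction by L-valued forms and the differential of a section *)

Section Contraction.
Context {R : realType} {M : manifold R} {g : ground} (P : lie_pair M g).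
Local Notation Cinf := (smoothfun M g).
Local Notation A := (lp_A P).
Local Notation L := (lp_L P).
Local Notation i_ := (smap (lp_i P)).
Local Notation OmA := (form (vsection A) Cinf^o).
Local Notation OmL := (form (vsection L) Cinf^o).

Definition dL (w : OmL) : OmL := CE (@lbr _ _ _ L) (@anchor _ _ _ L : _ -> Cinf^o -> Cinf^o) w.
Definition ipull (w : OmL) : OmA := fpull i_ w.

Lemma dA_gder : gder id true (@dA _ _ _ P).
Proof. exact: (CE_gder (algebroid_lie_rinehart A) (algebroid_flat_rep A)). Qed.

Lemma dL_gder : gder id true dL.
Proof. exact: (CE_gder (algebroid_lie_rinehart L) (algebroid_flat_rep L)). Qed.

Lemma dA_homog k (w : OmA) : homog k w -> homog (k + 1) (dA w).
Proof. exact: (CE_homog (algebroid_lie_rinehart A) (algebroid_flat_rep A) (algebroid_flat_rep A)). Qed.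

Lemma dL_homog k w : homog k w -> homog (k + 1) (dL w).
Proof. exact: (CE_homog (algebroid_lie_rinehart L) (algebroid_flat_rep L) (algebroid_flat_rep L)). Qed.

Lemma dA_dA (w : OmA) : dA (dA w) = 0.
Proof. exact: (CE_CE (algebroid_lie_rinehart A) (algebroid_flat_rep A) (algebroid_flat_rep A)). Qed.

Lemma dL_dL w : dL (dL w) = 0.
Proof. exact: (CE_CE (algebroid_lie_rinehart L) (algebroid_flat_rep L) (algebroid_flat_rep L)). Qed.

Lemma dA_form0 (f : Cinf) s :
  dA (form0 (f : Cinf^o) : OmA) s = dfun (@anchor _ _ _ A) f s.
Proof. exact: (CE_form0 (algebroid_lie_rinehart A) (algebroid_flat_rep A)). Qed.

Lemma dL_form0 (f : Cinf) s : dL (form0 (f : Cinf^o)) s = dfun (@anchor _ _ _ L) f s.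
Proof. exact: (CE_form0 (algebroid_lie_rinehart L) (algebroid_flat_rep L)). Qed.

Lemma dL_one w l l' : homog 1 w -> dL w [:: l; l'] =
  (anchor l (w [:: l']) : Cinf^o) - anchor l' (w [:: l]) - w [:: lbr l l'].
Proof.
move=> hw; have LR := algebroid_lie_rinehart L; have FR := algebroid_flat_rep L.
rewrite [LHS](CEE _ _ LR FR FR) /= /con.
by zmod.
Qed.

Lemma ipull_dL w : ipull (dL w) = dA (ipull w).
Proof.
have LRL := algebroid_lie_rinehart L; have FRL := algebroid_flat_rep L.
have LRA := algebroid_lie_rinehart A; have FRA := algebroid_flat_rep A.
apply: form_ext => s; rewrite fpullE [LHS](CEE _ _ LRL FRL FRL) [RHS](CEE _ _ LRA FRA FRA).
symmetry; apply: (@kz_map _ _ _ Cinf^o i_ (@lbr _ _ _ A) (@lbr _ _ _ L)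
  (@anchor _ _ _ A : _ -> Cinf^o -> Cinf^o) (@anchor _ _ _ L : _ -> Cinf^o -> Cinf^o) w).
  by move=> a b; exact: lp_i_lbr.
by move=> a f; rewrite -lp_i_anchor.
Qed.

Lemma insl_lin (w : OmL) : Dlin (fun l => form_val (ipull (iprod l w))).
Proof. by move=> c u v s; exact: (form_mlin w [::]). Qed.

(* The sum of the [xi k /\ i^* (iota (l k) w)], for [nu] the sum of the
   [xi k (x) l k]. *)
Definition iota_form (nu : Aform P L) (w : OmL) : OmA := fpwedge (insl_lin w) nu.

Lemma homog_absz (V W : lmodType Cinf) d (w : form V W) :
  homog d w -> homog (absz d)%:Z w.
Proof.
have [d0|d0 /homog_neg ->//] := leP 0 d; first by rewrite gez0_abs.
Qed.

Lemma iota_gder d nu : homog d nu -> gder ipull (~~ odd (absz d)) (iota_form nu).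
Proof.
move=> hn; have -> : ~~ odd (absz d) = true (+) odd (absz d) by [].
apply: (pwedge_gder (D := fun l w => ipull (iprod l w)) insl_lin (homog_absz hn)).
by move=> l; exact: iprod_gder.
Qed.

Lemma iota_homog d k nu w : homog d nu -> homog k w -> homog (d + (k - 1)) (iota_form nu w).
Proof.
move=> hn hw; apply: fpwedge_homog => // l s sk; rewrite fpullE; apply: hw => /= E.
by apply: sk; rewrite -E size_map -addn1 PoszD addrK.
Qed.

Lemma iota_form0 nu f : iota_form nu (form0 f) = 0.
Proof.
apply: form_ext => s; rewrite /= (@eq_pwedge _ _ _ _ _ (fun _ _ => 0) nu nu) ?pwedge_D0 //.
Qed.

Lemma iota_one nu w s : homog 1 w -> iota_form nu w s = w [:: nu s].
Proof.
move=> hw; rewrite -(pwedge_form0 (fun l => w [:: l]) nu s); apply: eq_pwedge => // l [|a t] //=.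
by rewrite hw.
Qed.

Lemma iota_nuD nu nu' w : iota_form (nu + nu') w = iota_form nu w + iota_form nu' w.
Proof. exact: fpwedgeD. Qed.

Lemma iota_0 w : iota_form 0 w = 0.
Proof. by apply: form_ext => s; apply: pwedge0; exact: insl_lin. Qed.

Lemma ipull_form0 f : ipull (form0 f) = form0 f.
Proof. exact: fpull_form0. Qed.

(* [mu] is the second component of the differential of [(X, nu)], tested against
   the 1-forms on [L]. *)
Definition is_differential (d : int) (X : OmA -> OmA) (nu mu : Aform P L) : Prop :=
  forall w, homog 1 w -> iota_form mu w =
    dA (iota_form nu w) - signed (odd (absz d)) (X (ipull w))
    + signed (odd (absz d)) (iota_form nu (dL w)).

Lemma is_differential_uniq d X nu mu mu' : is_differential d X nu mu -> is_differential d X nu mu' -> mu = mu'.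
Proof.
move=> b b'; apply: form_sep => w hw s.
by rewrite -!(iota_one _ _ hw) b // b'.
Qed.

(** The Lie derivative along [nu], that is, the graded commutator of [iota_form nu] with the
    differentials of [L] and [A]. *)
Lemma lieder_gder d nu : homog d nu -> gder ipull (odd (absz d))
  (fun w => iota_form nu (dL w) + signed (odd (absz d)) (dA (iota_form nu w))).
Proof.
move=> hn; have := gder_comm (b' := true) (fpull_feps i_) ipull_dL (iota_gder hn) dL_gder dA_gder.
rewrite addbT negbK andbT.
congr (gder _ _ _); apply/funext => w.
by case: (odd _) => //=; rewrite opprK.
Qed.

Lemma derivation_ipullE d X nu mu : homog d nu -> homog (d + 1) mu -> gder id (odd (absz d)) X ->
  (forall f, X (form0 f) = iota_form nu (dL (form0 f))) -> is_differential d X nu mu ->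
  forall w, X (ipull w) = iota_form nu (dL w) +
    signed (odd (absz d)) (dA (iota_form nu w) - iota_form mu w).
Proof.
move=> hn hm gX X0 br w.
have gm : gder ipull (odd (absz d)) (fun w => signed (~~ odd (absz d)) (iota_form mu w)).
  apply: gder_signed; have := iota_gder hm.
  by rewrite odd_abszD addbT negbK.
have E := gder_ext (fpull_gder i_ gX) (gder_add (lieder_gder hn) gm).
rewrite signedD signedN.
have -> x : - signed (odd (absz d)) x = signed (~~ odd (absz d)) x :> OmA.
  by case: (odd _) => //=; rewrite opprK.
rewrite addrA; apply: E => [f|f|w' hw'].
- exact: ipull_form0.
- rewrite fpull_form0 X0 !iota_form0 (gd_0 dA_gder) !signed0 !addr0.
  by [].
rewrite br //; case: (odd _) => /=; rewrite ?opprD ?opprK; zmod.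
Qed.

(** The expression to be represented extends to a derivation along [ipull] that vanishes on
    functions by the anchor condition; it is thus function-linear on 1-forms and reflexivity
    applies. *)
Lemma is_differential_exists d X nu : homog d nu -> gder id (odd (absz d)) X ->
  (forall k w, homog k w -> homog (k + d) (X w)) ->
  (forall f, X (form0 f) = iota_form nu (dL (form0 f))) ->
  exists2 mu, is_differential d X nu mu & homog (d + 1) mu.
Proof.
move=> hn gX degX X0.
pose Psi (w : OmL) := dA (iota_form nu w) - signed (odd (absz d)) (X (ipull w))
    + signed (odd (absz d)) (iota_form nu (dL w)).
have gG := gder_signed (odd (absz d)) (gder_add (lieder_gder hn)
  (gder_signed true (fpull_gder i_ gX))).
set G := (fun w => signed _ _) in gG.
have PsiE w : Psi w = G w.
  rewrite /Psi /G /ipull; case: (odd _) => /=; rewrite ?opprD ?opprK; zmod.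
have G0 f : G (form0 f) = 0.
  rewrite /G /= iota_form0 (gd_0 dA_gder) signed0 addr0.
  by rewrite -[fpull i_ (form0 f)]/(ipull _) ipull_form0 X0 subrr signed0.
have [w w'|f w hw|mu muP] := sections_dual_reflexive (Psi := Psi).
- by rewrite !PsiE (gd_D gG).
- by rewrite !PsiE (gd_M gG) G0 wedge0l add0r ipull_form0 fepsb_form0.
exists mu.
  by move=> w hw; apply: form_ext => s; rewrite iota_one // muP.
have hPsi w : homog 1 w -> homog (d + 1) (Psi w).
  move=> hw; apply: homogD; last first.
    apply: homog_signed; rewrite (_ : d + 1 = d + (1 + 1 - 1)); last by lia.
    by apply: iota_homog => //; exact: dL_homog.
  apply: homogD.
    apply: dA_homog; rewrite -[X in homog X]addr0 -(subrr 1); exact: iota_homog.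
  by apply/homogN/homog_signed; rewrite addrC; apply: degX; exact: fpull_homog.
move=> s sd; apply: vsection_ext => m; apply: section_sep => w hw.
rewrite muP // hPsi //.
by rewrite (@mlin0 _ _ _ w [::] [::] (form_mlin w)).
Qed.

End Contraction.

(** * Comparison with the bracket formula *)

Section Locality.
Context {R : realType} {M : manifold R} {g : ground}.
Local Notation Cinf := (smoothfun M g).

Lemma wedge_at {V : lmodType Cinf} (f f' w w' : form V Cinf^o) m :
  (forall t, (f t : Cinf) m = (f' t : Cinf) m) -> (forall t, (w t : Cinf) m = (w' t : Cinf) m) ->
  forall s, (wedge f w s : Cinf) m = (wedge f' w' s : Cinf) m.
Proof.
suff H (F F' G G' : seq V -> Cinf^o) s : (forall t, (F t : Cinf) m = (F' t : Cinf) m) ->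
    (forall t, (G t : Cinf) m = (G' t : Cinf) m) ->
    (wedge_fun F G s : Cinf) m = (wedge_fun F' G' s : Cinf) m.
  by move=> Hf Hw s; exact: H.
elim: s F F' G G' => [|a s IH] F F' G G' HF HG.
  by rewrite /= -[LHS]/((F [::] : Cinf) m * (G [::] : Cinf) m) -[RHS]/((F' [::] : Cinf) m * (G' [::] : Cinf) m) HF HG.
rewrite !wedge_fun_cons !sfD (IH _ (con a F') _ G') //; last by move=> t; exact: HF.
congr (_ + _); apply: IH => t; last exact: HG.
rewrite -[LHS]/(((-1) ^+ size t : Cinf) m * (F t : Cinf) m) HF.
by [].
Qed.

(** With psi equal to 1 at m, an algebraic substitute for vanishing near m that derivations can
    exploit. *)
Definition killed {V W : lmodType Cinf} (psi : Cinf) (w : form V W) : Prop :=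
  forall s, psi *: w s = 0.

Lemma cutoff (V : lmodType Cinf) (E : vbundle M g) (nu nu' : form V (vsection E)) m :
  (\forall m' \near m, forall s, nu s m' = nu' s m') ->
  exists psi : Cinf, psi m = 1 /\ killed psi (nu - nu').
Proof.
move=> /near_open [N [oN Nm NP]].
have [psi [C [psi1 Cc CN psi0]]] := kbump (g := g) oN Nm.
exists psi; split; first exact: nbhs_singleton psi1.
move=> s; apply: vsection_ext => m'; rewrite vsectionZE formDE formNE vsectionDE.
have [Nm'|Nm'] := pselect (N m'); last by rewrite psi0 ?scale0r // => /CN.
rewrite (NP _ Nm') -[(- nu' s) m']/(-1 *: nu' s m' + 0) addr0 scaleN1r subrr scaler0.
by [].
Qed.

Lemma killed_at {V : lmodType Cinf} (psi : Cinf) (m : M) (w : form V Cinf^o) : psi m = 1 ->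
  killed psi w -> forall s, (w s : Cinf) m = 0.
Proof.
move=> p1 kw s; have := congr1 (fun f : Cinf => f m) (kw s).
by rewrite -[psi *: w s]/(psi * (w s : Cinf)) sfM p1 mul1r.
Qed.

(** Expand 0 = D(psi w): at m the term containing w vanishes and the other one is D w. *)
Lemma killed_gder {V : lmodType Cinf} b (D : form V Cinf^o -> form V Cinf^o) (psi : Cinf) (m : M) w :
  gder id b D -> psi m = 1 -> killed psi w -> forall s, (D w s : Cinf) m = 0.
Proof.
move=> gD p1 kw s.
have : D (wedge (form0 (psi : Cinf^o)) w) = 0.
  rewrite (_ : wedge _ w = 0) ?(gd_0 gD) //.
  by apply: form_ext => t; rewrite wedge_form0 kw.
rewrite (gd_M gD) fepsb_form0 => /(congr1 (fun F : form V Cinf^o => (F s : Cinf) m)).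
rewrite formDE sfD (wedge_at (f' := D (form0 (psi : Cinf^o))) (w' := 0)) //; last first.
  by move=> t; rewrite (killed_at p1 kw).
rewrite wedge0r wedge_form0 => E.
have {}E : (0 : scalars R g) + psi m * (D w s : Cinf) m = 0 := E.
by move: E; rewrite add0r p1 mul1r.
Qed.

Lemma form_sub_at {V : lmodType Cinf} (F G : form V Cinf^o) t m :
  ((F - G) t : Cinf) m = (F t : Cinf) m - (G t : Cinf) m.
Proof. by rewrite formDE formNE sfD sfN. Qed.

Lemma gder_at {V : lmodType Cinf} b (D : form V Cinf^o -> form V Cinf^o) (psi : Cinf) (m : M) w w' :
  gder id b D -> psi m = 1 -> killed psi (w - w') ->
  forall s, (D w s : Cinf) m = (D w' s : Cinf) m.
Proof.
move=> gD p1 kw s; have := killed_gder gD p1 kw s.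
by rewrite (gd_D gD) (gd_N _ gD) form_sub_at => /eqP; rewrite subr_eq0 => /eqP.
Qed.

Lemma killedMl {V W : lmodType Cinf} (psi psi' : Cinf) (w : form V W) :
  killed psi w -> killed (psi * psi') w.
Proof. by move=> kw s; rewrite mulrC -scalerA kw scaler0. Qed.

Lemma killedMr {V W : lmodType Cinf} (psi psi' : Cinf) (w : form V W) :
  killed psi w -> killed (psi' * psi) w.
Proof. by move=> kw s; rewrite -scalerA kw scaler0. Qed.

Lemma killed_fpwedge {V W : lmodType Cinf} (psi : Cinf) (D : W -> form V Cinf^o)
    (Dl : Dlin (fun v => form_val (D v))) nu :
  killed psi nu -> killed psi (fpwedge Dl nu).
Proof.
move=> kn s; rewrite /= -pwedgeZ // -[RHS](pwedge0 s Dl).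
by apply: eq_pwedge => // t; exact: kn.
Qed.

End Locality.

Section BracketForm.
Context {R : realType} {M : manifold R} {g : ground} (P : lie_pair M g).
Local Notation Cinf := (smoothfun M g).
Local Notation A := (lp_A P).
Local Notation L := (lp_L P).
Local Notation i_ := (smap (lp_i P)).
Local Notation OmA := (form (vsection A) Cinf^o).
Local Notation OmL := (form (vsection L) Cinf^o).

Lemma ipull_iota w : homog 1 w -> ipull w = iota_form (form1 i_ : Aform P L) w.
Proof.
move=> hw; have w0 : w [:: 0] = 0 by exact: (@mlin0 _ _ _ w [::] [::] (form_mlin w)).
apply: form_ext => s; rewrite iota_one // fpullE; case: s => [|a [|b s]] //=.
  by rewrite w0 hw.
by rewrite w0 hw.
Qed.

Lemma iota_sum_killed (psi : Cinf) nu n (xi : 'I_n -> OmA) l w : homog 1 w ->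
  killed psi (nu - \sum_(k < n) tens (xi k) (l k) : Aform P L) ->
  killed psi (iota_form nu w - \sum_(k < n) wedge (form0 (w [:: l k])) (xi k)).
Proof.
move=> hw kn s; have := killed_fpwedge (insl_lin w) kn s.
rewrite (_ : fpwedge _ _ = iota_form nu w - \sum_(k < n) wedge (form0 (w [:: l k])) (xi k)) //.
rewrite -[LHS]/(iota_form _ w) iota_nuD; congr (_ + _).
apply: form_ext => t; rewrite iota_one // !formNE !form_sumE.
have [h ->] := form1P hw; rewrite /= linearN linear_sum; congr (- _).
by apply: eq_bigr => k _; rewrite linearZ wedge_const; exact: mulrC.
Qed.

Section PbSection.
Variables (d : int) (x : pbpair P).
Hypothesis px : pb_section d x.

Lemma pb_gder : gder id (odd (absz d)) x.1.
Proof. by case: px => dx _ _; exact: derivation_gder. Qed.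

Lemma pb_deg k w : homog k w -> homog (k + d) (x.1 w).
Proof. by case: px => -[H _ _] _ _; exact: H. Qed.

Lemma pb_homog : homog d x.2. Proof. by case: px. Qed.

Lemma iota_dL_form0 (nu : Aform P L) (f : Cinf) s :
  iota_form nu (dL (form0 (f : Cinf^o))) s = anchor (nu s) f.
Proof.
have h1 : homog 1 (dL (form0 (f : Cinf^o)) : OmL).
  by rewrite -[1]add0r; apply: dL_homog; exact: homog_form0.
by rewrite iota_one // dL_form0.
Qed.

Lemma pb_anchor f : x.1 (form0 f) = iota_form x.2 (dL (form0 f)).
Proof.
by apply: form_ext => s; rewrite iota_dL_form0; case: px => _ _ H; exact: H.
Qed.

(** Both sides are tested at m against 1-forms on [L]. Expanding the three terms of
    [is_differential] in the decompositions, all derivatives of values of w cancel and only the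
    brackets remain. *)
Lemma is_differential_bracket_form mu : is_differential d x.1 x.2 mu ->
  pb_bracket_form 1 d (@pb_s _ _ _ P) x mu.
Proof.
move=> br m n xi l n' xi' l' [hxi dec] [hxi' dec'] s.
have [psi1 [p1 k1]] := cutoff dec.
have [psi2 [p2 k2]] := cutoff dec'.
(* One cutoff serves for both decompositions. *)
pose psi := psi1 * psi2.
have pm : psi m = 1 by rewrite sfM p1 p2 mulr1.
have {}k1 := killedMl psi2 k1; have {}k2 := killedMr psi1 k2.
have gX := pb_gder; have gA := @dA_gder _ _ _ P.
pose b := odd (absz d).
have ip w : homog 1 w -> killed psi (ipull w - \sum_(k < n) wedge (form0 (w [:: l k])) (xi k)).
  by move=> hw; rewrite ipull_iota //; exact: iota_sum_killed.
have io w : homog 1 w -> killed psi (iota_form x.2 w - \sum_(k < n') wedge (form0 (w [:: l' k])) (xi' k)).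
  by move=> hw; exact: iota_sum_killed.
have at_eq (F G : OmA) : killed psi (F - G) -> forall t, (F t : Cinf) m = (G t : Cinf) m.
  move=> k t; have := killed_at pm k t.
  by rewrite form_sub_at => /eqP; rewrite subr_eq0 => /eqP.
have h0 (f : Cinf) : homog 1 (dL (form0 (f : Cinf^o)) : OmL).
  by rewrite -[1]add0r; apply: dL_homog; exact: homog_form0.
pose W k j := (wedge (xi k) (xi' j) s : Cinf) m.
(* [xi k] has degree 1 and [xi' j] degree d, so exchanging them costs (-1)^d. *)
have xx k j : wedge (xi' j) (xi k) = signed b (wedge (xi k) (xi' j)).
  rewrite (wedgeC (xi' j) (n := 1)) /=; last exact: hxi.
  by rewrite (feps_homog (hxi' j)) wedge_signedl signedK.
have sat (c : bool) (F : OmA) : (signed c F s : Cinf) m = signed c ((F s : Cinf) m).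
  by case: c => //=; rewrite formNE sfN.
apply: section_sep => w hw; rewrite -iota_one // br //.
(* The differential of f on [A] is pulled back from [L], and the inclusion is decomposed as the sum
   of the xi k (x) l k. *)
have dAf (f : Cinf) j : (wedge (dA (form0 (f : Cinf^o) : OmA)) (xi' j) s : Cinf) m =
    \sum_(k < n) (anchor (l k) f) m * W k j.
  rewrite -(@ipull_form0 _ _ _ P f) -ipull_dL.
  rewrite (wedge_at (w' := xi' j) (at_eq _ _ (ip _ (h0 f)))) //.
  rewrite wedge_suml form_sumE sf_sum; apply: eq_bigr => k _.
  by rewrite wedgeA wedge_form0 dL_form0.
have Xf (f : Cinf) k : (wedge (x.1 (form0 (f : Cinf^o))) (xi k) s : Cinf) m =
    \sum_(j < n') (anchor (l' j) f) m * signed b (W k j).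
  rewrite pb_anchor.
  rewrite (wedge_at (w' := xi k) (at_eq _ _ (io _ (h0 f)))) //.
  rewrite wedge_suml form_sumE sf_sum; apply: eq_bigr => j _.
  rewrite wedgeA wedge_form0 xx dL_form0 -sat.
  by [].
have E1 : (dA (iota_form x.2 w) s : Cinf) m = \sum_(j < n')
    (\sum_(k < n) (anchor (l k) (w [:: l' j])) m * W k j +
     (w [:: l' j] : Cinf) m * (dA (xi' j) s : Cinf) m).
  rewrite [LHS](gder_at gA pm (io w hw) s) (gd_sum _ _ _ gA) form_sumE sf_sum.
  apply: eq_bigr => j _; rewrite (gd_M gA) formDE sfD fepsb_form0 -dAf; congr (_ + _).
  by rewrite wedge_form0.
have E2 : (x.1 (ipull w) s : Cinf) m = \sum_(k < n)
    (\sum_(j < n') (anchor (l' j) (w [:: l k])) m * signed b (W k j) +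
     (w [:: l k] : Cinf) m * (x.1 (xi k) s : Cinf) m).
  rewrite [LHS](gder_at gX pm (ip w hw) s) (gd_sum _ _ _ gX) form_sumE sf_sum.
  apply: eq_bigr => j _; rewrite (gd_M gX) formDE sfD fepsb_form0 -Xf; congr (_ + _).
  by rewrite wedge_form0.
have E3 : (iota_form x.2 (dL w) s : Cinf) m = \sum_(j < n') \sum_(k < n)
    (dL w [:: l' j; l k] : Cinf) m * signed b (W k j).
  have := killed_at pm (killed_fpwedge (insl_lin (dL w)) k2) s.
  rewrite fpwedgeD => /eqP; rewrite formDE sfD addr_eq0 => /eqP ->.
  have -> F : (fpwedge (insl_lin (dL w)) (- F) : OmA) = - fpwedge (insl_lin (dL w)) F.
    by apply: form_ext => t; apply: pwedgeN; exact: insl_lin.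
  rewrite formNE sfN opprK fpwedge_sum form_sumE sf_sum; apply: eq_bigr => j _.
  rewrite fpwedge_tens.
  have hl : homog 1 (iprod (l' j) (dL w)).
    by move=> t ht; apply: (dL_homog hw) => E; apply: ht; move: E => /=; lia.
  rewrite (wedge_at (f' := xi' j) (fun _ => erefl) (at_eq _ _ (ip _ hl))).
  rewrite wedge_sumr form_sumE sf_sum; apply: eq_bigr => k _.
  have -> (c : Cinf^o) : wedge (xi' j) (wedge (form0 c) (xi k)) = wedge (form0 c) (wedge (xi' j) (xi k)).
    rewrite -!wedgeA; congr (wedge _ _); symmetry.
    exact: (wedgeC (n := 0) (xi' j) (homog_form0 c)).
  by rewrite wedge_form0 xx -sat.
have [h wh] := form1P hw.
have hD u v : h (u + v) = h u + h v by exact: linearD.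
have hZ (c : Cinf) v : h (c *: v) = c *: h v by exact: linearZ.
have hN v : h (- v) = - h v by exact: linearN.
have hs I (r : seq I) (F : I -> vsection L) : h (\sum_(i <- r) F i) = \sum_(i <- r) h (F i).
  by exact: linear_sum.
have wE v : w [:: v] = h v by rewrite wh.
rewrite [RHS](_ : _ = \sum_(j < n') (w [:: l' j] : Cinf) m * (dA (xi' j) s : Cinf) m
  - signed b (\sum_(k < n) (w [:: l k] : Cinf) m * (x.1 (xi k) s : Cinf) m)
  + \sum_(j < n') \sum_(k < n) (w [:: lbr (l k) (l' j)] : Cinf) m * W k j); last first.
  rewrite wE mul1r mulrz_sg !formDE formNE signedE !hD hN.
  have -> v : h (signed b v) = signed b (h v) by case: (b); rewrite /= ?hN.
  rewrite !form_sumE !hs !sfD; congr (_ + _ + _).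
  - by rewrite sf_sum; apply: eq_bigr => j _; rewrite hZ wE mulrC.
  - have -> (f : Cinf) : (- signed b f) m = - signed b (f m) by case: (b).
    congr (- signed _ _).
    by rewrite sf_sum; apply: eq_bigr => j _; rewrite hZ wE mulrC.
  rewrite sf_sum exchange_big; apply: eq_bigr => k _.
  rewrite form_sumE hs sf_sum; apply: eq_bigr => j _.
  by rewrite hZ wE mulrC.
rewrite formDE.
rewrite sfD.
rewrite form_sub_at -/b.
rewrite (sat b (x.1 (ipull w))) (sat b (iota_form x.2 (dL w))).
rewrite [X in X - _ + _]E1 [X in _ - signed b X + _]E2 [X in _ + signed b X]E3.
rewrite !big_split /= signedD.
have dLw j k : (dL w [:: l' j; l k] : Cinf) m = (anchor (l' j) (w [:: l k])) m
    - (anchor (l k) (w [:: l' j])) m + (w [:: lbr (l k) (l' j)] : Cinf) m.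
  by rewrite dL_one // (lbr_antisym (l' j)) !wE hN opprK.
set Bs := \sum_(j < n') (w [:: l' j] : Cinf) m * _.
set Ds := \sum_(k < n) (w [:: l k] : Cinf) m * _.
(* What is left after cancelling the terms [Bs] and [Ds]; the anchor terms of [dLw] absorb the first
   two sums. *)
suff E4 : \sum_(j < n') \sum_(k < n) (anchor (l k) (w [:: l' j])) m * W k j
    - signed b (\sum_(k < n) \sum_(j < n') (anchor (l' j) (w [:: l k])) m * signed b (W k j))
    + signed b (\sum_(j < n') \sum_(k < n) (dL w [:: l' j; l k] : Cinf) m * signed b (W k j))
    = \sum_(j < n') \sum_(k < n) (w [:: lbr (l k) (l' j)] : Cinf) m * W k j.
  by rewrite -E4; zmod.
have ssum (F : 'I_n' -> 'I_n -> scalars R g) :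
    signed b (\sum_(j < n') \sum_(k < n) F j k) = \sum_(j < n') \sum_(k < n) signed b (F j k).
  by case: (b) => //=; rewrite -sumrN; apply: eq_bigr => j _; rewrite sumrN.
rewrite [in X in _ - signed b X]exchange_big /= !ssum -sumrN -!big_split.
apply: eq_bigr => j _; rewrite -sumrN -!big_split; apply: eq_bigr => k _ /=.
by rewrite dLw; case: (b) => /=; ring.
Qed.

End PbSection.

Lemma decomp_exists (E : vbundle M g) d (nu : Aform P E) m : homog d nu ->
  exists n xi l, @decomp_near _ _ _ P E m nu n (fun=> d) xi l.
Proof.
move=> hn; have [u [th [e [u1 ue]]]] := frame_at E m.
exists (vrank E), (fun k => form_map (th k) nu), e; split.
  by move=> k s sd; rewrite /= hn // linear0.
apply: filterS u1 => m' um s; rewrite form_sumE -[LHS]scale1r -um -vsectionZE ue.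
by [].
Qed.

Lemma bracket_form_uniq d x mu mu' : pb_section d x ->
  pb_bracket_form 1 d (@pb_s _ _ _ P) x mu ->
  pb_bracket_form 1 d (@pb_s _ _ _ P) x mu' -> mu = mu'.
Proof.
move=> px b b'; apply: form_ext => s; apply: vsection_ext => m.
have [n [xi [l D1]]] := decomp_exists m (homog_form1 i_ : homog 1 (form1 i_ : Aform P L)).
have [n' [xi' [l' D2]]] := decomp_exists m (pb_homog px).
by rewrite (b _ _ _ _ _ _ _ D1 D2) (b' _ _ _ _ _ _ _ D1 D2).
Qed.

(** The form constructed by reflexivity satisfies the bracket formula, which has at most one
    solution; so [xget] returns this form. *)
Lemma pb_Q_spec d x : pb_section d x ->
  [/\ is_differential d x.1 x.2 (pb_Q d x).2, homog (d + 1) (pb_Q d x).2 &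
      pb_bracket_form 1 d (@pb_s _ _ _ P) x (pb_Q d x).2].
Proof.
move=> px.
have [mu br hm] := is_differential_exists (pb_homog px) (pb_gder px) (pb_deg px) (pb_anchor px).
have bf := is_differential_bracket_form px br.
have bQ : pb_bracket_form 1 d (@pb_s _ _ _ P) x (pb_Q d x).2.
  exact: (@xgetPex _ 0 [set mu | pb_bracket_form 1 d (@pb_s _ _ _ P) x mu] (ex_intro _ mu bf)).
have -> : (pb_Q d x).2 = mu by exact: bracket_form_uniq bQ bf.
by [].
Qed.

Lemma pb_Q_eq d x mu : pb_section d x -> is_differential d x.1 x.2 mu -> (@pb_Q _ _ _ P d x).2 = mu.
Proof. by move=> px br; have [br' _ _] := pb_Q_spec px; exact: is_differential_uniq br' br. Qed.

End BracketForm.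

(** * The operators of the contraction *)

Section RawComplements.
Context {S : comPzRingType} {V : lmodType S}.

Lemma lie_lin {W : lmodType S} (d1 d2 d3 : W -> W) (t1 t2 t3 : V -> V) c (w : seq V -> W) s :
  (forall x, d3 x = c *: d1 x + d2 x) -> (forall a, t3 a = c *: t1 a + t2 a) -> mlin w ->
  lie d3 t3 w s = c *: lie d1 t1 w s + lie d2 t2 w s.
Proof.
move=> D3 T3; elim: s w => [|a s IH] w wl; first exact: D3.
rewrite !lie_cons IH; last exact: mlin_con.
by rewrite T3 (wl [::] s) scalerBr; zmod.
Qed.

Lemma pwedge_map {W W' U : lmodType S} (h : {linear W -> W'}) (D : W' -> seq V -> U)
    (nu : seq V -> W) s :
  pwedge D (fun t => h (nu t)) s = pwedge (fun v => D (h v)) nu s.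
Proof.
elim: s D nu => [|a s IH] D nu //; rewrite !pwedge_cons -(IH D (con a nu)).
rewrite -(IH (fun v => con a (D v)) (eps nu)); congr (_ + _).
by apply: eq_pwedge => // t; rewrite /eps linearZ.
Qed.

Lemma wedge_map {W W' : lmodType S} (h : {linear W -> W'}) (f : seq V -> S^o)
    (w : seq V -> W) s :
  h (wedge_fun f w s) = wedge_fun f (fun t => h (w t)) s.
Proof.
elim: s f w => [|a s IH] f w; first exact: linearZ.
by rewrite !wedge_fun_cons linearD !IH.
Qed.

Lemma form_map_wedge {W W' : lmodType S} (h : {linear W -> W'}) (f : form V S^o) (w : form V W) :
  form_map h (wedge f w) = wedge f (form_map h w).
Proof. by apply: form_ext => s; exact: wedge_map. Qed.

Lemma form_mapD {W W' : lmodType S} (h : {linear W -> W'}) (w w' : form V W) :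
  form_map h (w + w') = form_map h w + form_map h w'.
Proof. by apply: form_ext => s; exact: linearD. Qed.

Lemma form_map_homog {W W' : lmodType S} (h : {linear W -> W'}) d (w : form V W) :
  homog d w -> homog d (form_map h w).
Proof. by move=> hw s sd; rewrite /= hw ?linear0. Qed.

Variables (rho : V -> S -> S) (br : V -> V -> V).
Hypothesis FR0 : @flat_rep _ _ rho br S^o rho.

(* The failure of [zeta] to be parallel, as a 1-form. *)
Definition conn_defect {B : lmodType S} (nabla : V -> B -> B) (zeta : B -> S^o)
    (b : B) (t : seq V) : S^o :=
  if t is [:: a] then zeta (nabla a b) - (rho a (zeta b) : S^o) else 0.

Lemma conn_defect_lin {B : lmodType S} (nabla : V -> B -> B) (zeta : {linear B -> S^o}) :
  flat_rep rho br nabla -> Dlin (conn_defect nabla zeta).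
Proof.
move=> FR c u v [|a [|a' t]]; rewrite /conn_defect ?scaler0 ?addr0 //.
have rZ := fr_Z FR0 a; have rD := fr_D FR0 a.
have zD x y : zeta (x + y) = zeta x + zeta y by exact: linearD.
have zZ f x : zeta (f *: x) = f *: zeta x by exact: linearZ.
by rewrite (fr_D FR) (fr_Z FR) !(zD, zZ) rD rZ scalerBr; zmod.
Qed.

Lemma lie_defect {B : lmodType S} (delta : B -> B) (delta0 : S^o -> S^o) tau
    (zeta : {linear B -> S^o}) (beta : seq V -> B) s :
  zeta (lie delta tau beta s) - lie delta0 tau (fun t => zeta (beta t)) s =
  zeta (delta (beta s)) - delta0 (zeta (beta s)).
Proof.
elim: s beta => [|a s IH] beta //; rewrite !lie_cons linearB.
by rewrite -[RHS](IH (con a beta)) /con; zmod.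
Qed.

(** Reduces a vector-valued differential to scalar ones. The defect 1-form is wedged on the right of
    [beta], hence the parity operator. *)
Lemma kz_defect {B : lmodType S} (nabla : V -> B -> B) (zeta : {linear B -> S^o})
    (beta : seq V -> B) s : flat_rep rho br nabla ->
  zeta (kz br nabla beta s) =
  kz br (rho : V -> S^o -> S^o) (fun t => zeta (beta t)) s +
  pwedge (conn_defect nabla zeta) (eps beta) s.
Proof.
move=> FR; have cl := conn_defect_lin zeta FR.
elim: s beta => [|a s IH] beta; first by rewrite /= linear0 addr0.
rewrite !kz_cons linearB IH pwedge_cons epsK.
rewrite (@eq_pwedge _ _ _ _ (conn_defect nabla zeta) (conn_defect nabla zeta)
  (con a (eps beta)) (fun t => - eps (con a beta) t)) //; last by move=> t; rewrite eps_con.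
rewrite pwedgeN // (@eq_pwedge _ _ _ _ (fun v => con a (conn_defect nabla zeta v))
  (fun v t => if t is [::] then zeta (nabla a v) - (rho a (zeta v) : S^o) else 0) beta beta) //.
rewrite (pwedge_form0 (fun v => zeta (nabla a v) - (rho a (zeta v) : S^o))).
have := lie_defect (nabla a) (rho a) (br a) zeta beta s.
move=> /(canRL (subrK _)) ->; rewrite /con; zmod.
Qed.

End RawComplements.

Section Operators.
Context {R : realType} {M : manifold R} {g : ground}.
Variables (P : lie_pair M g).
Local Notation Cinf := (smoothfun M g).
Local Notation A := (lp_A P).
Local Notation L := (lp_L P).
Local Notation OmA := (form (vsection A) Cinf^o).

(** [fpwedge] meets the specification in [op_sum], and a decomposition near each point makes the
    solution unique. When [c] is set, as for [H0], the sign (-1)^deg is moved from the operator onto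
    the form. *)
Lemma op_sumE (E : vbundle M g) (D : int -> vsection E -> Afun P -> Afun P) (c : bool)
    (D' : vsection E -> Afun P -> Afun P) (Dl : forall w, Dlin (fun v => form_val (D' v w)))
    d (nu : Aform P E) :
  (forall k v w, D k v w = signed (c && odd (absz k)) (D' v w)) -> homog d nu ->
  op_sum D nu = fun w => fpwedge (Dl w) (fepsb c nu).
Proof.
move=> DE hn; pose Y w : Afun P := fpwedge (Dl w) (fepsb c nu).
pose spec (Y : Afun P -> Afun P) := forall m n deg xi v,
    @decomp_near _ _ _ P E m nu n deg xi v ->
    forall w s, (Y w s : Cinf) m =
      ((\sum_(k < n) wedge (xi k) (D (deg k) (v k) w) : Afun P) s : Cinf) m.
have specY : spec Y.
  move=> m n deg xi v [hxi dec] w s.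
  have [psi [p1 kn]] := cutoff dec.
  have kn' : killed psi (fepsb c nu - \sum_(k < n) tens (fepsb c (xi k)) (v k)).
    case: (c) => // t.
    have -> : (fepsb true nu - \sum_(k < n) tens (fepsb true (xi k)) (v k)) t =
        (-1) ^+ size t *: (nu - \sum_(k < n) tens (xi k) (v k)) t.
      rewrite !formDE !formNE !form_sumE scalerDr scalerN scaler_sumr.
      by congr (_ - _); apply: eq_bigr => k _; rewrite [RHS]scalerA.
    by rewrite scalerA mulrC -scalerA kn scaler0.
  have := killed_at p1 (killed_fpwedge (Dl w) kn') s.
  rewrite fpwedgeD.
  have -> F : fpwedge (Dl w) (- F) = - fpwedge (Dl w) F :> OmA.
    by apply: form_ext => t; apply: pwedgeN; exact: Dl.
  rewrite form_sub_at => /eqP; rewrite subr_eq0 => /eqP ->.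
  rewrite fpwedge_sum (eq_bigr (fun k => wedge (xi k) (D (deg k) (v k) w))) // => k _.
  rewrite fpwedge_tens DE wedge_signedr -wedge_signedl; congr (wedge _ _).
  by case: (c) => //=; exact: feps_homog.
have specO : spec (op_sum D nu).
  exact: (@xgetPex _ 0 [set Y | spec Y] (ex_intro _ Y specY)).
apply/funext => w; apply: form_ext => s; apply: sf_ext => m.
have [n [xi [l D1]]] := decomp_exists m hn.
by rewrite (specO _ _ _ _ _ D1) (specY _ _ _ _ _ D1).
Qed.

Variable (S : splitting P).
Local Notation B := (sp_B S).
Local Notation i_ := (smap (lp_i P)).
Local Notation q_ := (smap (sp_q S)).
Local Notation j_ := (smap (sp_j S)).
Local Notation p_ := (smap (sp_p S)).

Definition tau (b : vsection B) (a : vsection A) : vsection A := p_ (lbr (j_ b) (i_ a)).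

Lemma tauP b c a a' : tau b (c *: a + a') = c *: tau b a + anchor (j_ b) c *: a + tau b a'.
Proof.
rewrite /tau !(smapD, smapZ) (lr_brP (algebroid_lie_rinehart L)).
by rewrite !(smapD, smapZ) sm_pi.
Qed.

Lemma is_form_Delta b (w : OmA) :
  is_form (lie (anchor (j_ b) : Cinf^o -> Cinf^o) (tau b) w).
Proof.
have FR := algebroid_flat_rep L.
apply: mlin_alt_is_form.
  apply: (@lie_mlin _ _ _ _ _ (anchor (j_ b)) (fr_D FR (j_ b)) (fr_Z FR (j_ b)) (@tauP b)).
  exact: form_mlin.
by apply: lie_alt; [exact: fr_D FR (j_ b)|exact: form_mlin|exact: form_alt].
Qed.

Definition Deltaf b (w : OmA) : OmA := Form (is_form_Delta b w).

Lemma Deltaf_form0 b (f : Cinf) : Deltaf b (form0 (f : Cinf^o)) = form0 (anchor (j_ b) f : Cinf^o).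
Proof.
apply: form_ext => -[|a s] //; rewrite /= subr0.
by elim: s => [|a' s IH] /=; [exact: anchor0|rewrite subr0; exact: IH].
Qed.

Lemma Deltaf_gder b : gder id false (Deltaf b).
Proof.
have FR := algebroid_flat_rep L; have rD := fr_D FR (j_ b).
split=> [w w'|w|w w']; apply: form_ext => s.
- exact: lieD.
- by rewrite fepsE -(lie_eps _ rD).
- exact: (lie_wedge _ _ _ _ rD rD (fr_Z FR (j_ b))).
Qed.

Lemma Deltaf_homog b k w : homog k w -> homog k (Deltaf b w).
Proof. by move=> h s; apply: lie_homog => //; exact: anchor0. Qed.

Lemma Deltaf_is_Delta b : is_Delta b (Deltaf b).
Proof.
split=> [|f|xi a hxi].
- apply: gder_derivation; first exact: Deltaf_gder.
    by move=> k w; rewrite addr0; exact: Deltaf_homog.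
  move=> c; rewrite [LHS]Deltaf_form0 anchor_cst.
  by apply: form_ext => -[].
- exact: Deltaf_form0.
- by [].
Qed.

(** The Lie derivative [Deltaf] satisfies [is_Delta], whose conditions on functions and 1-forms
    determine a derivation. *)
Lemma DeltaE b : Delta b = Deltaf b.
Proof.
have H := Deltaf_is_Delta b.
have [der f1 x1] : is_Delta b (Delta b).
  exact: (@xgetPex _ 0 [set D | is_Delta b D] (ex_intro _ _ H)).
have [_ f2 x2] := H.
apply/funext => w; apply: (gder_ext (derivation_gder der) (Deltaf_gder b)) => // [f|w' h].
  by rewrite [LHS]f1 [RHS]f2.
apply: homog1_ext => [||a]; [|exact: Deltaf_homog|by rewrite x1 // x2].
by have [deg _ _] := der; rewrite -[1]addr0; exact: deg.
Qed.

(** The non-linear term of [j(c b), i(a)] is a multiple of j(b), which [p] kills. *)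
Lemma Delta_lin w : Dlin (fun b => form_val (Delta (S := S) b w)).
Proof.
move=> c u v s; rewrite !DeltaE; apply: lie_lin; last exact: form_mlin.
  by move=> x; rewrite smapD smapZ; exact: anchor_linear.
move=> a; rewrite /tau !(smapD, smapZ) (lr_Pbr (algebroid_lie_rinehart L)).
by rewrite !(smapD, smapN, smapZ) sm_pj scaler0 subr0.
Qed.

Lemma iprod_lin w : Dlin (fun v => form_val (iprod (p_ v) w : OmA)).
Proof. by move=> c u v s; rewrite /= smapD smapZ; exact: (form_mlin w [::]). Qed.

Lemma I0E d (beta : Aform P B) : homog d beta ->
  I0 beta = (fun w => fpwedge (Delta_lin w) beta, form_map j_ beta).
Proof.
by move=> hb; rewrite /I0; congr (_, _); exact: (op_sumE (c := false) Delta_lin _ hb).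
Qed.

Lemma H0E d (x : pbpair P) : homog d x.2 ->
  H0 S x = (fun w => fpwedge (iprod_lin w) (feps x.2), 0).
Proof.
move=> hx; rewrite /H0; congr (_, _); apply: (op_sumE (c := true) iprod_lin _ hx).
by move=> k v w; rewrite mulrz_sg.
Qed.

Lemma pb_section_I0 d (beta : Aform P B) : homog d beta -> pb_section d (I0 beta).
Proof.
move=> hb; rewrite (I0E hb); split=> /=; last first.
- move=> f s; rewrite -[RHS](pwedge_form0 (fun b => anchor (j_ b) f : Cinf^o) beta s).
  by apply: eq_pwedge => // v t; rewrite DeltaE [Deltaf _ _]Deltaf_form0.
- exact: form_map_homog.
apply: gder_derivation.
- have := pwedge_gder (D := fun b w => Delta (S := S) b w) Delta_lin (homog_absz hb)
    (fun b => eq_ind_r (gder id false) (Deltaf_gder b) (DeltaE b)).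
  by [].
- move=> k w hw; rewrite addrC; apply: fpwedge_homog => // v.
  by rewrite DeltaE; exact: Deltaf_homog.
move=> c; apply: form_ext => s; rewrite /= -[RHS](pwedge_D0 beta s).
by apply: eq_pwedge => // v t; rewrite DeltaE [Deltaf _ _]Deltaf_form0 anchor_cst; case: t.
Qed.

Lemma anchor_sec0 (L' : lie_algebroid M g) f : anchor (0 : vsection L') f = 0.
Proof.
have := anchor_linear (-1) (0 : vsection L') 0 f; rewrite scaler0 addr0 => ->.
by rewrite mulN1r addNr.
Qed.

Lemma pb_section_H0 d (x : pbpair P) : pb_section d x -> pb_section (d - 1) (H0 S x).
Proof.
move=> px; have hx := pb_homog px; rewrite (H0E hx).
have z (c : Cinf) : fpwedge (iprod_lin (form0 (c : Cinf^o))) (feps x.2) = 0.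
  apply: form_ext => s; rewrite /= -[RHS](pwedge_D0 (eps x.2) s).
  exact: eq_pwedge.
split=> /=; last first.
- by move=> f s; rewrite [RHS]anchor_sec0; exact: (congr1 (fun F : OmA => F s) (z f)).
- exact: homog0.
apply: gder_derivation.
- have := pwedge_gder (Phi := id) (b := true) (D := fun v w => iprod (p_ v) w : OmA) iprod_lin
    (homog_absz (homog_feps hx)).
  have -> : odd (absz (d - 1)) = true (+) odd (absz d) by rewrite odd_abszD addbT.
  apply=> v; split=> [w w'|w|w w'].
  - exact: form_ext.
  - by apply: form_ext => s; exact: eps_con.
  - exact: form_ext.
- move=> k w hw; rewrite addrCA; apply: fpwedge_homog; first exact: homog_feps.
  move=> v s sk; apply: hw => /= E; apply: sk; rewrite -E -addn1 PoszD addrK //.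
by move=> c; exact: z.
Qed.

End Operators.

(** * The contraction *)

Section Differential.
Context {R : realType} {M : manifold R} {g : ground} (P : lie_pair M g).
Local Notation Cinf := (smoothfun M g).
Local Notation A := (lp_A P).
Local Notation L := (lp_L P).
Local Notation OmA := (form (vsection A) Cinf^o).
Implicit Types (x y : pbpair P).

Lemma iota_wedge (f : OmA) nu w : iota_form (wedge f nu) w = wedge f (iota_form nu w).
Proof. exact: fpwedge_wedge. Qed.

Lemma dA_Acst c : dA (Acst P c) = 0.
Proof.
apply: form_ext => s; rewrite [LHS]dA_form0.
by case: s => [|a [|b s]] //=; exact: anchor_cst.
Qed.

Lemma pb_Acst d x c : pb_section d x -> x.1 (Acst P c) = 0.
Proof.
by move=> [_ _ H]; apply: form_ext => s; rewrite [LHS]H anchor_cst.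
Qed.

Lemma wedge_Acst_gder b (D : OmA -> OmA) c w : gder id b D -> D (Acst P c) = 0 ->
  D (wedge (Acst P c) w) = wedge (Acst P c) (D w).
Proof. by move=> gD D0; rewrite (gd_M gD) D0 wedge0l add0r [fepsb _ _]fepsb_form0. Qed.

Lemma pb_section0 d : pb_section d (0 : pbpair P).
Proof.
split=> [||f s]; last by rewrite [RHS]anchor_sec0.
- split=> [k w _|c w w'|k w w' _]; first exact: homog0.
  + by apply: form_ext => s; rewrite formDE -[RHS]/(wedge_fun (Acst P c) (fun=> 0) s + 0)
      wedge_fun0r addr0.
  + apply: form_ext => s; rewrite mulrz_sg formDE signedE.
    rewrite -[RHS]/(wedge_fun (fun=> 0) w' s + signed _ (wedge_fun w (fun=> 0) s)).
    by rewrite wedge_fun0l wedge_fun0r signed0 addr0.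
- exact: homog0.
Qed.

Lemma pb_section_lin d c x y : pb_section d x -> pb_section d y ->
  pb_section d (pb_act (Acst P c) x + y).
Proof.
move=> px py; split=> /=.
- apply: gder_derivation.
  + apply: gder_add (pb_gder py); split=> [w w'|w|w w'].
    * by rewrite (gd_D (pb_gder px)) wedgeDr.
    * rewrite (gd_feps (pb_gder px)) wedge_signedr; congr (signed _ _).
      by rewrite -feps_wedge -[feps (Acst P c)]/(fepsb true _) [fepsb _ (Acst _ _)]fepsb_form0.
    * rewrite (gd_M (pb_gder px)) wedgeDr !wedgeA; congr (_ + _).
      rewrite -!wedgeA; congr (wedge _ _).
      exact: (wedgeC (n := 0) _ (homog_form0 _)).
  + move=> k w hw; apply: homogD; last exact: pb_deg py _ _ hw.
    rewrite -[k + d]add0r; apply: homog_wedge; first exact: homog_form0.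
    exact: pb_deg px _ _ hw.
  + move=> c'; rewrite -[LHS]/(wedge (Acst P c) (x.1 (Acst P c')) + y.1 (Acst P c')).
    by rewrite (pb_Acst _ px) (pb_Acst _ py) wedge0r addr0.
- apply: homogD; last exact: pb_homog py.
  rewrite -[d]add0r; apply: homog_wedge; [exact: homog_form0|exact: pb_homog px].
- move=> f s; have [[_ _ Hx] [_ _ Hy]] := (px, py).
  rewrite -[LHS]/(wedge (Acst P c) (x.1 (Afun0 P f)) s + y.1 (Afun0 P f) s).
  have E2 : (pb_act (Acst P c) x + y).2 s = smooth_cst M c *: x.2 s + y.2 s.
    by rewrite -[LHS]/(wedge (Acst P c) x.2 s + y.2 s) wedge_form0.
  by rewrite -[RHS]/(anchor ((pb_act (Acst P c) x + y).2 s) f) E2 anchor_linear wedge_form0 Hx Hy.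
Qed.

Lemma pb_Q1 d x w : (pb_Q d x).1 w = dA (x.1 w) - signed (odd (absz d)) (x.1 (dA w)).
Proof. by rewrite -[LHS]/(dA (x.1 w) - x.1 (dA w) *~ sg (1 * d)) mul1r mulrz_sg. Qed.

(** The anchor condition is [is_differential] tested on the 1-form dL f, where dL^2 = 0 removes the
    last term. *)
Lemma pb_section_Q d x : pb_section d x -> pb_section (d + 1) (pb_Q d x).
Proof.
move=> px; have [br hm _] := pb_Q_spec px; have gX := pb_gder px; have gA := @dA_gder _ _ _ P.
have gQ : gder id (odd (absz (d + 1))) (pb_Q d x).1.
  rewrite odd_abszD addbC.
  have := gder_comm (Phi := id) (fun _ => erefl) (fun _ => erefl) gA gX gX.
  by congr (gder _ _ _); apply/funext => w; rewrite pb_Q1.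
split; last 2 first.
- exact: hm.
- move=> f s; rewrite -iota_dL_form0 br; last first.
    by rewrite -[1]add0r; apply: dL_homog; exact: homog_form0.
  rewrite dL_dL (_ : iota_form x.2 0 = 0); last exact: gd_0 (iota_gder (pb_homog px)).
  by rewrite signed0 addr0 pb_Q1 ipull_dL ipull_form0 (pb_anchor px).
apply: gder_derivation => //.
- move=> k w hw; rewrite pb_Q1; apply: homogD.
    by rewrite addrA; apply/dA_homog/(pb_deg px).
  apply/homogN/homog_signed; rewrite addrA addrAC; exact/(pb_deg px)/dA_homog.
- move=> c; rewrite pb_Q1 (pb_Acst _ px) dA_Acst (gd_0 gA) (gd_0 gX) signed0 subr0.
  by [].
Qed.

Lemma pb_ipullE d x w : pb_section d x ->
  x.1 (ipull w) = iota_form x.2 (dL w) +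
    signed (odd (absz d)) (dA (iota_form x.2 w) - iota_form (pb_Q d x).2 w).
Proof.
move=> px; have [br hm _] := pb_Q_spec px.
exact: (derivation_ipullE (pb_homog px) hm (pb_gder px) (pb_anchor px) br).
Qed.

Lemma pb_Q_Q d x : pb_section d x -> pb_Q (d + 1) (pb_Q d x) = 0.
Proof.
move=> px; have pQ := pb_section_Q px; have gX := pb_gder px; have gA := @dA_gder _ _ _ P.
have b1 : odd (absz (d + 1)) = ~~ odd (absz d) by rewrite odd_abszD addbT.
rewrite [LHS]surjective_pairing; congr (_, _).
  apply/funext => w; rewrite !pb_Q1 b1 dA_dA (gd_D gA) (gd_N _ gA) (gd_signed _ _ gA) !dA_dA.
  rewrite (gd_0 gX) signed0 subr0 -[RHS]/(0 : OmA).
  by case: (odd _) => /=; zmod.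
(* Eliminating [X] by [pb_ipullE] leaves contractions only, and these cancel since both
   differentials square to 0. *)
apply: pb_Q_eq => // w hw; rewrite iota_0 pb_Q1 b1 -ipull_dL !(pb_ipullE _ px) dL_dL.
rewrite (gd_0 (iota_gder (pb_homog px))) (gd_D gA) (gd_signed _ _ gA) (gd_D gA) (gd_N _ gA).
rewrite dA_dA.
by case: (odd _) => /=; zmod.
Qed.

Lemma pb_Q_lin d c x y : pb_section d x -> pb_section d y ->
  pb_Q d (pb_act (Acst P c) x + y) = pb_act (Acst P c) (pb_Q d x) + pb_Q d y.
Proof.
move=> px py; have pl := pb_section_lin c px py; have gA := @dA_gder _ _ _ P.
have [brx _ _] := pb_Q_spec px; have [bry _ _] := pb_Q_spec py.
rewrite [LHS]surjective_pairing; congr (_, _).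
  apply/funext => w; rewrite pb_Q1.
  rewrite -[RHS]/(wedge (Acst P c) ((pb_Q d x).1 w) + (pb_Q d y).1 w) !pb_Q1.
  have -> : (pb_act (Acst P c) x + y).1 w = wedge (Acst P c) (x.1 w) + y.1 w by [].
  have -> : (pb_act (Acst P c) x + y).1 (dA w) = wedge (Acst P c) (x.1 (dA w)) + y.1 (dA w) by [].
  rewrite (gd_D gA) (wedge_Acst_gder _ gA (dA_Acst c)) wedgeDr wedgeNr wedge_signedr signedD.
  by zmod.
apply: (pb_Q_eq (mu := wedge (Acst P c) (pb_Q d x).2 + (pb_Q d y).2)) => // w hw.
have -> : (pb_act (Acst P c) x + y).2 = wedge (Acst P c) x.2 + y.2 by [].
have -> : (pb_act (Acst P c) x + y).1 (ipull w) = wedge (Acst P c) (x.1 (ipull w)) + y.1 (ipull w) by [].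
rewrite !iota_nuD !iota_wedge brx // bry //.
rewrite (gd_D gA) (wedge_Acst_gder _ gA (dA_Acst c)) !wedgeDr wedgeNr !wedge_signedr !signedD.
by zmod.
Qed.

Variable (S : splitting P).
Local Notation B := (sp_B S).
Local Notation i_ := (smap (lp_i P)).
Local Notation q_ := (smap (sp_q S)).
Local Notation j_ := (smap (sp_j S)).
Local Notation p_ := (smap (sp_p S)).

(* [i^*] is onto since [p i = id], so the first component of a section is
   determined by its second component and that of its differential. *)
Lemma pb_ext d x y : pb_section d x -> pb_section d y -> x.2 = y.2 ->
  (pb_Q d x).2 = (pb_Q d y).2 -> x = y.
Proof.
move=> px py E2 EQ; rewrite (surjective_pairing x) (surjective_pairing y) E2.
congr (_, _); apply/funext => w.
have -> : w = ipull (fpull p_ w).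
  apply: form_ext => s; rewrite !fpullE -map_comp -[in LHS](map_id s).
  by congr (w _); apply: eq_map => a /=; rewrite sm_pi.
by rewrite (pb_ipullE _ px) (pb_ipullE _ py) E2 EQ.
Qed.

Lemma dBottE (beta : Aform P B) s :
  dBott beta s = kz (@lbr _ _ _ A) (@bott _ _ _ P S) beta s.
Proof.
exact: (CEE _ _ (algebroid_lie_rinehart A) (algebroid_flat_rep A) (bott_flat_rep S)).
Qed.

Lemma dBott_defect d (zeta : {linear vsection B -> Cinf^o}) (beta : Aform P B) s :
  homog d beta -> zeta (dBott beta s) =
  kz (@lbr _ _ _ A) (@anchor _ _ _ A : _ -> Cinf^o -> Cinf^o) (fun t => zeta (beta t)) s +
  signed (odd (absz d)) (pwedge (conn_defect (@anchor _ _ _ A) (@bott _ _ _ P S) zeta) beta s).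
Proof.
move=> hb; have FR := algebroid_flat_rep A; have FB := bott_flat_rep S.
rewrite dBottE (kz_defect FR zeta _ _ FB); congr (_ + _).
rewrite (@eq_pwedge _ _ _ _ (conn_defect (@anchor _ _ _ A) (@bott _ _ _ P S) zeta)
  (conn_defect (@anchor _ _ _ A) (@bott _ _ _ P S) zeta) (eps beta)
  (fun t => (-1) ^+ odd (absz d) *: beta t)) //; last exact: (eps_homog (homog_absz hb)).
rewrite pwedgeZ; last exact: (conn_defect_lin FR zeta FB).
by case: (odd _); rewrite /= ?scaleN1r ?scale1r.
Qed.

Lemma iota_form_map (E : vbundle M g) (h : {linear vsection E -> vsection L})
    (beta : Aform P E) w s :
  iota_form (form_map h beta) w s =
  pwedge (fun b => form_val (ipull (iprod (h b) w))) beta s.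
Proof. exact: (pwedge_map h (fun l => form_val (ipull (iprod l w))) beta s). Qed.

Lemma dA_iota_one nu (w : form (vsection L) Cinf^o) s : homog 1 w -> dA (iota_form nu w) s =
  kz (@lbr _ _ _ A) (@anchor _ _ _ A : _ -> Cinf^o -> Cinf^o) (fun t => w [:: nu t]) s.
Proof.
move=> hw; have FR := algebroid_flat_rep A.
rewrite [LHS](CEE _ _ (algebroid_lie_rinehart A) FR FR).
by apply: eq_kz => t; rewrite iota_one.
Qed.

(** Tested on 1-forms on [L] pulled back along [q]: they vanish on [A], so the first component of
    the section drops out. *)
Lemma P0_chain d x : pb_section d x -> P0 S (pb_Q d x) = dBott (P0 S x).
Proof.
move=> px; have [br _ _] := pb_Q_spec px; have hn := pb_homog px.
apply: form_sep => zeta hz s.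
have [h zh] := form1P hz.
pose w := fpull q_ zeta.
have hw : homog 1 w by exact: fpull_homog.
have iw0 : ipull w = 0.
  apply: homog1_ext => //; first exact: fpull_homog.
  by move=> a; rewrite !fpullE /= sm_qi (@mlin0 _ _ _ zeta [::] [::] (form_mlin zeta)).
rewrite -[LHS]/(w [:: (pb_Q d x).2 s]) -iota_one // br // iw0.
rewrite (gd_0 (pb_gder px)) signed0 subr0 formDE dA_iota_one //.
have zE v : zeta [:: v] = h v by rewrite zh.
rewrite [RHS]zE.
rewrite (dBott_defect h s (form_map_homog _ hn)); congr (_ + _).
  by apply: eq_kz => t; rewrite -zE.
rewrite signedE; congr (signed _ _).
rewrite [RHS](pwedge_map q_); apply: eq_pwedge => // l.
have hl : homog 1 (ipull (iprod l (dL w))).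
  apply: fpull_homog => t ht; apply: (dL_homog hw) => E; apply: ht; move: E => /=; lia.
move=> [|a [|a' t]]; try by rewrite hl.
rewrite -[LHS]/(dL w [:: l; i_ a]) dL_one // !fpullE /= sm_qi.
rewrite (@mlin0 _ _ _ zeta [::] [::] (form_mlin zeta)) anchor0 sub0r.
rewrite lp_i_anchor lbr_antisym smapN !zE linearN opprK addrC.
by rewrite /bott q_lbr_i.
Qed.

Lemma is_differential_I0 d (beta : Aform P B) : homog d beta ->
  is_differential d (I0 beta).1 (I0 beta).2 (form_map j_ (dBott beta)).
Proof.
move=> hb w hw; have [h wh] := form1P hw; rewrite (I0E hb) /=.
pose zeta : {linear vsection B -> Cinf^o} := h \o j_.
apply: form_ext => s; rewrite iota_one //.
rewrite !formDE formNE !signedE dA_iota_one // {1}wh.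
rewrite -[LHS]/(zeta (dBott beta s)) (dBott_defect zeta s hb) -addrA; congr (_ + _).
  by apply: eq_kz => t; rewrite wh.
rewrite addrC -signedN -signedD; congr (signed _ _).
rewrite iota_form_map -pwedge_DN -pwedge_DD; apply: eq_pwedge => // b.
have hl : homog 1 (ipull (iprod (j_ b) (dL w))).
  apply: fpull_homog => t ht; apply: (dL_homog hw) => E; apply: ht; move: E => /=; lia.
have hD : homog 1 (Delta (S := S) b (ipull w)).
  by rewrite DeltaE; apply: Deltaf_homog; exact: fpull_homog.
move=> [|a [|a' t]]; try by rewrite hl // hD // subr0.
rewrite -[X in _ = X - _]/(dL w [:: j_ b; i_ a]) dL_one // DeltaE.
rewrite -[Deltaf b (ipull w) [:: a]]/(anchor (j_ b) (w [:: i_ a]) - w [:: i_ (tau b a)]).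
rewrite lp_i_anchor wh /= /tau.
(* The [A]-part of [j b, i a] is the one in [Delta], the [B]-part is minus the Bott derivative. *)
have E : h (lbr (j_ b) (i_ a)) = h (i_ (p_ (lbr (j_ b) (i_ a)))) - h (j_ (bott a b)).
  rewrite {1}(sm_split S (lbr (j_ b) (i_ a))) linearD; congr (_ + _).
  by rewrite lbr_antisym /bott !smapN linearN.
rewrite E; zmod.
Qed.

Lemma is_differential_H0 d x : pb_section d x ->
  is_differential (d - 1) (H0 S x).1 (H0 S x).2 (form_map i_ (form_map p_ x.2)).
Proof.
move=> px w hw; have hn := pb_homog px; rewrite (H0E S hn) /= !iota_0.
rewrite (gd_0 (@dA_gder _ _ _ P)) signed0 addr0 sub0r.
have -> : odd (absz (d - 1)) = ~~ odd (absz d) by rewrite odd_abszD addbT.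
apply: form_ext => s; rewrite iota_one // formNE signedE.
have -> : fpwedge (iprod_lin S (ipull w)) (feps x.2) s =
    signed (odd (absz d)) (w [:: i_ (p_ (x.2 s))]).
  rewrite (feps_homog hn).
  rewrite [LHS](@eq_pwedge _ _ _ _ _ (fun v t => if t is [::] then w [:: i_ (p_ v)] else 0)
    (signed (odd (absz d)) x.2) (signed (odd (absz d)) x.2)) //.
    rewrite (pwedge_form0 (fun v => w [:: i_ (p_ v)])) signedE.
    case: (odd _) => //=; rewrite !smapN.
    exact: (@mlinN _ _ _ w [::] [::] _ (form_mlin w)).
  by move=> v [|a t] //; rewrite /= hw.
by case: (odd _) => /=; rewrite ?opprK.
Qed.

End Differential.

Section ContractionData.
Context {R : realType} {M : manifold R} {g : ground} (P : lie_pair M g).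
Variable (S : splitting P).
Local Notation Cinf := (smoothfun M g).
Local Notation A := (lp_A P).
Local Notation B := (sp_B S).
Local Notation i_ := (smap (lp_i P)).
Local Notation q_ := (smap (sp_q S)).
Local Notation j_ := (smap (sp_j S)).
Local Notation p_ := (smap (sp_p S)).
Implicit Types (x y : pbpair P) (d : int).

Lemma pb_section_s : pb_section 1 (@pb_s _ _ _ P).
Proof.
split=> /=; last 2 first.
- exact: homog_form1.
- move=> f s; rewrite [LHS]dA_form0; case: s => [|a [|b s]] /=.
  + by rewrite anchor_sec0.
  + by rewrite lp_i_anchor.
  + by rewrite anchor_sec0.
by apply: gder_derivation; [exact: dA_gder|exact: dA_homog|exact: dA_Acst].
Qed.

Lemma wedge_Acst1 (W : lmodType Cinf) (w : form (vsection A) W) : wedge (Acst P 1) w = w.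
Proof. by rewrite /Acst /Afun0 smooth_cst1 wedge1. Qed.

Lemma wedge_AcstN1 (W : lmodType Cinf) (w : form (vsection A) W) :
  wedge (Acst P (-1)) w = - w.
Proof.
apply: form_ext => s; rewrite wedge_form0 formNE.
have -> : smooth_cst M (-1) = -1 :> Cinf by exact: sf_ext.
by rewrite scaleN1r.
Qed.

(** With [pb_actN1], derives sums and differences from the single linearity statement with a
    constant coefficient. *)
Lemma pb_act1 x : pb_act (Acst P 1) x = x.
Proof.
rewrite [RHS]surjective_pairing /pb_act wedge_Acst1; congr (_, _).
by apply/funext => w; rewrite wedge_Acst1.
Qed.

Lemma pb_actN1 x : pb_act (Acst P (-1)) x = - x.
Proof.
rewrite /pb_act wedge_AcstN1 [RHS]surjective_pairing; congr (_, _).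
by apply/funext => w; rewrite wedge_AcstN1.
Qed.

Lemma pb_sectionD d x y : pb_section d x -> pb_section d y -> pb_section d (x + y).
Proof. by move=> px py; rewrite -(pb_act1 x); exact: pb_section_lin. Qed.

Lemma pb_sectionB d x y : pb_section d x -> pb_section d y -> pb_section d (x - y).
Proof. by move=> px py; rewrite addrC -(pb_actN1 y); exact: pb_section_lin. Qed.

Lemma pb_QD d x y : pb_section d x -> pb_section d y ->
  pb_Q d (x + y) = pb_Q d x + pb_Q d y.
Proof.
by move=> px py; have := pb_Q_lin 1 px py; rewrite !pb_act1.
Qed.

Lemma pb_QB d x y : pb_section d x -> pb_section d y ->
  pb_Q d (x - y) = pb_Q d x - pb_Q d y.
Proof.
move=> px py; have := pb_Q_lin (-1) py px; rewrite !pb_actN1.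
by rewrite addrC => ->; rewrite addrC.
Qed.

Lemma dBott_dBott (beta : Aform P B) : dBott (dBott beta) = 0.
Proof.
exact: (CE_CE (algebroid_lie_rinehart A) (algebroid_flat_rep A) (bott_flat_rep S)).
Qed.

Lemma dBott_homog d (beta : Aform P B) : homog d beta -> homog (d + 1) (dBott beta).
Proof.
exact: (CE_homog (algebroid_lie_rinehart A) (algebroid_flat_rep A) (bott_flat_rep S)).
Qed.

Lemma dBott_lin c (beta beta' : Aform P B) :
  dBott (wedge (Acst P c) beta + beta') = wedge (Acst P c) (dBott beta) + dBott beta'.
Proof.
have LR := algebroid_lie_rinehart A; have FR := algebroid_flat_rep A.
have FB := bott_flat_rep S.
rewrite /dBott (CE_D LR FR FB) (CE_wedge LR FR FB).
by rewrite [CE _ _ (Acst P c)]dA_Acst wedge0l add0r -[feps _]/(fepsb true _) [fepsb _ _]fepsb_form0.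
Qed.

(** * Contraction identities and graded linearity *)

Lemma pb_Q_I0 d (beta : Aform P B) : homog d beta ->
  (pb_Q d (I0 beta)).2 = form_map j_ (dBott beta).
Proof. by move=> hb; exact: pb_Q_eq (pb_section_I0 hb) (is_differential_I0 hb). Qed.

Lemma pb_Q_H0 d x : pb_section d x ->
  (pb_Q (d - 1) (H0 S x)).2 = form_map i_ (form_map p_ x.2).
Proof. by move=> px; exact: pb_Q_eq (pb_section_H0 S px) (is_differential_H0 S px). Qed.

Lemma I0_chain d (beta : Aform P B) : homog d beta ->
  I0 (dBott beta) = pb_Q d (I0 beta).
Proof.
move=> hb; have hdb := dBott_homog hb; have pI := pb_section_I0 hb.
apply: (pb_ext S (pb_section_I0 hdb) (pb_section_Q pI)).
  by rewrite pb_Q_I0.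
(* Both differentials vanish, one because the Bott connection is flat and the other because Q^2 =
   0. *)
rewrite pb_Q_I0 // (pb_Q_Q pI) dBott_dBott.
by apply: form_ext => s; exact: linear0.
Qed.

Lemma IP_homotopy d x : pb_section d x ->
  I0 (P0 S x) = x - (H0 S (pb_Q d x) + pb_Q (d - 1) (H0 S x)).
Proof.
move=> px; have pQ := pb_section_Q px; have pH := pb_section_H0 S px.
have pHQ := pb_section_H0 S pQ; have pQH := pb_section_Q pH.
have hP : homog d (P0 S x) by exact: form_map_homog (pb_homog px).
have QHQ := pb_Q_H0 pQ; have QQH := pb_Q_Q pH.
rewrite addrK in pHQ QHQ; rewrite subrK in pQH QQH.
have pHH := pb_sectionD pHQ pQH.
have splitB v : v - i_ (p_ v) = j_ (q_ v) by rewrite {1}(sm_split S v) addrAC subrr add0r.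
apply: (pb_ext S (pb_section_I0 hP) (pb_sectionB px pHH)).
  apply: form_ext => s.
  rewrite -[RHS]/(x.2 s - (0 + (pb_Q (d - 1) (H0 S x)).2 s)) add0r pb_Q_H0 //.
  by rewrite splitB.
(* After Q Q H = 0, the remaining identity is the same splitting of [L], now applied to the second
   component of Q x. *)
rewrite pb_QB // pb_QD // QQH addr0 pb_Q_I0 // -(P0_chain S px).
rewrite -[RHS]/((pb_Q d x).2 - (pb_Q d (H0 S (pb_Q d x))).2) QHQ.
apply: form_ext => s; rewrite formDE formNE.
by rewrite splitB.
Qed.

(** [H0] depends only on the [A]-part of the second component; this yields H^2 = 0 and H I = 0. *)
Lemma H0_eq0 d x : homog d x.2 -> (forall s, p_ (x.2 s) = 0) -> H0 S x = 0.
Proof.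
move=> hx px0; rewrite (H0E S hx) [RHS]surjective_pairing; congr (_, _).
apply/funext => w; apply: form_ext => s; rewrite /= -[LHS](pwedge_map p_
  (fun a => form_val (iprod a w)) (eps x.2) s).
rewrite (@eq_pwedge _ _ _ _ _ (fun a => form_val (iprod a w)) _ (fun=> 0)) //.
  apply: pwedge0 => c u v t; exact: (form_mlin w [::]).
by move=> t; have := smapZ (sp_p S) ((-1) ^+ size t) (x.2 t); rewrite px0 scaler0.
Qed.

Lemma pb_contraction : contraction
  (fun d => [set x | pb_section d x]) (@pb_Q _ _ _ P)
  (fun d => [set w | homog d w]) (fun=> @dBott _ _ _ P S)
  (P0 S) (@I0 _ _ _ P S) (H0 S).
Proof.
split=> /= [d x px|d y hy|d x px|d x px|d y hy|d y hy|d x px|d x px|d y hy|d x px].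
- exact: form_map_homog (pb_homog px).
- exact: pb_section_I0.
- exact: pb_section_H0.
- exact: P0_chain.
- exact: I0_chain.
- by apply: form_ext => s; exact: sm_qj.
- exact: IP_homotopy.
- by apply: (H0_eq0 (d := d - 1)) => // s; exact: smap0.
- apply: (H0_eq0 (d := d)); first exact: form_map_homog.
  by move=> s; exact: sm_pj.
- by apply: form_ext => s; exact: smap0.
Qed.

Lemma P0_graded_linear : graded_linear (fun k => [set f : Afun P | homog k f])
  (@pb_act _ _ _ P) (@wedge _ _ _) (fun d => [set x | pb_section d x]) 0 (P0 S).
Proof.
split=> [d x y _ _|k d f x _ _]; first exact: form_mapD.
by rewrite mulr0 mulrz_sg; exact: form_map_wedge.
Qed.

Lemma I0_graded_linear : graded_linear (fun k => [set f : Afun P | homog k f])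
  (@wedge _ _ _) (@pb_act _ _ _ P) (fun d => [set w | homog d w]) 0 (@I0 _ _ _ P S).
Proof.
split=> [d x y hx hy|k d f x hf hx].
  rewrite (I0E (homogD hx hy)) (I0E hx) (I0E hy) form_mapD; congr (_, _).
  by apply/funext => w; exact: fpwedgeD.
rewrite mulr0 mulrz_sg (I0E (homog_wedge hf hx)) (I0E hx) form_map_wedge; congr (_, _).
by apply/funext => w; exact: fpwedge_wedge.
Qed.

Lemma H0_graded_linear : graded_linear (fun k => [set f : Afun P | homog k f])
  (@pb_act _ _ _ P) (@pb_act _ _ _ P) (fun d => [set x | pb_section d x]) (-1) (H0 S).
Proof.
split=> [d x y px py|k d f x hf px].
  have [hx hy] := (pb_homog px, pb_homog py).
  rewrite (H0E S (x := x + y) (homogD hx hy)) (H0E S hx) (H0E S hy); congr (_, _).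
    by apply/funext => w; rewrite [feps _]fepsD fpwedgeD.
  by rewrite addr0.
have hx := pb_homog px.
rewrite mulrz_sg odd_abszM andbT (H0E S (x := pb_act f x) (homog_wedge hf hx)) (H0E S hx).
(* The Koszul sign (-1)^|f| comes from the parity operator that [H0] applies to the product. *)
rewrite /pb_act /= wedge0r -feps_wedge (feps_homog hf) wedge_signedl.
have -> : (fun w => fpwedge (iprod_lin S w) (signed (odd `|k|%N) (wedge f (feps x.2)))) =
    signed (odd `|k|%N) (fun w => wedge f (fpwedge (iprod_lin S w) (feps x.2))).
  apply/funext => w; case: (odd _); last exact: fpwedge_wedge.
  rewrite -[RHS]/(- wedge f (fpwedge (iprod_lin S w) (feps x.2))) -fpwedge_wedge.
  by apply: form_ext => s; apply: pwedgeN; exact: iprod_lin.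
by case: (odd _) => //=; rewrite [RHS]surjective_pairing /= oppr0.
Qed.

End ContractionData.

Theorem theorem3p1 (R : realType) (M : manifold R) (g : ground)
    (P : lie_pair M g) (S : splitting P) :
  [/\ pb_section 1 (pb_s P) /\
      (forall d x, pb_section d x ->
        pb_bracket_form 1 d (pb_s P) x (pb_Q d x).2),
      cochain_complex (fun c x => pb_act (Acst P c) x)
        (fun d => [set x | pb_section d x]) (@pb_Q _ _ _ P),
      cochain_complex (fun c w => wedge (Acst P c) w)
        (fun d => [set w | homog d w]) (fun=> @dBott _ _ _ P S),
      contraction
        (fun d => [set x | pb_section d x]) (@pb_Q _ _ _ P)
        (fun d => [set w | homog d w]) (fun=> @dBott _ _ _ P S)
        (P0 S) (@I0 _ _ _ P S) (H0 S) &
      [/\ graded_linear (fun k => [set f : Afun P | homog k f])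
            (@pb_act _ _ _ P) (@wedge _ _ _)
            (fun d => [set x | pb_section d x]) 0 (P0 S),
          graded_linear (fun k => [set f : Afun P | homog k f])
            (@wedge _ _ _) (@pb_act _ _ _ P)
            (fun d => [set w | homog d w]) 0 (@I0 _ _ _ P S) &
          graded_linear (fun k => [set f : Afun P | homog k f])
            (@pb_act _ _ _ P) (@pb_act _ _ _ P)
            (fun d => [set x | pb_section d x]) (-1) (H0 S)]].
Proof.
split; [split| | | |split].
- exact: pb_section_s.
- by move=> d x /pb_Q_spec[].
- split=> /= [d|d c x y px py|d x px|d c x y px py|d x px].
  + exact: pb_section0.
  + exact: pb_section_lin.
  + exact: pb_section_Q.
  + exact: pb_Q_lin.
  + exact: pb_Q_Q.
- split=> /= [d|d c x y hx hy|d x hx|d c x y hx hy|d x hx].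
  + exact: homog0.
  + by apply: homogD => //; rewrite -[d]add0r; apply: homog_wedge => //; exact: homog_form0.
  + exact: dBott_homog.
  + exact: dBott_lin.
  + exact: dBott_dBott.
- exact: pb_contraction.
- exact: P0_graded_linear.
- exact: I0_graded_linear.
- exact: H0_graded_linear.
Qed.
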